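(* Let $\Gamma$ be an infinite weighted graph (as in the context) satisfying $(D)$, $(L_2)$ and $(P_2)$. Let $L$ be a second order uniformly elliptic operator on $L^2(\Gamma)$ with ellipticity constants $C_\infty$ and $\delta$. Let $\omega\in(0,\frac\pi2)$ be such that $L$ is $\omega$-accretive on $L^2(\Gamma)$, let $\nu\in(\frac\pi2,\pi-\omega)$, and let $\Sigma_\nu=\{z\in\mathbb{C}:\ z=0\text{ or }|\arg z|<\nu\}$. Then for all $f\in L^2(\Gamma)$ and all $\lambda\in\Sigma_\nu$, there exists a unique $u\in W^{1,2}(\Gamma)$ which is a weak solution of $Lu+\lambda u=f$, i.e. such that for all $v\in W^{1,2}(\Gamma)$ $$\sum_{(x,y)\in E}c_{xy}\,du(x,y)\overline{dv(x,y)}\mu_{xy}+\lambda\sum_{x\in\Gamma}u(x)\overline{v(x)}m(x)=\sum_{x\in\Gamma}f(x)\overline{v(x)}m(x).$$ Moreover, there exist $C,\eta>0$ only depending on the constants in $(D)$, $(L_2)$ and $(P_2)$ and the constants of ellipticity of $L$ such that $$\|u\|_{L^\infty(\Gamma)}\le C|\lambda|^{-\frac12}\|f\|_{L^2(\Gamma)}$$ and $$|u|_{\dot C^\eta(\Gamma)}\le C|\lambda|^{\frac\eta2}|\lambda|^{-\frac12}\|f\|_{L^2(\Gamma)}.$$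
   Context: Graph. $\Gamma$ is an infinite set with a symmetric weight $h_{xy}=h_{yx}\ge0$, $h_{xx}=0$; $x\sim y$ means $h_{xy}>0$ or $x=y$; $E=\{(x,y):x\sim y\}$; $h_x=\sup_{y\sim x}h_{xy}$. Standing assumptions: there is $N$ with $\#\{y:y\sim x\}\le N$ for all $x$; there is $C_W\ge1$ with $C_W^{-1}\le h_{xy}/h_{xz}\le C_W$ whenever $x\sim y$, $x\sim z$, $y\ne x$, $z\ne x$; $\Gamma$ is connected (any $x,y$ are joined by a finite path $x=x_0\sim x_1\sim\dots\sim x_n=y$, of length $\sum_k h_{x_kx_{k+1}}$); coefficients $\mu_{xy}=\mu_{yx}>0$ are given for $x\sim y$ (including $x=y$), and there is a constant $C_\mu$ with $\mu_{xy}/\mu_{xz}\le C_\mu$ whenever $x\sim y$, $x\sim z$. $d(x,y)$ is the infimum of the lengths of paths joining $x$ to $y$; $B(x,r)=\{y:d(x,y)<r\}$; $m(x)=\sum_{y\sim x}\mu_{xy}$, $m(A)=\sum_{x\in A}m(x)$, $V(x,r)=m(B(x,r))$. Function spaces (complex-valued functions). $\|f\|_{L^p(\Gamma)}=(\sum_x|f(x)|^pm(x))^{1/p}$, $\|f\|_{L^\infty(\Gamma)}=\sup|f|$. $df(x,y)=(f(y)-f(x))/h_{xy}$ if $x\ne y$, $df(x,x)=0$. $\nabla f(x)=\frac1{h_x}\big(\sum_{y\sim x}|f(y)-f(x)|^2\big)^{1/2}$. $W^{1,p}(\Gamma)$: $\|f\|_{W^{1,p}}=\|f\|_{L^p}+\|\nabla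 f\|_{L^p}<\infty$. $|u|_{\dot C^\eta(\Gamma)}=\sup_{x\ne y}|u(x)-u(y)|/d(x,y)^\eta$. Geometric assumptions. $(D)$: there is $C$ with $V(x,2r)\le CV(x,r)$ for all $x$, $r>0$. $(L_2)$: there is $c>0$ with $V(x,r)\ge cr^2$ for all $x$, $r>0$. $(P_2)$: there is $C$ with $\sum_{y\in B}|f(y)-f_B|^2m(y)\le Cr^2\sum_{y\in B}|\nabla f(y)|^2m(y)$ for all balls $B=B(x,r)$, $r>0$, and all $f$, where $f_B=\frac1{m(B)}\sum_{y\in B}f(y)m(y)$. Operator. Coefficients $c_{xy}\in\mathbb{C}$, $x\sim y$, are given with $|c_{xy}|\le C_\infty$ and, for all $u\in W^{1,2}(\Gamma)$, $\mathrm{Re}\sum_{(x,y)\in E}c_{xy}|du(x,y)|^2\mu_{xy}\ge\delta\sum_{(x,y)\in E}|du(x,y)|^2\mu_{xy}$, where $C_\infty,\delta>0$ (no positivity of the $c_{xy}$ is assumed). $L$ is the unique maximal accretive operator on $L^2(\Gamma)$ such that for all $u\in\mathcal{D}(L)$ (the domain of $L$) and $v\in W^{1,2}(\Gamma)$, $\sum_xLu(x)\overline{v(x)}m(x)=\sum_{(x,y)\in E}c_{xy}du(x,y)\overline{dv(x,y)}\mu_{xy}$; it is called a second order uniformly elliptic operator with ellipticity constants $C_\infty,\delta$. $L$ is $\omega$-accretive if $\langle Lu,u\rangle$ lies in the closed sector $\{z=0\text{ or }|\arg z|\le\omega\}$ for all $u\in\mathcal{D}(L)$.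
   Formalization: The formal theorem assumes λ ≠ 0 (at λ = 0 existence fails, e.g. the Laplacian on Z², and the bounds are undefined) and lets C, η depend also on N, C_W, C_μ, ω and ν (C must depend on C_μ, ω and ν). *)

(* Defs.v *)
From HB Require Import structures.
From mathcomp Require Import all_boot all_order all_algebra.
From mathcomp Require Import all_classical all_reals all_analysis.
From mathcomp.real_closed Require Import complex.

Set Implicit Arguments.
Unset Strict Implicit.
Unset Printing Implicit Defensive.

Import Order.TTheory GRing.Theory Num.Theory.
Import numFieldNormedType.Exports.

Local Open Scope classical_set_scope.
Local Open Scope ring_scope.

Notation cmod := ComplexField.Normc.normc.

Section Complex.
Context {R : realType}.
Implicit Types z : R[i].

(* Principal argument, in ]-pi, pi]; only meaningful for z != 0. *)
Definition carg z : R :=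
  if 0 <= complex.Im z then acos (complex.Re z / cmod z)
  else - acos (complex.Re z / cmod z).

Definition open_sector (a : R) : set R[i] :=
  [set z | z = 0 \/ `|carg z| < a].

Definition closed_sector (a : R) : set R[i] :=
  [set z | z = 0 \/ `|carg z| <= a].

(* Sums of absolutely summable families; [\esum] is only meaningful on
   nonnegative terms, whence the decomposition into f^+ - f^-. *)
Definition rsum (T : choiceType) (D : set T) (f : T -> R) : R :=
  fine (\esum_(x in D) (Num.max (f x) 0)%:E)
  - fine (\esum_(x in D) (Num.max (- f x) 0)%:E).

Definition csum (T : choiceType) (D : set T) (f : T -> R[i]) : R[i] :=
  Complex (rsum D (fun x => complex.Re (f x)))
          (rsum D (fun x => complex.Im (f x))).

End Complex.

Section Paths.
Context {R : realType} {T : choiceType} (h : T -> T -> R).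

Definition adj_of : rel T := fun x y => (0 < h x y) || (x == y).

Fixpoint path_length (x : T) (p : seq T) : R :=
  if p is y :: q then h x y + path_length y q else 0.

Definition joins (x y : T) (p : seq T) : Prop :=
  path adj_of x p /\ last x p = y.

End Paths.

(* mu x y (and, below, c x y) is only relevant when x ~ y. *)
Record wgraph (R : realType) := WGraph {
  vertex :> choiceType;
  h : vertex -> vertex -> R;
  mu : vertex -> vertex -> R;
  wgraph_infinite : infinite_set [set: vertex];
  h_sym : forall x y, h x y = h y x;
  h_ge0 : forall x y, 0 <= h x y;
  h_diag : forall x, h x x = 0;
  wgraph_connected : forall x y, exists p, joins h x y p;
  mu_sym : forall x y, adj_of h x y -> mu x y = mu y x;
  mu_gt0 : forall x y, adj_of h x y -> 0 < mu x y }.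

Section Graph.
Context {R : realType} (X : wgraph R).
Implicit Types (x y z : X) (f g u v : X -> R[i]).

Definition adj : rel X := adj_of (@h R X).
Definition nbr x : set X := [set y | adj x y].
Definition edges : set (X * X) := [set e | adj e.1 e.2].
Definition hv x : R := sup [set h x y | y in nbr x].

Definition bounded_geometry (N : nat) (CW Cmu : R) : Prop :=
  [/\ forall x, (nbr x #<= `I_N)%card,
      1 <= CW,
      forall x y z, adj x y -> adj x z -> y <> x -> z <> x ->
        CW^-1 <= h x y / h x z <= CW
    & forall x y z, adj x y -> adj x z -> mu x y / mu x z <= Cmu].

Definition dist x y : R :=
  inf [set path_length (@h R X) x p | p in joins (@h R X) x y].
Definition gball x (r : R) : set X := [set y | dist x y < r].

Definition mass x : R := \sum_(y \in nbr x) mu x y.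
Definition vmeasure (A : set X) : \bar R := \esum_(x in A) (mass x)%:E.
Definition vol x (r : R) : \bar R := vmeasure (gball x r).

Definition normL2 f : \bar R :=
  sqrte (\esum_(x in [set: X]) (cmod (f x) ^+ 2 * mass x)%:E).
Definition normLinf f : \bar R := ereal_sup [set (cmod (f x))%:E | x in setT].
Definition inner f g : R[i] :=
  csum [set: X] (fun x => f x * conjc (g x) * (mass x)%:C%C).
Definition L2 : set (X -> R[i]) := [set f | (normL2 f < +oo)%E].

Definition df f x y : R[i] :=
  if x == y then 0 else (f y - f x) / (h x y)%:C%C.
Definition grad f x : R :=
  (hv x)^-1 * Num.sqrt (\sum_(y \in nbr x) cmod (f y - f x) ^+ 2).

Definition normW12 f : \bar R :=
  (normL2 f + normL2 (fun x => (grad f x)%:C%C))%E.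
Definition W12 : set (X -> R[i]) := [set f | (normW12 f < +oo)%E].

Definition holder_seminorm (eta : R) u : \bar R :=
  ereal_sup [set (cmod (u e.1 - u e.2) / dist e.1 e.2 `^ eta)%:E
            | e in [set e : X * X | e.1 <> e.2]].

Definition doubling (C : R) : Prop :=
  forall x (r : R), 0 < r -> (vol x (2 * r) <= C%:E * vol x r)%E.

Definition lower_volume2 (c : R) : Prop :=
  0 < c /\ forall x (r : R), 0 < r -> ((c * r ^+ 2)%:E <= vol x r)%E.

Definition mean (B : set X) f : R[i] :=
  csum B (fun y => f y * (mass y)%:C%C) / (fine (vmeasure B))%:C%C.

(* A ball may be infinite: f ranges over all functions which are summable on
   the ball, i.e., whose mean over it makes sense. *)
Definition poincare2 (C : R) : Prop :=
  forall x (r : R), 0 < r -> let B := gball x r in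
  forall f, summable B (fun y => (cmod (f y) * mass y)%:E) ->
    (\esum_(y in B) (cmod (f y - mean B f) ^+ 2 * mass y)%:E <=
     (C * r ^+ 2)%:E * \esum_(y in B) (grad f y ^+ 2 * mass y)%:E)%E.

Definition form (c : X -> X -> R[i]) u v : R[i] :=
  csum edges (fun e => c e.1 e.2 * df u e.1 e.2 * conjc (df v e.1 e.2)
                       * (mu e.1 e.2)%:C%C).

Definition uniformly_elliptic (Cinf delta : R) (c : X -> X -> R[i]) : Prop :=
  [/\ 0 < Cinf, 0 < delta,
      forall x y, adj x y -> cmod (c x y) <= Cinf
    & forall u, W12 u ->
        delta * rsum edges (fun e => cmod (df u e.1 e.2) ^+ 2 * mu e.1 e.2)
        <= complex.Re (csum edges (fun e =>
             c e.1 e.2 * (cmod (df u e.1 e.2) ^+ 2 * mu e.1 e.2)%:C%C))].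

(* Unbounded linear operators on L^2; the values of [op] outside of [dom]
   are irrelevant. *)
Record operator := Operator {
  dom : set (X -> R[i]);
  op : (X -> R[i]) -> X -> R[i];
  dom_L2 : dom `<=` L2;
  op_L2 : forall u, dom u -> L2 (op u);
  dom0 : dom (fun=> 0);
  dom_lin : forall (a : R[i]) u v,
    dom u -> dom v -> dom (fun x => a * u x + v x);
  op_lin : forall (a : R[i]) u v,
    dom u -> dom v ->
    op (fun x => a * u x + v x) = (fun x => a * op u x + op v x) }.

Definition accretive (L : operator) : Prop :=
  forall u, dom L u -> 0 <= complex.Re (inner (op L u) u).

Definition extends (M L : operator) : Prop :=
  dom L `<=` dom M /\ forall u, dom L u -> op M u = op L u.

Definition maximal_accretive (L : operator) : Prop :=
  accretive L /\
  forall M, accretive M -> extends M L -> dom M `<=` dom L.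

Definition associated_operator (c : X -> X -> R[i]) (L : operator) : Prop :=
  [/\ maximal_accretive L,
      dom L `<=` W12
    & forall u v, dom L u -> W12 v -> inner (op L u) v = form c u v].

Definition omega_accretive (omega : R) (L : operator) : Prop :=
  forall u, dom L u -> closed_sector omega (inner (op L u) u).

Definition weak_solution (c : X -> X -> R[i]) (lambda : R[i]) f u : Prop :=
  W12 u /\ forall v, W12 v -> form c u v + lambda * inner u v = inner f v.

End Graph.

(* Main.v *)
(** Since the coefficients are complex, there is no De Giorgi-Nash theory; the
    Hoelder regularity comes from Morrey's method in dimension two. If u solves
    the equation with source g, a Caccioppoli inequality with a cutoff averaged
    over M dyadic scales loses only O(1/M) of the energy. Hence, for some q, the
    energy of u on B(o, rho/2^q) is at most half of its energy on B(o, rho), up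
    to C rho^2 |g|^2. As V(x, r) >= c r^2, the Poincare inequality turns this
    decay into geometric decay of the differences of means of u over concentric
    balls, which yields the L^oo bound and the Hoelder exponent 1/(2q). Below the
    scale h_o the balls are singletons and there is nothing to prove.

    The form inherits the sector of angle omega from L, because D(L) is dense in
    W^{1,2} for the form norm. A rotation by a unimodular a then makes
    a (form + lambda) coercive: Lax-Milgram gives u, together with bounds for
    |u| and |du|, and the regularity estimates are applied at the scale
    r = |lambda|^{-1/2} with g = f - lambda u. *)

Require Import Defs.
From mathcomp Require Import finmap.
From mathcomp Require Import all_boot all_order all_algebra.
From mathcomp Require Import all_classical all_reals all_analysis.
From mathcomp.real_closed Require Import complex.
From mathcomp Require Import ring lra.

Set Implicit Arguments.
Unset Strict Implicit.
Unset Printing Implicit Defensive.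

Import Order.TTheory GRing.Theory Num.Theory.
Import numFieldNormedType.Exports.

Local Open Scope classical_set_scope.
Local Open Scope ring_scope.

(** * The modulus on [R[i]] *)

Section ComplexModulus.
Context {R : realType}.
Implicit Types z w : R[i].

(** Two features of the hypotheses shape the argument. Ellipticity is an inequality between sums
    over all edges, so it can only be applied to a globally defined localized function, never edge
    by edge on a ball. The Poincaré inequality is given on balls, not on annuli, so the classical
    hole-filling trick, which compares the energy of a ball with that of a surrounding annulus, is
    not at hand; and a single cutoff controlled by Poincaré on a ball only returns a multiple of the
    initial energy, without any decay. Averaging over scales supplies the missing gain. Since the
    subtracted mean changes with the scale, the localization is not multiplication by one function,
    and the usual squared cutoff is replaced by localizing twice. Discreteness costs a factor: an
    edge starting in a ball of radius at least [hv o / CW] stays in the ball enlarged by [1 + CW],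
    so each decay step must shrink the radius by somewhat more than the M dyadic scales. *)

Lemma cmod_ge0 z : 0 <= cmod z.
Proof. by case: z => a b; exact: sqrtr_ge0. Qed.

Lemma sqr_cmod z : cmod z ^+ 2 = complex.Re z ^+ 2 + complex.Im z ^+ 2.
Proof. by case: z => a b /=; rewrite sqr_sqrtr ?addr_ge0 ?sqr_ge0. Qed.

Lemma cmodM z w : cmod (z * w) = cmod z * cmod w.
Proof. exact: ComplexField.Normc.normcM. Qed.

Lemma cmodD z w : cmod (z + w) <= cmod z + cmod w.
Proof. exact: le_normcD. Qed.

Lemma cmodN z : cmod (- z) = cmod z.
Proof. exact: normcN. Qed.

Lemma cmodB z w : cmod (z - w) <= cmod z + cmod w.
Proof. by rewrite -(cmodN w) cmodD. Qed.

Lemma cmod0 : cmod (0 : R[i]) = 0.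
Proof. by rewrite ComplexField.Normc.normc0. Qed.

Lemma cmod_real (x : R) : cmod x%:C%C = `|x|.
Proof. by rewrite /= expr0n /= addr0 sqrtr_sqr. Qed.

Lemma cmodJ z : cmod (conjc z) = cmod z.
Proof. by case: z => a b /=; rewrite sqrrN. Qed.

Lemma cmodV z : cmod z^-1 = (cmod z)^-1.
Proof. exact: ComplexField.Normc.normcV. Qed.

Lemma cmod_eq0 z : (cmod z == 0) = (z == 0).
Proof.
apply/eqP/eqP => [|->]; last exact: cmod0.
exact: ComplexField.Normc.eq0_normc.
Qed.

Lemma cmod_gt0 z : z <> 0 -> 0 < cmod z.
Proof. by move=> /eqP z0; rewrite lt_neqAle cmod_ge0 eq_sym cmod_eq0 z0. Qed.

Lemma normr_Re_le z : `|complex.Re z| <= cmod z.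
Proof.
rewrite -(ler_pXn2r (n := 2)) ?nnegrE ?cmod_ge0 // sqr_cmod real_normK ?num_real //.
by rewrite lerDl sqr_ge0.
Qed.

Lemma normr_Im_le z : `|complex.Im z| <= cmod z.
Proof.
rewrite -(ler_pXn2r (n := 2)) ?nnegrE ?cmod_ge0 // sqr_cmod real_normK ?num_real //.
by rewrite lerDr sqr_ge0.
Qed.

Lemma sqr_cmodD z w : cmod (z + w) ^+ 2 <= 2 * cmod z ^+ 2 + 2 * cmod w ^+ 2.
Proof.
have := cmodD z w; have := cmod_ge0 (z + w).
have := sqr_ge0 (cmod z - cmod w); nra.
Qed.

Lemma sqr_cmodB z w : cmod (z - w) ^+ 2 <= 2 * cmod z ^+ 2 + 2 * cmod w ^+ 2.
Proof. by rewrite -(cmodN w) sqr_cmodD. Qed.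

Lemma mulcJ z : z * conjc z = (cmod z ^+ 2)%:C%C.
Proof.
by rewrite sqr_cmod; case: z => a b; apply/eqP; rewrite eq_complex /=;
  apply/andP; split; apply/eqP; ring.
Qed.

Lemma Re_addc z w : complex.Re (z + w) = complex.Re z + complex.Re w.
Proof. by case: z w => a b []. Qed.

Lemma Im_addc z w : complex.Im (z + w) = complex.Im z + complex.Im w.
Proof. by case: z w => a b []. Qed.

Lemma Re_oppc z : complex.Re (- z) = - complex.Re z.
Proof. by case: z. Qed.

Lemma Re_mulc z w :
  complex.Re (z * w)
  = complex.Re z * complex.Re w - complex.Im z * complex.Im w.
Proof. by case: z w => a b []. Qed.

Lemma Im_mulc z w :
  complex.Im (z * w)
  = complex.Re z * complex.Im w + complex.Im z * complex.Re w.
Proof. by case: z w => a b []. Qed.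

Lemma complexP z w :
  complex.Re z = complex.Re w -> complex.Im z = complex.Im w -> z = w.
Proof. by case: z w => a b [c d] /= -> ->. Qed.

Lemma realcM (a b : R) : (a * b)%:C%C = a%:C%C * b%:C%C.
Proof. exact: rmorphM. Qed.

Lemma conjcM z w : conjc (z * w) = conjc z * conjc w.
Proof. exact: rmorphM. Qed.

Lemma realcB (a b : R) : (a - b)%:C%C = a%:C%C - b%:C%C.
Proof. exact: rmorphB. Qed.

Lemma realcV (a : R) : a^-1%:C%C = a%:C%C^-1.
Proof. exact: fmorphV. Qed.

(** Optimization in [t]: the choice [t = a / b] gives the claim, and if [b = 0] the choice
    [t = (c + 1) / a] contradicts [a > 0]. Both Cauchy-Schwarz inequalities below are obtained from
    Young's inequality in this way. *)
Lemma le_cmod_of_Young (a b c : R) : 0 <= b -> 0 <= c ->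
  (forall t, 0 < t -> 2 * a <= t * b + t^-1 * c) -> 0 <= a -> a ^+ 2 <= b * c.
Proof.
move=> b0 c0 H a0.
have [->|an0] := eqVneq a 0; first by rewrite expr0n mulr_ge0.
have ap : 0 < a by rewrite lt_neqAle eq_sym an0.
have [b00|bn0] := eqVneq b 0.
  have := H ((c + 1) / a) (divr_gt0 (ltr_wpDl c0 ltr01) ap).
  rewrite b00 mulr0 add0r mul0r invf_div mulrAC.
  have c1 : 0 < c + 1 by lra.
  by rewrite ler_pdivlMr // => h; nra.
have bp : 0 < b by rewrite lt_neqAle eq_sym bn0.
have := H (a / b) (divr_gt0 ap bp).
rewrite invf_div divfK // mulr_natl mulr2n lerD2l mulrAC ler_pdivlMr // expr2 [c * b]mulrC.
Qed.

End ComplexModulus.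

(** * Absolutely summable real and complex families *)

Definition rsummable {R : realType} {T : choiceType} (D : set T) (f : T -> R) :=
  summable D (fun x => (f x)%:E).

Section RealSums.
Context {R : realType} {T : choiceType}.
Implicit Types (D A : set T) (f g : T -> R).

Lemma rsummable_le D f g : (forall x, D x -> `|f x| <= g x) ->
  rsummable D g -> rsummable D f.
Proof.
move=> fg; rewrite /rsummable /summable; apply: le_lt_trans.
apply: le_esum => x Dx; rewrite lee_fin (le_trans (fg _ Dx)) //.
exact: ler_norm.
Qed.

Lemma rsummable_sub D A f : A `<=` D -> rsummable D f -> rsummable A f.
Proof.
move=> AD; rewrite /rsummable /summable; apply: le_lt_trans.
rewrite esum_mkcond [leRHS]esum_mkcond; apply: le_esum => x _.
case: ifPn => [/set_mem/AD/mem_set ->//|_].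
by case: ifP.
Qed.

Lemma rsummable_nneg D f : (forall x, D x -> 0 <= f x) ->
  (\esum_(x in D) (f x)%:E < +oo)%E -> rsummable D f.
Proof.
move=> f0; apply: le_lt_trans; apply: le_esum => x Dx.
by rewrite lee_fin ger0_norm // f0.
Qed.

Lemma rsummableD D f g : rsummable D f -> rsummable D g ->
  rsummable D (fun x => f x + g x).
Proof. exact: summableD. Qed.

Lemma rsummableN D f : rsummable D f -> rsummable D (fun x => - f x).
Proof. by apply: le_lt_trans; apply: le_esum => x _; rewrite /= normrN. Qed.

Lemma rsummableB D f g : rsummable D f -> rsummable D g ->
  rsummable D (fun x => f x - g x).
Proof. by move=> hf hg; apply: rsummableD => //; exact: rsummableN. Qed.

Lemma rsummable_norm D f : rsummable D f -> rsummable D (fun x => `|f x|).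
Proof. by apply: le_lt_trans; apply: le_esum => x _; rewrite /= normr_id. Qed.

Lemma rsummable0 D : rsummable D (fun=> 0 : R).
Proof. by rewrite /rsummable /summable esum1 // => x _; rewrite /= normr0. Qed.

Lemma esum_fin_num D f : (forall x, D x -> 0 <= f x) -> rsummable D f ->
  (\esum_(x in D) (f x)%:E)%E \is a fin_num.
Proof.
move=> f0; rewrite /rsummable summableE (@eq_esum _ _ _ _ (fun x => (f x)%:E)) // => x Dx.
by rewrite /= ger0_norm ?f0.
Qed.

(** Additivity of [rsum] rests on this freedom in the decomposition: the positive part of a sum is
    not the sum of the positive parts, so the value must not depend on which nonnegative parts are
    subtracted. *)
Lemma rsum_diff D f g :
  (forall x, D x -> 0 <= f x) -> (forall x, D x -> 0 <= g x) ->
  rsummable D f -> rsummable D g ->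
  rsum D (fun x => f x - g x)
  = fine (\esum_(x in D) (f x)%:E) - fine (\esum_(x in D) (g x)%:E).
Proof.
move=> f0 g0 sf sg.
have := esumB sf sg; rewrite /rsum => /(_ f0 g0) H.
have sd := rsummableB sf sg.
have P1 : forall k : T -> R, (fun i => (k i)%:E)^\+%E = (fun i => (Num.max (k i) 0)%:E).
  by move=> k; apply/funext => x; rewrite funeposE EFin_max.
have P2 : forall k : T -> R, (fun i => (k i)%:E)^\-%E = (fun i => (Num.max (- k i) 0)%:E).
  by move=> k; apply/funext => x; rewrite funenegE EFin_max.
have Ep := P1 (fun i => f i - g i); have En := P2 (fun i => f i - g i).
rewrite (_ : (fun x => (f x)%:E - (g x)%:E)%E = (fun x => (f x - g x)%:E)) // in H.
rewrite Ep En in H.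
rewrite -fineB; first last.
- apply: esum_fin_num; first by move=> x _; rewrite le_max lexx orbT.
  apply: (rsummable_le _ (rsummable_norm sd)) => x _.
  by rewrite ger0_norm ?le_max ?lexx ?orbT // ge_max -normrN ler_norm normr_ge0.
- apply: esum_fin_num; first by move=> x _; rewrite le_max lexx orbT.
  apply: (rsummable_le _ (rsummable_norm sd)) => x _.
  by rewrite ger0_norm ?le_max ?lexx ?orbT // ge_max ler_norm normr_ge0.
by rewrite -fineB ?esum_fin_num //; congr fine.
Qed.

Lemma rsum_nneg D f : (forall x, D x -> 0 <= f x) ->
  rsum D f = fine (\esum_(x in D) (f x)%:E).
Proof.
move=> f0; rewrite /rsum.
rewrite (@eq_esum _ _ _ _ (fun x => (f x)%:E)); last first.
  by move=> x Dx; rewrite max_l // f0.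
rewrite [X in _ - fine X]esum1 ?subr0 // => x Dx.
by rewrite max_r // oppr_le0 f0.
Qed.

Lemma rsum_esum D f : (forall x, D x -> 0 <= f x) -> rsummable D f ->
  (rsum D f)%:E = (\esum_(x in D) (f x)%:E)%E.
Proof. by move=> f0 sf; rewrite rsum_nneg // fineK // esum_fin_num. Qed.

Lemma eq_rsum D f g : (forall x, D x -> f x = g x) -> rsum D f = rsum D g.
Proof.
by move=> fg; rewrite /rsum; congr (fine _ - fine _);
  apply: eq_esum => x Dx; rewrite fg.
Qed.

Lemma eq_rsummable D f g : (forall x, D x -> f x = g x) ->
  rsummable D f -> rsummable D g.
Proof.
move=> fg; rewrite /rsummable /summable.
by rewrite (@eq_esum _ _ _ _ (fun x => `|(g x)%:E|%E)) // => x /fg ->.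
Qed.

Let pos f x := Num.max (f x) 0.
Let neg f x := Num.max (- f x) 0.

Let posBneg f x : f x = pos f x - neg f x.
Proof. by rewrite /pos /neg; case: (lerP 0 (f x)) => h; [rewrite max_r|rewrite max_l]; lra. Qed.

Let pos_ge0 f x : 0 <= pos f x. Proof. by rewrite le_max lexx orbT. Qed.
Let neg_ge0 f x : 0 <= neg f x. Proof. by rewrite le_max lexx orbT. Qed.

Let pos_sum D f : rsummable D f -> rsummable D (pos f).
Proof.
move=> /rsummable_norm; apply: rsummable_le => x _.
by rewrite ger0_norm ?pos_ge0 // ge_max ler_norm normr_ge0.
Qed.

Let neg_sum D f : rsummable D f -> rsummable D (neg f).
Proof.
move=> /rsummable_norm; apply: rsummable_le => x _.
by rewrite ger0_norm ?neg_ge0 // ge_max -normrN ler_norm normr_ge0.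
Qed.

Let rsumE D f : rsum D f =
  fine (\esum_(x in D) (pos f x)%:E) - fine (\esum_(x in D) (neg f x)%:E).
Proof. by []. Qed.

Lemma rsumD D f g : rsummable D f -> rsummable D g ->
  rsum D (fun x => f x + g x) = rsum D f + rsum D g.
Proof.
move=> sf sg.
have sp : rsummable D (fun x => pos f x + pos g x).
  by apply: rsummableD; apply: pos_sum.
have sn : rsummable D (fun x => neg f x + neg g x).
  by apply: rsummableD; apply: neg_sum.
rewrite (@eq_rsum _ _ (fun x => (pos f x + pos g x) - (neg f x + neg g x))); last first.
  by move=> x _; rewrite {1}(posBneg f x) {1}(posBneg g x); lra.
rewrite rsum_diff //; try (by move=> x _; rewrite addr_ge0 // ?pos_ge0 ?neg_ge0).
have E a b : (forall x, 0 <= a x) -> (forall x, 0 <= b x) ->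
    rsummable D a -> rsummable D b ->
    fine (\esum_(x in D) (a x + b x)%:E) =
    fine (\esum_(x in D) (a x)%:E) + fine (\esum_(x in D) (b x)%:E) :> R.
  move=> a0 b0 sa sb.
  rewrite (@eq_esum _ _ _ _ (fun x => (a x)%:E + (b x)%:E)%E) //.
  rewrite esumD; [|by move=> x _; rewrite lee_fin..].
  by rewrite fineD ?esum_fin_num.
rewrite (E (pos f) (pos g)); [|exact: pos_ge0|exact: pos_ge0|exact: pos_sum|exact: pos_sum].
rewrite (E (neg f) (neg g)); [|exact: neg_ge0|exact: neg_ge0|exact: neg_sum|exact: neg_sum].
rewrite (rsumE D f) (rsumE D g); lra.
Qed.

Lemma rsumN D f : rsum D (fun x => - f x) = - rsum D f.
Proof.
rewrite /rsum opprB; congr (_ - fine _).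
by apply: eq_esum => x _; rewrite opprK.
Qed.

Lemma rsumB D f g : rsummable D f -> rsummable D g ->
  rsum D (fun x => f x - g x) = rsum D f - rsum D g.
Proof. by move=> sf sg; rewrite rsumD ?rsumN //; exact: rsummableN. Qed.

Lemma rsum_ge0 D f : (forall x, D x -> 0 <= f x) -> 0 <= rsum D f.
Proof.
by move=> f0; rewrite rsum_nneg // fine_ge0 // esum_ge0 // => x Dx; rewrite lee_fin f0.
Qed.

Lemma ler_rsum D f g : rsummable D f -> rsummable D g ->
  (forall x, D x -> f x <= g x) -> rsum D f <= rsum D g.
Proof.
move=> sf sg fg; rewrite -subr_ge0 -rsumB //; apply: rsum_ge0 => x Dx.
by rewrite subr_ge0 fg.
Qed.

Lemma ler_rsum_nneg D f g : (forall x, D x -> 0 <= f x <= g x) ->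
  rsummable D g -> rsum D f <= rsum D g.
Proof.
move=> fg sg; apply: ler_rsum => //; last by move=> x /fg/andP[].
by apply: rsummable_le sg => x /fg/andP[f0 fg']; rewrite ger0_norm.
Qed.

Lemma esum_fsum (F : set T) f : finite_set F -> (forall x, F x -> 0 <= f x) ->
  (\esum_(x in F) (f x)%:E)%E = (\sum_(x \in F) f x)%:E.
Proof.
move=> fF f0; rewrite esum_fset //; first by rewrite -fsumEFin.
by move=> x; rewrite inE => /f0; rewrite lee_fin.
Qed.

(** A nonnegative sum is the supremum of its finite partial sums; together with [fsum_le_rsum] this
    is how later inequalities are reduced to finite sets. *)
Lemma rsummable_bounded D f (M : R) : (forall x, D x -> 0 <= f x) ->
  (forall F : set T, finite_set F -> F `<=` D -> \sum_(x \in F) f x <= M) ->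
  rsummable D f /\ rsum D f <= M.
Proof.
move=> f0 H.
have le : (\esum_(x in D) (f x)%:E <= M%:E)%E.
  rewrite /esum; apply: ub_ereal_sup => _ [F [fF FD] <-].
  rewrite -esum_fset //; last by move=> x; rewrite inE => /FD/f0; rewrite lee_fin.
  by rewrite esum_fsum ?lee_fin ?H // => x /FD/f0.
have sf : rsummable D f by apply: rsummable_nneg => //; exact: le_lt_trans le (ltry _).
by split => //; rewrite -lee_fin rsum_esum.
Qed.

Lemma fsum_le_rsum D f (F : set T) : (forall x, D x -> 0 <= f x) ->
  rsummable D f -> finite_set F -> F `<=` D -> \sum_(x \in F) f x <= rsum D f.
Proof.
move=> f0 sf fF FD; rewrite -lee_fin rsum_esum //.
rewrite -esum_fsum //; last by move=> x /FD/f0.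
rewrite esum_fset //; last by move=> x; rewrite inE => /FD/f0; rewrite lee_fin.
by apply: ereal_sup_ubound; exists F.
Qed.

Lemma rsum_finite (F : set T) f : finite_set F -> (forall x, F x -> 0 <= f x) ->
  rsummable F f /\ rsum F f = \sum_(x \in F) f x.
Proof.
move=> fF f0; have sf : rsummable F f.
  by apply: rsummable_nneg => //; rewrite esum_fsum // ltry.
by split => //; apply/EFin_inj; rewrite rsum_esum // esum_fsum.
Qed.

Lemma term_le_rsum D f t : (forall x, D x -> 0 <= f x) ->
  rsummable D f -> D t -> f t <= rsum D f.
Proof.
move=> f0 sf Dt; have := @fsum_le_rsum D f [set t] f0 sf (finite_set1 t).
by rewrite fsbig_set1; apply => x ->.
Qed.

Lemma rsum_sub D A f : (forall x, D x -> 0 <= f x) -> rsummable D f ->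
  A `<=` D -> rsum A f <= rsum D f.
Proof.
move=> f0 sf AD; have [] // := @rsummable_bounded A f (rsum D f).
  by move=> x /AD/f0.
by move=> F fF FA; apply: fsum_le_rsum => // x /FA/AD.
Qed.

Lemma rsum_mkcond D A f : A `<=` D ->
  rsum A f = rsum D (fun x => if x \in A then f x else 0).
Proof.
move=> AD; rewrite /rsum; congr (fine _ - fine _).
- rewrite esum_mkcond [RHS]esum_mkcond; apply: eq_esum => x _.
  case: (boolP (x \in A)) => [/set_mem xA|_]; first by rewrite (mem_set (AD _ xA)).
  by rewrite maxxx; case: ifP.
- rewrite esum_mkcond [RHS]esum_mkcond; apply: eq_esum => x _.
  case: (boolP (x \in A)) => [/set_mem xA|_]; first by rewrite (mem_set (AD _ xA)).
  by rewrite oppr0 maxxx; case: ifP.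
Qed.

Lemma rsummable_mkcond D A f : A `<=` D ->
  rsummable A f -> rsummable D (fun x => if x \in A then f x else 0).
Proof.
move=> AD; rewrite /rsummable /summable esum_mkcond => h.
rewrite esum_mkcond; apply: le_lt_trans h; apply: le_esum => x _.
case: (boolP (x \in A)) => [/set_mem xA|_]; first by rewrite (mem_set (AD _ xA)).
by case: ifP => _; rewrite ?normr0 // abse0.
Qed.

Lemma rsum_tail D f e : (forall x, D x -> 0 <= f x) -> rsummable D f -> 0 < e ->
  exists F : set T, [/\ finite_set F, F `<=` D & rsum (D `\` F) f <= e].
Proof.
move=> f0 sf e0.
have fin := esum_fin_num f0 sf.
have [_ [F [fF FD] <-] Fe] := ub_ereal_sup_adherent e0 fin.
exists F; split => //.
have f0F x : F x -> 0 <= f x by move=> /FD/f0.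
rewrite -/(esum D _) -esum_fset // in Fe; last by move=> x; rewrite inE => /FD/f0; rewrite lee_fin.
have H0 : forall i, D i -> (0 <= (f i)%:E)%E by move=> x /f0; rewrite lee_fin.
have := @esumID _ _ F D _ H0.
rewrite (_ : D `&` F = F); last by apply/setIidr.
rewrite -setDE => E.
have s1 := rsummable_sub (@subDsetl _ D F) sf.
have s2 := rsummable_sub FD sf.
move: Fe; rewrite -rsum_esum // -(rsum_esum f0F s2) -EFinB lte_fin => Fe.
move: E Fe; rewrite -rsum_esum // -(rsum_esum f0F s2) -rsum_esum //; last by move=> x [/f0].
by rewrite -EFinD => -[->]; rewrite ltrBlDr ltrD2l => /ltW.
Qed.

(** For nonnegative data, one inequality comes from finite partial sums and the other from the same
    argument with [b^-1]. Signs are then restored by splitting [f] and negating. *)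
Lemma rsumZ D (a : R) f : rsummable D f ->
  rsummable D (fun x => a * f x) /\ rsum D (fun x => a * f x) = a * rsum D f.
Proof.
have nn (b : R) (k : T -> R) : 0 <= b -> (forall x, 0 <= k x) -> rsummable D k ->
    rsummable D (fun x => b * k x) /\ rsum D (fun x => b * k x) = b * rsum D k.
  move=> b0 k0 sk.
  have [S1 le1] : rsummable D (fun x => b * k x) /\
      rsum D (fun x => b * k x) <= b * rsum D k.
    apply: rsummable_bounded => [x _|F fF FD]; first by rewrite mulr_ge0.
    rewrite -mulr_fsumr ler_wpM2l //.
    exact: fsum_le_rsum.
  split => //; apply/eqP; rewrite eq_le le1 /=.
  have [->|bn0] := eqVneq b 0; first by rewrite mul0r rsum_ge0 // => x _; rewrite mul0r.
  have bp : 0 < b by rewrite lt_neqAle eq_sym bn0.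
  rewrite -ler_pdivlMl //.
  have [] // := @rsummable_bounded D k (b^-1 * rsum D (fun x => b * k x)).
  move=> F fF FD; rewrite ler_pdivlMl // mulr_fsumr.
  by apply: fsum_le_rsum => // x _; rewrite mulr_ge0.
have nn2 (b : R) (k : T -> R) : 0 <= b -> rsummable D k ->
    rsummable D (fun x => b * k x) /\ rsum D (fun x => b * k x) = b * rsum D k.
  move=> b0 sk.
  have [p1 p2] := nn b _ b0 (pos_ge0 k) (pos_sum sk).
  have [n1 n2] := nn b _ b0 (neg_ge0 k) (neg_sum sk).
  have E : (fun x => b * k x) = (fun x => b * pos k x - b * neg k x).
    by apply/funext => x; rewrite {1}(posBneg k x) mulrBr.
  have E' : k = (fun x => pos k x - neg k x) by apply/funext => x; exact: posBneg.
  rewrite E; split; first exact: rsummableB.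
  rewrite rsumB // p2 n2 -mulrBr -rsumB; [|exact: pos_sum|exact: neg_sum].
  by rewrite -E'.
move=> sf; have [a0|a0] := lerP 0 a; first exact: nn2.
have na : 0 <= - a by lra.
have [s1 s2] := nn2 _ _ na sf.
have E : (fun x => a * f x) = (fun x => - (- a * f x)).
  by apply/funext => x; rewrite mulNr opprK.
rewrite E; split; first exact: rsummableN.
by rewrite rsumN s2 mulNr opprK.
Qed.

Lemma rsummableZ D (a : R) f : rsummable D f -> rsummable D (fun x => a * f x).
Proof. by case/(rsumZ a). Qed.

Lemma rsumZE D (a : R) f : rsummable D f ->
  rsum D (fun x => a * f x) = a * rsum D f.
Proof. by case/(rsumZ a). Qed.

(** Pointwise convergence passes to every finite partial sum, and these determine the sum of the
    limit. It yields the completeness of [W12]. *)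
Lemma Fatou_rsum D (f_ : nat -> T -> R) f (M : R) :
  (forall n x, D x -> 0 <= f_ n x) ->
  (forall x, D x -> (fun n => f_ n x) @ \oo --> (f x : R)) ->
  (forall n, rsummable D (f_ n)) ->
  (\forall n \near \oo, rsum D (f_ n) <= M) ->
  rsummable D f /\ rsum D f <= M.
Proof.
move=> f0 cf sf H.
have ff0 x : D x -> 0 <= f x.
  move=> Dx; rewrite -(cvg_lim _ (cf x Dx)) //.
  apply: limr_ge; first by apply/cvg_ex; exists (f x); exact: cf.
  by near=> n; exact: f0.
apply: rsummable_bounded => // F fF FD.
have c : (fun n => \sum_(x \in F) f_ n x) @ \oo --> \sum_(x \in F) f x.
  have E k : \sum_(x \in F) k x = \sum_(x <- fset_set F) k x :> R.
    by rewrite fsbig_finite.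
  rewrite E (_ : (fun _ => _) = (fun n => \sum_(x <- fset_set F) f_ n x)); last first.
    by apply/funext => n; rewrite E.
  have : forall x, x \in enum_fset (fset_set F) -> x \in F.
    by move=> x; rewrite -[x \in _]/(x \in fset_set F) in_fset_set.
  elim: (enum_fset (fset_set F)) => [|y s IH] sub.
    rewrite big_nil (_ : (fun _ => _) = (fun=> 0)); first exact: cvg_cst.
    by apply/funext => n; rewrite big_nil.
  rewrite big_cons (_ : (fun _ => _) = (fun n => f_ n y + \sum_(x <- s) f_ n x)); last first.
    by apply/funext => n; rewrite big_cons.
  apply: cvgD; last by apply: IH => x xs; apply: sub; rewrite inE xs orbT.
  by apply: cf; apply/FD/set_mem/sub; rewrite inE eqxx.
rewrite -(cvg_lim _ c) //; apply: limr_le.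
  by apply/cvg_ex; eexists; exact: c.
near=> n; apply: le_trans (_ : rsum D (f_ n) <= M); last by near: n.
by apply: fsum_le_rsum => // x; exact: f0.
Unshelve. all: by end_near. Qed.

End RealSums.

Definition csummable {R : realType} {T : choiceType} (D : set T) (f : T -> R[i]) :=
  rsummable D (fun x => cmod (f x)).

Section ComplexSums.
Context {R : realType} {T : choiceType}.
Implicit Types (D : set T) (f g : T -> R[i]).

Lemma csummable_Re D f : csummable D f -> rsummable D (fun x => complex.Re (f x)).
Proof. by apply: rsummable_le => x _; exact: normr_Re_le. Qed.

Lemma csummable_Im D f : csummable D f -> rsummable D (fun x => complex.Im (f x)).
Proof. by apply: rsummable_le => x _; exact: normr_Im_le. Qed.

Lemma csummable_le D f (g : T -> R) : (forall x, D x -> cmod (f x) <= g x) ->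
  rsummable D g -> csummable D f.
Proof.
by move=> fg; apply: rsummable_le => x Dx; rewrite ger0_norm ?cmod_ge0 // fg.
Qed.

Lemma csummableZ D (a : R[i]) f : csummable D f -> csummable D (fun x => a * f x).
Proof.
move=> sf; apply: csummable_le (rsummableZ (cmod a) sf) => x _.
by rewrite cmodM.
Qed.

Lemma eq_csum D f g : (forall x, D x -> f x = g x) -> csum D f = csum D g.
Proof.
by move=> fg; congr Complex; apply: eq_rsum => x Dx; rewrite fg.
Qed.

Lemma csumD D f g : csummable D f -> csummable D g ->
  csum D (fun x => f x + g x) = csum D f + csum D g.
Proof.
move=> sf sg; apply: complexP.
  rewrite Re_addc /= -rsumD; [|exact: csummable_Re..].
  by apply: eq_rsum => x _; rewrite Re_addc.
rewrite Im_addc /= -rsumD; [|exact: csummable_Im..].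
by apply: eq_rsum => x _; rewrite Im_addc.
Qed.

Lemma csumZ D (a : R[i]) f : csummable D f ->
  csum D (fun x => a * f x) = a * csum D f.
Proof.
move=> sf; have sR := csummable_Re sf; have sI := csummable_Im sf.
apply: complexP.
  rewrite Re_mulc /= -!rsumZE // -rsumB; [|exact: rsummableZ..].
  by apply: eq_rsum => x _; rewrite Re_mulc.
rewrite Im_mulc /= -!rsumZE // -rsumD; [|exact: rsummableZ..].
by apply: eq_rsum => x _; rewrite Im_mulc.
Qed.

(** Multiplication by the conjugate of the sum makes it real, so its squared modulus is the real
    part of a sum that can be estimated term by term. *)
Lemma cmod_csum_le D f : csummable D f ->
  cmod (csum D f) <= rsum D (fun x => cmod (f x)).
Proof.
move=> sf; set z := csum D f.
have [z0|/eqP z0] := eqVneq z 0.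
  by rewrite z0 cmod0; apply: rsum_ge0 => x _; exact: cmod_ge0.
have zp := cmod_gt0 z0.
rewrite -(ler_pM2l zp) -expr2 -rsumZE //.
have E : (cmod z ^+ 2)%:C%C = csum D (fun x => conjc z * f x).
  by rewrite csumZ // -/z -mulcJ mulrC.
have -> : cmod z ^+ 2 = complex.Re (csum D (fun x => conjc z * f x)) by rewrite -E.
apply: ler_rsum; [exact/csummable_Re/csummableZ|exact: rsummableZ|].
move=> x _; apply: (le_trans (ler_norm _)); apply: (le_trans (normr_Re_le _)).
by rewrite cmodM cmodJ.
Qed.

End ComplexSums.

(** * Weighted l^2 spaces over an abstract index set *)

Definition nsq {R : realType} {T : choiceType} (D : set T) (p : T -> R)
  (F : T -> R[i]) : R := rsum D (fun t => cmod (F t) ^+ 2 * p t).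

Definition l2s {R : realType} {T : choiceType} (D : set T) (p : T -> R)
  (F : T -> R[i]) : Prop := rsummable D (fun t => cmod (F t) ^+ 2 * p t).

(** Index set and weight stay abstract because the theory is used twice: on vertices with weight
    [mass], where [pairing] unfolds to [inner], and on edges with weight [mue], where [form c u v]
    is the pairing of [c du] with [dv]. *)
Definition pairing {R : realType} {T : choiceType} (D : set T) (p : T -> R)
  (F G : T -> R[i]) : R[i] := csum D (fun t => F t * conjc (G t) * (p t)%:C%C).

Lemma eq_pairing {R : realType} {T : choiceType} (D : set T) (p : T -> R)
    (F F' G G' : T -> R[i]) :
  (forall t, D t -> F t = F' t) -> (forall t, D t -> G t = G' t) ->
  pairing D p F G = pairing D p F' G'.
Proof. by move=> FF GG; apply: eq_csum => t Dt; rewrite FF ?GG. Qed.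

Lemma eq_nsq {R : realType} {T : choiceType} (D : set T) (p : T -> R)
    (F F' : T -> R[i]) :
  (forall t, D t -> F t = F' t) -> nsq D p F = nsq D p F'.
Proof. by move=> FF; apply: eq_rsum => t Dt; rewrite FF. Qed.

Lemma eq_l2s {R : realType} {T : choiceType} (D : set T) (p : T -> R)
    (F F' : T -> R[i]) :
  (forall t, D t -> F t = F' t) -> l2s D p F -> l2s D p F'.
Proof. by move=> FF; apply: eq_rsummable => t Dt; rewrite FF. Qed.

Section WeightedL2.
Context {R : realType} {T : choiceType} (D : set T) (p : T -> R).
Hypothesis p_ge0 : forall t, D t -> 0 <= p t.
Implicit Types (F G H : T -> R[i]).

Lemma sqp_ge0 F t : D t -> 0 <= cmod (F t) ^+ 2 * p t.
Proof. by move=> Dt; rewrite mulr_ge0 ?p_ge0 // sqr_ge0. Qed.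

Lemma nsq_ge0 F : 0 <= nsq D p F.
Proof. by apply: rsum_ge0 => t; exact: sqp_ge0. Qed.

Lemma l2s_le K F G : 0 <= K -> (forall t, D t -> cmod (F t) <= K * cmod (G t)) ->
  l2s D p G -> l2s D p F.
Proof.
move=> K0 FG /(rsummableZ (K ^+ 2)); apply: rsummable_le => t Dt.
rewrite ger0_norm ?sqp_ge0 // mulrA ler_wpM2r ?p_ge0 // -exprMn.
by rewrite lerXn2r ?nnegrE ?cmod_ge0 ?FG // mulr_ge0 ?cmod_ge0.
Qed.

Lemma nsq_le K F G : 0 <= K -> (forall t, D t -> cmod (F t) <= K * cmod (G t)) ->
  l2s D p G -> nsq D p F <= K ^+ 2 * nsq D p G.
Proof.
move=> K0 FG lG; rewrite /nsq -rsumZE //; apply: ler_rsum_nneg.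
  move=> t Dt; rewrite sqp_ge0 //= mulrA ler_wpM2r ?p_ge0 // -exprMn.
  by rewrite lerXn2r ?nnegrE ?cmod_ge0 ?FG // mulr_ge0 ?cmod_ge0.
exact: rsummableZ.
Qed.

Lemma l2sD F G : l2s D p F -> l2s D p G -> l2s D p (fun t => F t + G t).
Proof.
move=> lF lG.
apply: rsummable_le (rsummableD (rsummableZ 2 lF) (rsummableZ 2 lG)) => t Dt.
rewrite ger0_norm; last exact: (sqp_ge0 (fun t => F t + G t)).
by have := ler_wpM2r (p_ge0 Dt) (sqr_cmodD (F t) (G t)); lra.
Qed.

Lemma nsqD_le F G : l2s D p F -> l2s D p G ->
  nsq D p (fun t => F t + G t) <= 2 * nsq D p F + 2 * nsq D p G.
Proof.
move=> lF lG; rewrite /nsq -!rsumZE // -rsumD; [|exact: rsummableZ..].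
apply: ler_rsum_nneg; last by apply: rsummableD; exact: rsummableZ.
move=> t Dt; rewrite (sqp_ge0 (fun t => F t + G t)) //=.
by have := ler_wpM2r (p_ge0 Dt) (sqr_cmodD (F t) (G t)); lra.
Qed.

Lemma l2sZ (a : R[i]) F : l2s D p F -> l2s D p (fun t => a * F t).
Proof. by apply: (l2s_le (cmod_ge0 a)) => t _; rewrite cmodM. Qed.

Lemma nsqZ (a : R[i]) F : l2s D p F ->
  nsq D p (fun t => a * F t) = cmod a ^+ 2 * nsq D p F.
Proof.
by move=> lF; rewrite /nsq -rsumZE //; apply: eq_rsum => t _; rewrite cmodM; ring.
Qed.

Lemma l2sN F : l2s D p F -> l2s D p (fun t => - F t).
Proof. by apply: (l2s_le ler01) => t _; rewrite cmodN mul1r. Qed.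

Lemma l2sB F G : l2s D p F -> l2s D p G -> l2s D p (fun t => F t - G t).
Proof. by move=> lF lG; apply: l2sD => //; exact: l2sN. Qed.

Lemma l2s0 : l2s D p (fun=> 0).
Proof. by apply: eq_rsummable (@rsummable0 R T D) => t _; rewrite cmod0 expr0n mul0r. Qed.

Let young (s a b q : R) : 0 < s -> 0 <= q ->
  a * b * q <= 2^-1 * (s * (a ^+ 2 * q)) + 2^-1 * (s^-1 * (b ^+ 2 * q)).
Proof.
move=> s0 q0.
have -> : 2^-1 * (s * (a ^+ 2 * q)) + 2^-1 * (s^-1 * (b ^+ 2 * q))
  = (2^-1 * (s * a ^+ 2 + s^-1 * b ^+ 2)) * q by ring.
apply: ler_wpM2r => //.
have : 0 <= s^-1 * (s * a - b) ^+ 2 by rewrite mulr_ge0 ?sqr_ge0 // invr_ge0 ltW.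
have -> : s^-1 * (s * a - b) ^+ 2 = s * a ^+ 2 + s^-1 * b ^+ 2 - 2 * (a * b).
  by field; rewrite gt_eqF.
lra.
Qed.

Let mod_pair F G t : D t ->
  cmod (F t * conjc (G t) * (p t)%:C%C) = cmod (F t) * cmod (G t) * p t.
Proof. by move=> Dt; rewrite !cmodM cmodJ cmod_real ger0_norm ?p_ge0. Qed.

Lemma csummable_pairing F G : l2s D p F -> l2s D p G ->
  csummable D (fun t => F t * conjc (G t) * (p t)%:C%C).
Proof.
move=> lF lG.
apply: csummable_le (rsummableD (rsummableZ 2^-1 (rsummableZ 1 lF))
  (rsummableZ 2^-1 (rsummableZ 1^-1 lG))) => t Dt.
by rewrite mod_pair // young ?p_ge0.
Qed.

Lemma pairing_young s F G : 0 < s -> l2s D p F -> l2s D p G ->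
  cmod (pairing D p F G) <= 2^-1 * (s * nsq D p F) + 2^-1 * (s^-1 * nsq D p G).
Proof.
move=> s0 lF lG; apply: le_trans (cmod_csum_le (csummable_pairing lF lG)) _.
have l1 := rsummableZ s lF; have l2 := rsummableZ s^-1 lG.
rewrite /nsq -!rsumZE // -rsumD; [|exact: rsummableZ..].
apply: ler_rsum_nneg; last by apply: rsummableD; exact: rsummableZ.
by move=> t Dt; rewrite cmod_ge0 mod_pair // young ?p_ge0.
Qed.

Lemma pairing_CS F G : l2s D p F -> l2s D p G ->
  cmod (pairing D p F G) ^+ 2 <= nsq D p F * nsq D p G.
Proof.
move=> lF lG; apply: le_cmod_of_Young; rewrite ?nsq_ge0 ?cmod_ge0 // => s s0.
by have := pairing_young s0 lF lG; lra.
Qed.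

Lemma pairingDl F G H : l2s D p F -> l2s D p G -> l2s D p H ->
  pairing D p (fun t => F t + G t) H = pairing D p F H + pairing D p G H.
Proof.
move=> lF lG lH; rewrite /pairing -csumD; [|exact: csummable_pairing..].
by apply: eq_csum => t _; rewrite !mulrDl.
Qed.

Lemma pairingDr F G H : l2s D p F -> l2s D p G -> l2s D p H ->
  pairing D p H (fun t => F t + G t) = pairing D p H F + pairing D p H G.
Proof.
move=> lF lG lH; rewrite /pairing -csumD; [|exact: csummable_pairing..].
by apply: eq_csum => t _; rewrite rmorphD mulrDr mulrDl.
Qed.

Lemma pairingZl (a : R[i]) F G : l2s D p F -> l2s D p G ->
  pairing D p (fun t => a * F t) G = a * pairing D p F G.
Proof.
move=> lF lG; rewrite /pairing -csumZ; last exact: csummable_pairing.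
by apply: eq_csum => t _; rewrite !mulrA.
Qed.

Lemma pairingZr (a : R[i]) F G : l2s D p F -> l2s D p G ->
  pairing D p F (fun t => a * G t) = conjc a * pairing D p F G.
Proof.
move=> lF lG; rewrite /pairing -csumZ; last exact: csummable_pairing.
by apply: eq_csum => t _; rewrite rmorphM; ring.
Qed.

Lemma pairingNl F G : l2s D p F -> l2s D p G ->
  pairing D p (fun t => - F t) G = - pairing D p F G.
Proof.
move=> lF lG; rewrite -mulN1r -pairingZl //.
by apply: eq_csum => t _; rewrite mulN1r.
Qed.

Lemma pairingBl F G H : l2s D p F -> l2s D p G -> l2s D p H ->
  pairing D p (fun t => F t - G t) H = pairing D p F H - pairing D p G H.
Proof. by move=> lF lG lH; rewrite pairingDl ?pairingNl //; exact: l2sN. Qed.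

Lemma pairing_self F : pairing D p F F = (nsq D p F)%:C%C.
Proof.
have E t : F t * conjc (F t) * (p t)%:C%C = (cmod (F t) ^+ 2 * p t)%:C%C.
  by rewrite mulcJ -rmorphM.
apply: complexP => /=.
  by apply: eq_rsum => t _; rewrite E.
by rewrite (@eq_rsum _ _ _ _ (fun=> 0)) => [|t _]; rewrite ?E // rsum_nneg ?esum1.
Qed.

Lemma Re_pairingC F G :
  complex.Re (pairing D p F G) = complex.Re (pairing D p G F).
Proof.
apply: eq_rsum => t _; case: (F t) (G t) => a b [c d] /=.
by rewrite !mulr0 !subr0; ring.
Qed.

End WeightedL2.

(** * Riesz representation and the Lax-Milgram theorem *)

Definition form_complete {R : realType} {V : lmodType R[i]} (W : V -> Prop)
    (q : V -> V -> R) := forall u_ : nat -> V, (forall n, W (u_ n)) ->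
  (forall e, 0 < e -> exists N, forall n m, (N <= n)%N -> (N <= m)%N ->
     q (u_ n - u_ m) (u_ n - u_ m) <= e) ->
  exists u, W u /\ forall e, 0 < e -> exists N, forall n, (N <= n)%N ->
     q (u_ n - u) (u_ n - u) <= e.

Definition is_subspace {R : realType} {V : lmodType R[i]} (W : V -> Prop) :=
  W 0 /\ forall a u v, W u -> W v -> W (a *: u + v).

(** Only real linearity is demanded, since [q] is meant to be the real part of a Hermitian product.
    Degeneracy is allowed and [W] is a bare predicate, so neither a quotient nor a normed space
    structure has to be built on [W12]. *)
Definition semi_inner {R : realType} {V : lmodType R[i]} (W : V -> Prop)
    (q : V -> V -> R) :=
  [/\ forall u v, W u -> W v -> q u v = q v u,
      forall (a : R) u v w, W u -> W v -> W w ->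
        q (a%:C%C *: u + v) w = a * q u w + q v w
    & forall u, W u -> 0 <= q u u].

Section Riesz.
Context {R : realType} {V : lmodType R[i]} (W : V -> Prop) (q : V -> V -> R).
Hypotheses (Wsub : is_subspace W) (qsemi : semi_inner W q)
  (Wcomplete : form_complete W q).

Let W0 : W 0. Proof. by case: Wsub. Qed.
Let WL a u v : W u -> W v -> W (a *: u + v). Proof. by case: Wsub => _; apply. Qed.

Lemma subspaceD u v : W u -> W v -> W (u + v).
Proof. by move=> Wu Wv; rewrite -(scale1r u); exact: WL. Qed.

Lemma subspaceZ a u : W u -> W (a *: u).
Proof. by move=> Wu; rewrite -[_ *: _]addr0; exact: WL. Qed.

Lemma subspaceB u v : W u -> W v -> W (u - v).
Proof. by move=> Wu Wv; rewrite addrC -scaleN1r; exact: WL. Qed.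

Lemma semi_innerDl u v w : W u -> W v -> W w -> q (u + v) w = q u w + q v w.
Proof.
case: qsemi => _ + _ Wu Wv Ww => /(_ 1 u v w Wu Wv Ww).
by rewrite mul1r (_ : 1%:C%C = 1) // scale1r.
Qed.

Lemma semi_inner0l w : W w -> q 0 w = 0.
Proof.
move=> Ww; have := semi_innerDl W0 W0 Ww; rewrite addr0 => h.
by apply: (addrI (q 0 w)); rewrite -h addr0.
Qed.

Lemma semi_innerZl (a : R) u w : W u -> W w -> q (a%:C%C *: u) w = a * q u w.
Proof.
case: qsemi => _ + _ Wu Ww => /(_ a u 0 w Wu W0 Ww).
by rewrite addr0 semi_inner0l // addr0.
Qed.

Lemma semi_innerC u v : W u -> W v -> q u v = q v u.
Proof. by case: qsemi => + _ _; apply. Qed.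

Lemma semi_inner_ge0 u : W u -> 0 <= q u u.
Proof. by case: qsemi => _ _; apply. Qed.

Lemma semi_innerDZ (a : R) u v : W u -> W v ->
  q (a%:C%C *: u + v) (a%:C%C *: u + v) = a ^+ 2 * q u u + 2 * a * q u v + q v v.
Proof.
move=> Wu Wv; have Wa := subspaceZ a%:C%C Wu; have Ws := subspaceD Wa Wv.
rewrite semi_innerDl // semi_innerZl // (semi_innerC Wu Ws) (semi_innerC Wv Ws).
rewrite !semi_innerDl // !semi_innerZl // (semi_innerC Wv Wu); ring.
Qed.

Lemma semi_innerBB u v : W u -> W v ->
  q (u - v) (u - v) = q u u - 2 * q u v + q v v.
Proof.
move=> Wu Wv; have := semi_innerDZ (-1) Wv Wu.
rewrite rmorphN rmorph1 scaleN1r addrC => ->; rewrite (semi_innerC Wv Wu); ring.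
Qed.

Lemma semi_inner_young (s : R) u v : 0 < s -> W u -> W v ->
  2 * `|q u v| <= s * q u u + s^-1 * q v v.
Proof.
move=> s0 Wu Wv.
have h a : 0 <= a ^+ 2 * q u u + 2 * a * q u v + q v v.
  rewrite -semi_innerDZ //; apply: semi_inner_ge0.
  by apply: subspaceD => //; exact: subspaceZ.
have h1 := h s; have h2 := h (- s); rewrite sqrrN in h2.
rewrite -(ler_pM2l s0) mulrDr mulVKf ?gt_eqF //.
by case: (ger0P (q u v)) => _; lra.
Qed.

Lemma semi_inner_CS u v : W u -> W v -> q u v ^+ 2 <= q u u * q v v.
Proof.
move=> Wu Wv; rewrite -[q u v ^+ 2]real_normK ?num_real //.
apply: le_cmod_of_Young; rewrite ?semi_inner_ge0 // => s s0.
exact: semi_inner_young.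
Qed.

(** Dirichlet principle: the representing vector minimizes [J v = q v v - 2 * l v], which the bound
    on [l] keeps above [- K]. *)
Lemma Riesz_representation (l : V -> R) (K : R) : 0 <= K ->
  (forall (a : R) u v, W u -> W v -> l (a%:C%C *: u + v) = a * l u + l v) ->
  (forall u, W u -> l u ^+ 2 <= K * q u u) ->
  exists u, W u /\ forall v, W v -> q u v = l v.
Proof.
move=> K0 lL lK.
have lD u v : W u -> W v -> l (u + v) = l u + l v.
  by move=> Wu Wv; have := lL 1 u v Wu Wv; rewrite (_ : 1%:C%C = 1) // scale1r mul1r.
have l0 : l 0 = 0.
  by have := lD _ _ W0 W0; rewrite addr0 => h; apply: (addrI (l 0)); rewrite -h addr0.
have lZ (a : R) u : W u -> l (a%:C%C *: u) = a * l u.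
  by move=> Wu; have := lL a u 0 Wu W0; rewrite addr0 l0 addr0.
pose J v := q v v - 2 * l v.
have Jlow v : W v -> - K <= J v.
  move=> Wv; have := lK v Wv; have := semi_inner_ge0 Wv.
  rewrite /J; set Q := q v v; set L := l v => Q0 LK.
  suff : L <= 2^-1 * (K + Q) by lra.
  have [L0|L0] := lerP L 0; first by apply: le_trans L0 _; lra.
  have KQ : 0 <= 2^-1 * (K + Q) by lra.
  have : L ^+ 2 <= (2^-1 * (K + Q)) ^+ 2.
    by apply: (le_trans LK); have := sqr_ge0 (K - Q); lra.
  by rewrite ler_pXn2r ?nnegrE // ltW.
pose E := [set J v | v in [set v | W v]].
have infE : has_inf E.
  by split; [exists (J 0); exists 0|exists (- K) => _ [v Wv <-]; exact: Jlow].
pose m := inf E.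
have mJ v : W v -> m <= J v.
  by move=> Wv; apply: ge_inf; [case: infE|exists v].
have /choice[u_ Hu] : forall n : nat, exists u, W u /\ J u <= m + n.+1%:R^-1.
  move=> n; have e0 : 0 < n.+1%:R^-1 :> R by rewrite invr_gt0.
  have [_ [v Wv <-] Jv] := inf_adherent e0 infE.
  by exists v; split => //; exact: ltW.
have Wu n : W (u_ n) by case: (Hu n).
have Ju n : J (u_ n) <= m + n.+1%:R^-1 by case: (Hu n).
(* The parallelogram identity combined with [m <= J] at the midpoint of [u] and [v]; it makes every
   minimizing sequence Cauchy. *)
have par u v : W u -> W v -> q (u - v) (u - v) <= 2 * (J u - m) + 2 * (J v - m).
  move=> Wu' Wv.
  have Wh : W ((2^-1 : R)%:C%C *: (u + v)) by apply: subspaceZ; exact: subspaceD.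
  have := mJ _ Wh; rewrite /J lZ ?lD //; last exact: subspaceD.
  rewrite semi_innerZl //; last exact: subspaceD.
  rewrite (semi_innerC _ Wh); last exact: subspaceD.
  rewrite semi_innerZl //; try exact: subspaceD.
  have := semi_innerDZ 1 Wu' Wv; rewrite (_ : 1%:C%C = 1) // scale1r => ->.
  by rewrite semi_innerBB // => h; lra.
have small (e : R) : 0 < e -> exists N, forall n, (N <= n)%N -> n.+1%:R^-1 <= e.
  move=> e0; have [N HN] := ltr_add_invr e0.
  exists N => n Nn; apply: le_trans (_ : N.+1%:R^-1 <= e); last first.
    by rewrite add0r in HN; apply: ltW.
  by rewrite lef_pV2 ?posrE // ler_nat ltnS.
have [|u [Wu' Hlim]] := Wcomplete Wu.
  move=> e e0; have e4 : 0 < 4^-1 * e by lra.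
  have [N HN] := small _ e4.
  exists N => n k Nn Nk; apply: le_trans (par _ _ (Wu n) (Wu k)) _.
  have JN i : (N <= i)%N -> J (u_ i) <= m + 4^-1 * e.
    by move=> Ni; apply: le_trans (Ju i) _; rewrite lerD2l HN.
  by have := JN _ Nn; have := JN _ Nk; lra.
exists u; split => // v Wv.
set d := q u v - l v; set Q := q v v.
have Q0 : 0 <= Q by exact: semi_inner_ge0.
(* Minimality is tested on [t v + u_n] for large [n]. The cross term [q (u_n - u) v] is absorbed by
   the nonnegativity of [q] at [- t v + (u_n - u)], which is why [t ^+ 2 * Q] appears with the
   factor 2. *)
have key (t : R) : 0 <= 2 * t * d + 2 * t ^+ 2 * Q.
  apply/ler_addgt0Pr => e e0.
  have e2 : 0 < 2^-1 * e by lra.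
  have [N1 H1] := small _ e2; have [N2 H2] := Hlim _ e2.
  pose n := maxn N1 N2.
  have {}H1 := H1 n (leq_maxl _ _); have {}H2 := H2 n (leq_maxr _ _).
  have Wn := Wu n; have Jn := Ju n.
  have Wd := subspaceB Wn Wu'.
  have := mJ _ (WL t%:C%C Wv Wn).
  rewrite /J lL // semi_innerDZ // -/Q.
  rewrite /J in Jn.
  have -> : q v (u_ n) = q u v + q (u_ n - u) v.
    by rewrite (semi_innerC Wv Wn) -semi_innerDl // addrC subrK.
  have := semi_inner_ge0 (WL (- t)%:C%C Wv Wd); rewrite semi_innerDZ //.
  rewrite (semi_innerC Wv Wd) -/Q sqrrN.
  have Jn' : q (u_ n) (u_ n) - 2 * l (u_ n) <= m + 2^-1 * e.
    by apply: le_trans Jn _; rewrite lerD2l.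
  by rewrite /d; lra.
have s0 : 0 < Q + 1 by lra.
(* This [t] nearly minimizes the quadratic; the [+ 1] covers [Q = 0]. *)
have := key (- (d / (Q + 1))).
have -> : 2 * - (d / (Q + 1)) * d + 2 * (- (d / (Q + 1))) ^+ 2 * Q =
   - (2 * d ^+ 2 / (Q + 1) ^+ 2) by field; rewrite gt_eqF.
rewrite oppr_ge0 pmulr_lle0 ?invr_gt0 ?exprn_gt0 // => h.
have : d ^+ 2 <= 0 by lra.
by rewrite real_exprn_even_le0 ?num_real //= => /eqP; rewrite /d => h'; lra.
Qed.

End Riesz.

Section LaxMilgram.
Context {R : realType} {V : lmodType R[i]} (W : V -> Prop) (q : V -> V -> R).
Hypotheses (Wsub : is_subspace W) (qsemi : semi_inner W q)
  (Wcomplete : form_complete W q).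

(* Riesz for [q] turns [Re B] into [q (A u) v]; Riesz for the equivalent inner
   product [q (A u) (A v)] then solves the normal equation [A^* A u = A^* f]. *)
Lemma Lax_Milgram (B : V -> V -> R[i]) (F : V -> R[i]) (K K' kappa : R) :
  0 <= K -> 0 <= K' -> 0 < kappa ->
  (forall a u v w, W u -> W v -> W w -> B (a *: u + v) w = a * B u w + B v w) ->
  (forall a u v w, W u -> W v -> W w ->
     B w (a *: u + v) = conjc a * B w u + B w v) ->
  (forall u v, W u -> W v -> cmod (B u v) ^+ 2 <= K * q u u * q v v) ->
  (forall u, W u -> kappa * q u u <= complex.Re (B u u)) ->
  (forall a u v, W u -> W v -> F (a *: u + v) = conjc a * F u + F v) ->
  (forall u, W u -> cmod (F u) ^+ 2 <= K' * q u u) ->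
  exists u, W u /\ forall v, W v -> B u v = F v.
Proof.
move=> K0 K'0 k0 Bl Br BK Bc Fl FK.
have Re2 (z : R[i]) : complex.Re z ^+ 2 <= cmod z ^+ 2.
  by rewrite sqr_cmod lerDl sqr_ge0.
have ReZ (a : R) (z : R[i]) : complex.Re (a%:C%C * z) = a * complex.Re z.
  by rewrite Re_mulc /= mul0r subr0.
have /choice[A HA] : forall u, exists w, W u ->
    W w /\ forall v, W v -> q w v = complex.Re (B u v).
  move=> u; have [Wu|nWu] := pselect (W u); last by exists 0.
  have [|||w Hw] := @Riesz_representation R V W q Wsub qsemi Wcomplete
    (fun v => complex.Re (B u v)) (K * q u u).
  - by rewrite mulr_ge0 ?(semi_inner_ge0 qsemi).
  - by move=> a v w Wv Ww; rewrite Br // Re_addc conjc_real ReZ.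
  - by move=> v Wv; apply: le_trans (BK _ _ Wu Wv); exact: Re2.
  - by exists w.
have WA u : W u -> W (A u) by move=> /HA[].
have qA u v : W u -> W v -> q (A u) v = complex.Re (B u v).
  by move=> /HA[_]; apply.
pose q' u v := q (A u) (A v).
have q's : semi_inner W q'.
  split.
  - by move=> u v Wu Wv; rewrite /q' (semi_innerC qsemi) //; exact: WA.
  - move=> a u v w Wu Wv Ww; have Wuv : W (a%:C%C *: u + v) by apply Wsub.
    by rewrite /q' !qA ?Bl ?Re_addc ?ReZ //; exact: WA.
  - by move=> u Wu; apply: (semi_inner_ge0 qsemi); exact: WA.
have low u : W u -> kappa ^+ 2 * q u u <= q' u u.
  move=> Wu; have := Bc u Wu; rewrite -qA // => h1.
  have := semi_inner_young Wsub qsemi k0 Wu (WA _ Wu).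
  rewrite (semi_innerC qsemi Wu (WA _ Wu)) -/(q' u u) => h2.
  have h3 := ler_norm (q (A u) u).
  have : kappa * q u u <= kappa^-1 * q' u u by lra.
  by rewrite -(ler_pM2l k0) mulVKf ?gt_eqF // mulrA -expr2.
have high u : W u -> q' u u <= K * q u u.
  move=> Wu; have := le_trans (Re2 _) (BK _ _ Wu (WA _ Wu)).
  have -> : complex.Re (B u (A u)) = q' u u by rewrite -qA //; exact: WA.
  rewrite -/(q' u u) expr2; have := semi_inner_ge0 q's Wu; rewrite le_eqVlt => /predU1P[<-|qp].
    by rewrite mulr_ge0 ?(semi_inner_ge0 qsemi).
  by rewrite ler_pM2r.
(* Completeness transfers because [low] and [high] make [q'] equivalent to [q]. *)
have comp' : form_complete W q'.
  move=> u_ Wu Cu.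
  have k2 : 0 < kappa ^+ 2 by rewrite exprn_gt0.
  have [|u [Wu' Hu]] := Wcomplete Wu.
    move=> e e0; have [N HN] := Cu _ (mulr_gt0 k2 e0).
    exists N => n m Nn Nm; rewrite -(ler_pM2l k2).
    apply: le_trans (low _ _) (HN _ _ Nn Nm); exact: (subspaceB Wsub).
  exists u; split => // e e0.
  have [N HN] := Hu (e / (K + 1)) (divr_gt0 e0 (ltr_wpDl K0 ltr01)).
  exists N => n Nn; apply: le_trans (high _ _) _; first exact: (subspaceB Wsub).
  have := HN _ Nn; rewrite ler_pdivlMr ?ltr_wpDl // => h.
  have := semi_inner_ge0 qsemi (subspaceB Wsub (Wu n) Wu'); lra.
have [|||f [Wf Hf]] := @Riesz_representation R V W q Wsub qsemi Wcomplete
    (fun v => complex.Re (F v)) K'.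
- by [].
- by move=> a u v Wu Wv; rewrite Fl // Re_addc conjc_real ReZ.
- by move=> v Wv; apply: le_trans (FK _ Wv); exact: Re2.
have [|||u [Wu Hu]] := @Riesz_representation R V W q' Wsub q's comp'
    (fun v => complex.Re (B v f)) (K * q f f / kappa ^+ 2).
- by rewrite divr_ge0 ?sqr_ge0 // mulr_ge0 ?(semi_inner_ge0 qsemi).
- by move=> a v w Wv Ww; rewrite Bl // Re_addc ReZ.
- move=> v Wv; apply: le_trans (Re2 _) _; apply: le_trans (BK _ _ Wv Wf) _.
  rewrite -mulrA [leRHS]mulrAC ler_pdivlMr ?exprn_gt0 //.
  have := low v Wv; have := semi_inner_ge0 qsemi Wf => h1 h2.
  have h3 : 0 <= K * q f f by rewrite mulr_ge0.
  by have := ler_wpM2l h3 h2; lra.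
have Wd : W (A u - f) by apply: (subspaceB Wsub) => //; exact: WA.
(* The normal equation makes the real part of [B d d] vanish for the residual [d = A u - f], and
   coercivity of [B] then kills [d]. *)
have d0 : q (A u - f) (A u - f) = 0.
  apply/eqP; rewrite eq_le (semi_inner_ge0 qsemi) // andbT -(pmulr_rle0 _ k0).
  apply: le_trans (Bc _ Wd) _.
  have := Br (-1) f (A u) (A u - f) Wf (WA _ Wu) Wd.
  rewrite scaleN1r [- f + _]addrC => ->; rewrite rmorphN rmorph1 mulN1r Re_addc Re_oppc.
  rewrite -Hu // -(qA (A u - f)) //; last exact: WA.
  by rewrite -/(q' _ _) (semi_innerC q's) // addNr.
have ReE v : W v -> complex.Re (B u v) = complex.Re (F v).
  move=> Wv; rewrite -qA // -Hf //; apply/eqP; rewrite -subr_eq0.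
  have E : q (A u) v - q f v = q (A u - f) v.
    apply/eqP; rewrite subr_eq -(semi_innerDl qsemi) ?subrK //.
  have := semi_inner_CS Wsub qsemi Wd Wv.
  by rewrite -E d0 mul0r real_exprn_even_le0 ?num_real.
exists u; split => // v Wv; apply: complexP; first exact: ReE.
(* Only real parts agree so far; testing with ['i v] recovers the imaginary parts. *)
have Wi : W ('i%C *: v) by exact: (subspaceZ Wsub).
have W0 : W 0 by apply Wsub.
have B0 : B u 0 = 0.
  have := BK u 0 Wu W0; rewrite (semi_inner0l Wsub qsemi) // mulr0.
  by rewrite real_exprn_even_le0 ?num_real //= cmod_eq0 => /eqP.
have F0 : F 0 = 0.
  have := FK 0 W0; rewrite (semi_inner0l Wsub qsemi) // mulr0.
  by rewrite real_exprn_even_le0 ?num_real //= cmod_eq0 => /eqP.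
have := ReE _ Wi; rewrite -[_ *: _]addr0 Br // Fl // B0 F0 !addr0 !Re_mulc /=.
by rewrite !mul0r !sub0r !mulN1r !opprK.
Qed.

End LaxMilgram.

(** * Local geometry of the graph: distances, small balls, masses *)

Section Geometry.
Context {R : realType} (X : wgraph R) (N : nat) (CW Cmu : R).
Hypothesis geom : bounded_geometry X N CW Cmu.
Implicit Types x y z : X.

Lemma adjxx x : adj x x.
Proof. by rewrite /adj /adj_of eqxx orbT. Qed.

Lemma adjC x y : adj x y = adj y x.
Proof. by rewrite /adj /adj_of h_sym eq_sym. Qed.

Lemma adj_h_gt0 x y : adj x y -> y <> x -> 0 < h x y.
Proof. by move=> /orP[//|/eqP ->]. Qed.

Lemma finite_nbr x : finite_set (nbr x).
Proof. by case: geom => /(_ x) h _ _ _; apply/finite_set_leP; exists N. Qed.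

Lemma CW_ge1 : 1 <= CW.
Proof. by case: geom. Qed.

Lemma CW_gt0 : 0 < CW.
Proof. exact: lt_le_trans ltr01 CW_ge1. Qed.

Lemma adj_mu_gt0 x y : adj x y -> 0 < mu x y.
Proof. exact: mu_gt0. Qed.

Lemma mu_le x y z : adj x y -> adj x z -> mu x y <= Cmu * mu x z.
Proof.
move=> xy xz; case: geom => _ _ _ /(_ x y z xy xz).
by rewrite ler_pdivrMr // adj_mu_gt0.
Qed.

Lemma h_le x y z : adj x y -> adj x z -> z <> x -> h x y <= CW * h x z.
Proof.
move=> xy xz zx; have hz := adj_h_gt0 xz zx.
have [->|/eqP yx] := eqVneq y x; first by rewrite h_diag mulr_ge0 ?(ltW hz) // (ltW CW_gt0).
by case: geom => _ _ /(_ x y z xy xz yx zx)/andP[_ +] _; rewrite ler_pdivrMr.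
Qed.

Lemma h_le_hv x y : adj x y -> h x y <= hv x.
Proof.
move=> xy; apply: ub_le_sup; last by exists y.
have [/existsNP[z /not_implyP[xz zx]]|H] :=
    pselect (~ forall z, adj x z -> z = x); last first.
  exists 0 => _ [z xz <-]; move/contrapT : H => /(_ z xz) ->.
  by rewrite h_diag.
by exists (CW * h x z) => _ [t xt <-]; exact: h_le.
Qed.

Lemma hv_le x z : adj x z -> z <> x -> hv x <= CW * h x z.
Proof.
move=> xz zx; apply: ge_sup; first by exists (h x x), x => //; exact: adjxx.
by move=> _ [t xt <-]; exact: h_le.
Qed.

Lemma path_length_ge0 x p : 0 <= path_length (@h R X) x p.
Proof. by elim: p x => //= y p IH x; rewrite addr_ge0 ?h_ge0. Qed.

(** Paths may contain trivial steps [x ~ x] of length 0; skipping them exposes a genuine edge at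
    [x], whose weight is comparable with [hv x]. This is the only source of lower bounds on
    lengths. *)
Lemma first_edge x y p : joins (@h R X) x y p -> y <> x ->
  exists z, [/\ adj x z, z <> x & h x z <= path_length (@h R X) x p].
Proof.
elim: p x => [x [_ /= ->]//|z p IH x [/= /andP[xz pz] lz] yx].
have [zx|/eqP zx] := eqVneq z x.
  subst z; have [//|//|t [xt tx le]] := IH x; exists t; split => //.
  by apply: le_trans le _; rewrite lerDr h_ge0.
by exists z; split => //; rewrite lerDl path_length_ge0.
Qed.

Lemma last_edge x y p : joins (@h R X) x y p -> y <> x ->
  exists z, [/\ adj y z, z <> y & h y z <= path_length (@h R X) x p].
Proof.
elim: p x => [x [_ /= ->]//|z p IH x [/= /andP[xz pz] lz] yx].
have [zy|/eqP zy] := eqVneq z y.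
  exists x; split; [by rewrite adjC -zy|by move=> ?; apply: yx|].
  by rewrite h_sym -zy lerDl path_length_ge0.
have [//|//|] := IH z; first by move=> yz; apply: zy.
move=> t [yt ty le]; exists t; split => //.
by apply: le_trans le _; rewrite lerDr h_ge0.
Qed.

Lemma exists_nbr x : exists z, adj x z /\ z <> x.
Proof.
have [y yx] : exists y : X, y <> x.
  apply: contrapT => /forallNP H; apply: (@wgraph_infinite R X).
  apply: (sub_finite_set _ (finite_set1 x)) => y _ /=.
  exact: contrapT (H y).
have [p jp] := @wgraph_connected R X x y.
by have [z [xz zx _]] := first_edge jp yx; exists z.
Qed.

Lemma hv_gt0 x : 0 < hv x.
Proof.
have [z [xz zx]] := exists_nbr x.
exact: lt_le_trans (adj_h_gt0 xz zx) (h_le_hv xz).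
Qed.

Let has_inf_dist x y :
  has_inf [set path_length (@h R X) x p | p in joins (@h R X) x y].
Proof.
split; first by have [p jp] := @wgraph_connected R X x y; exists (path_length (@h R X) x p), p.
by exists 0 => _ [p _ <-]; exact: path_length_ge0.
Qed.

Lemma dist_le_path x y p : joins (@h R X) x y p ->
  dist x y <= path_length (@h R X) x p.
Proof. by move=> jp; apply: ge_inf; [case: (has_inf_dist x y)|exists p]. Qed.

Lemma dist_adherent x y r : dist x y < r ->
  exists2 p, joins (@h R X) x y p & path_length (@h R X) x p < r.
Proof.
rewrite -subr_gt0 => r0; have [_ [p jp <-]] := inf_adherent r0 (has_inf_dist x y).
by rewrite addrC subrK => le; exists p.
Qed.

Lemma dist_ge0 x y : 0 <= dist x y.
Proof.
apply: lb_le_inf; first by case: (has_inf_dist x y).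
by move=> _ [p _ <-]; exact: path_length_ge0.
Qed.

Lemma dist_self x : dist x x = 0.
Proof. by apply/eqP; rewrite eq_le dist_ge0 andbT (@dist_le_path x x [::]). Qed.

Lemma path_length_cat x p q :
  path_length (@h R X) x (p ++ q)
  = path_length (@h R X) x p + path_length (@h R X) (last x p) q.
Proof. by elim: p x => [|y p IH] x /=; rewrite ?add0r // IH addrA. Qed.

Lemma dist_triangle x y z : dist x z <= dist x y + dist y z.
Proof.
apply/ler_addgt0Pr => e e0; have e2 : 0 < 2^-1 * e by lra.
have [|p [pp lp] hp] := @dist_adherent x y (dist x y + 2^-1 * e); first by lra.
have [|q [pq lq] hq] := @dist_adherent y z (dist y z + 2^-1 * e); first by lra.
have : joins (@h R X) x z (p ++ q) by split; rewrite ?cat_path ?last_cat lp ?pp.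
by move=> /dist_le_path; rewrite path_length_cat lp => le; lra.
Qed.

Lemma dist_adj x y : adj x y -> dist x y <= h x y.
Proof.
move=> xy; have : joins (@h R X) x y [:: y] by split => //=; rewrite andbT.
by move=> /dist_le_path /=; rewrite addr0.
Qed.

(** The scale dichotomy: a ball of radius below [hv x / CW] contains nothing but its center. All
    radii below are measured against this threshold. *)
Lemma hv_le_dist_l x y r : y <> x -> dist x y < r -> hv x <= CW * r.
Proof.
move=> yx /dist_adherent[p jp lp]; have [z [xz zx le]] := first_edge jp yx.
apply: le_trans (hv_le xz zx) _.
by rewrite ler_pM2l ?CW_gt0 // (le_trans le) // ltW.
Qed.

Lemma hv_le_dist_r x y r : y <> x -> dist x y < r -> hv y <= CW * r.
Proof.
move=> yx /dist_adherent[p jp lp]; have [z [yz zy le]] := last_edge jp yx.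
apply: le_trans (hv_le yz zy) _.
by rewrite ler_pM2l ?CW_gt0 // (le_trans le) // ltW.
Qed.

Lemma gball_center x r : 0 < r -> gball x r x.
Proof. by rewrite /gball /= dist_self. Qed.

Lemma gball_small x r : 0 < r -> CW * r < hv x -> gball x r = [set x].
Proof.
move=> r0 hr; apply/seteqP; split => [y|y ->]; last exact: gball_center.
rewrite /gball /= => xy; apply: contrapT => yx.
by have := hv_le_dist_l yx xy; rewrite leNgt hr.
Qed.

Lemma gball_sub x r s : r <= s -> gball x r `<=` gball x s.
Proof. by move=> rs y /= xy; exact: lt_le_trans xy rs. Qed.

Lemma dist_gt0 x y : x <> y -> 0 < dist x y.
Proof.
move=> xy; rewrite ltNge; apply/negP => d0.
have hx := hv_gt0 x; have CW0 := CW_gt0.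
have r0 : 0 < hv x / (2 * CW) by rewrite divr_gt0 // mulr_gt0.
have := hv_le_dist_l (nesym xy) (le_lt_trans d0 r0).
rewrite (_ : CW * (hv x / (2 * CW)) = hv x / 2); first by lra.
by field; rewrite gt_eqF.
Qed.

Lemma hv_ball x y r : hv x <= CW * r -> gball x r y -> hv y <= CW * r.
Proof.
move=> hx xy; have [->//|/eqP yx] := eqVneq y x.
exact: hv_le_dist_r yx xy.
Qed.

(** Above the threshold, every vertex of the ball has its edges no longer than [CW * r], so
    following one edge enlarges the radius by the factor [1 + CW] at most. This is the origin of the
    constant [K] below. *)
Lemma dist_nbr x y z r : hv x <= CW * r -> gball x r y -> adj y z ->
  gball x ((1 + CW) * r) z.
Proof.
move=> hx xy yz; rewrite /gball /=; apply: le_lt_trans (dist_triangle x y z) _.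
rewrite mulrDl mul1r; apply: ltr_leD => //.
exact: le_trans (dist_adj yz) (le_trans (h_le_hv yz) (hv_ball hx xy)).
Qed.

Lemma mass_rsum x : rsummable (nbr x) (mu x) /\ mass x = rsum (nbr x) (mu x).
Proof.
have [] := rsum_finite (f := mu x) (finite_nbr x); last by move=> ? ->.
by move=> y /adj_mu_gt0/ltW.
Qed.

Lemma mu_le_mass x y : adj x y -> mu x y <= mass x.
Proof.
have [s ->] := mass_rsum x; move=> xy; apply: (term_le_rsum (f := mu x)) => //.
by move=> z /adj_mu_gt0/ltW.
Qed.

Lemma mass_gt0 x : 0 < mass x.
Proof. exact: lt_le_trans (adj_mu_gt0 (adjxx x)) (mu_le_mass (adjxx x)). Qed.

Lemma mass_le x y : adj x y -> mass x <= N%:R * Cmu * mu x y.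
Proof.
move=> xy; rewrite /mass fsbig_finite; last exact: finite_nbr.
have Cm : 0 <= Cmu * mu x y.
  exact: le_trans (ltW (adj_mu_gt0 xy)) (mu_le xy xy).
have le : (size (enum_fset (fset_set (nbr x))) <= N)%N.
  by apply: geq_card_fset_set; case: geom.
apply: le_trans (_ : (size (enum_fset (fset_set (nbr x))))%:R * (Cmu * mu x y) <= _); last first.
  by rewrite -mulrA ler_wpM2r // ler_nat.
have : forall z, z \in enum_fset (fset_set (nbr x)) -> adj x z.
  move=> z; rewrite -[_ \in _]/(z \in fset_set (nbr x)) in_fset_set; last exact: finite_nbr.
  by rewrite inE.
elim: (enum_fset _) => [|z s IH] sub; first by rewrite big_nil mul0r.
rewrite big_cons /= -natr1 mulrDl mul1r addrC lerD //.
  by apply: IH => t ts; apply: sub; rewrite inE ts orbT.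
by apply: mu_le => //; apply: sub; rewrite inE eqxx.
Qed.

Lemma NCmu_ge1 (x : X) : 1 <= N%:R * Cmu.
Proof.
have m0 := adj_mu_gt0 (adjxx x).
have := le_trans (mu_le_mass (adjxx x)) (mass_le (adjxx x)).
by rewrite -{1}[mu x x]mul1r ler_pM2r.
Qed.

(** Edges are attributed to their initial vertex, although they may leave [A]; sums over them thus
    become sums over [A] of vertex contributions. *)
Definition edges_from (A : set X) : set (X * X) :=
  [set e | adj e.1 e.2 /\ A e.1].

Lemma edges_fromT : @edges R X = edges_from setT.
Proof. by apply/seteqP; split => [e ?|e []]. Qed.

Lemma edges_fromS (A B : set X) : A `<=` B -> edges_from A `<=` edges_from B.
Proof. by move=> AB e [? /AB]. Qed.

Lemma rsum_edges_from (A : set X) (F : X * X -> R) :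
  (forall e, adj e.1 e.2 -> 0 <= F e) ->
  (rsummable (edges_from A) F <->
   rsummable A (fun x => rsum (nbr x) (fun y => F (x, y)))) /\
  rsum (edges_from A) F = rsum A (fun x => rsum (nbr x) (fun y => F (x, y))).
Proof.
move=> F0.
have g0 x : 0 <= rsum (nbr x) (fun y => F (x, y)).
  by apply: rsum_ge0 => y xy; exact: F0.
have sF x : rsummable (nbr x) (fun y => F (x, y)).
  by have [|] := rsum_finite (f := fun y => F (x, y)) (finite_nbr x) => // y xy; exact: F0.
have E : (\esum_(e in edges_from A) (F e)%:E =
    \esum_(x in A) (rsum (nbr x) (fun y => F (x, y)))%:E)%E.
  transitivity (\esum_(x in A) \esum_(y in nbr x) (F (x, y))%:E)%E; last first.
    by apply: eq_esum => x _; rewrite rsum_esum // => y xy; exact: F0.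
  rewrite (esum_esum (a := fun x y => (F (x, y))%:E)) => [|i j _ ij]; last by rewrite lee_fin F0.
  rewrite (_ : A `*`` _ = edges_from A); first by apply: eq_esum => -[].
  by apply/seteqP; split => -[x y] [].
have S (T : choiceType) (D : set T) (f : T -> R) : (forall t, D t -> 0 <= f t) ->
    rsummable D f = ((\esum_(t in D) (f t)%:E < +oo)%E : bool).
  move=> f0; rewrite /rsummable /summable.
  by congr (_ < _)%E; apply: eq_esum => t Dt; rewrite /= ger0_norm // f0.
have F0' e : edges_from A e -> 0 <= F e by move=> [/F0].
by split; [rewrite !S // E|rewrite !rsum_nneg // E].
Qed.

End Geometry.

(** * Sobolev norms in edge form, volumes, means and the Poincaré inequality *)

Definition dfe {R : realType} {X : wgraph R} (u : X -> R[i]) (e : X * X) : R[i] :=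
  df u e.1 e.2.

Definition mue {R : realType} {X : wgraph R} (e : X * X) : R := mu e.1 e.2.

Definition energy {R : realType} {X : wgraph R} (A : set X) (u : X -> R[i]) : R :=
  nsq (edges_from A) mue (dfe u).

Section FunctionSpaces.
Context {R : realType} (X : wgraph R) (N : nat) (CW Cmu : R).
Hypothesis geom : bounded_geometry X N CW Cmu.
Implicit Types (x y z : X) (u v f g : X -> R[i]).

Local Notation L2u u := (l2s setT (@mass R X) u).
Local Notation L2d u := (l2s (@edges R X) mue (dfe u)).

Lemma mass_ge0 (A : set X) x : A x -> 0 <= mass x.
Proof. by move=> _; rewrite ltW // (mass_gt0 geom). Qed.

Lemma mue_ge0 (A : set X) (e : X * X) : edges_from A e -> 0 <= mue e.
Proof. by move=> [/adj_mu_gt0/ltW]. Qed.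

Lemma mue_ge0T (e : X * X) : edges e -> 0 <= mue e.
Proof. by move=> /adj_mu_gt0/ltW. Qed.

Lemma df_lin (a : R[i]) u v x y :
  df (fun t => a * u t + v t) x y = a * df u x y + df v x y.
Proof. by rewrite /df; case: eqP => _; rewrite ?mulr0 ?addr0 // mulrA -mulrDl; congr (_ / _); ring. Qed.

Lemma cmod_df_ne u x y : adj x y -> y <> x ->
  cmod (df u x y) = cmod (u y - u x) / h x y.
Proof.
move=> xy yx; have hp := adj_h_gt0 xy yx.
rewrite /df; case: eqP => [e|_]; first by rewrite e in yx.
by rewrite cmodM cmodV cmod_real gtr0_norm.
Qed.

Let vertex_energy u x := rsum (nbr x) (fun y => cmod (df u x y) ^+ 2 * mu x y).

Let osc u x := rsum (nbr x) (fun y => cmod (u y - u x) ^+ 2).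

Let finsum x (f : X -> R) : (forall y, adj x y -> 0 <= f y) ->
  rsummable (nbr x) f /\ rsum (nbr x) f = \sum_(y \in nbr x) f y.
Proof. by apply: rsum_finite; exact: (finite_nbr geom). Qed.

Lemma sqr_grad u x : grad u x ^+ 2 = (hv x)^-1 ^+ 2 * osc u x.
Proof.
rewrite /grad exprMn sqr_sqrtr.
  by have [_ <-] := finsum (x := x) (f := fun y => cmod (u y - u x) ^+ 2) (fun y _ => sqr_ge0 _).
by apply: fsumr_ge0 => y _; exact: sqr_ge0.
Qed.

Let vertex_energy_ge0 u x : 0 <= vertex_energy u x.
Proof.
by apply: rsum_ge0 => y /adj_mu_gt0/ltW m0; rewrite mulr_ge0 ?sqr_ge0.
Qed.

Let vertex_energy_sum u x :
  rsummable (nbr x) (fun y => cmod (df u x y) ^+ 2 * mu x y).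
Proof.
by have [|] := finsum (x := x) (f := fun y => cmod (df u x y) ^+ 2 * mu x y) => //
  y /adj_mu_gt0/ltW m0; rewrite mulr_ge0 ?sqr_ge0.
Qed.

Let osc_sum u x : rsummable (nbr x) (fun y => cmod (u y - u x) ^+ 2).
Proof. by have [|] := finsum (x := x) (f := fun y => cmod (u y - u x) ^+ 2) => // y _; exact: sqr_ge0. Qed.

Lemma vertex_energy_le u x :
  vertex_energy u x <= CW ^+ 2 * (grad u x ^+ 2 * mass x).
Proof.
have hp := hv_gt0 geom x.
rewrite sqr_grad; set k := (hv x)^-1.
have -> : CW ^+ 2 * (k ^+ 2 * osc u x * mass x)
   = (CW ^+ 2 * k ^+ 2 * mass x) * osc u x by ring.
rewrite /osc -rsumZE // /vertex_energy; apply: ler_rsum => //; first exact: rsummableZ.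
move=> y xy; have [->|/eqP yx] := eqVneq y x.
  rewrite /df eqxx cmod0 expr0n mul0r mulr_ge0 ?sqr_ge0 //.
  by rewrite mulr_ge0 ?(ltW (mass_gt0 geom x)) // mulr_ge0 ?sqr_ge0.
have hq := adj_h_gt0 xy yx.
rewrite cmod_df_ne // exprMn.
have -> : cmod (u y - u x) ^+ 2 * (h x y)^-1 ^+ 2 * mu x y =
  (h x y)^-1 ^+ 2 * mu x y * cmod (u y - u x) ^+ 2 by ring.
rewrite ler_wpM2r ?sqr_ge0 //; apply: ler_pM; rewrite ?sqr_ge0 //; [exact/ltW/adj_mu_gt0| |exact: (mu_le_mass geom)].
rewrite -exprMn lerXn2r ?nnegrE ?invr_ge0 ?(ltW hq) //.
  by rewrite mulr_ge0 ?invr_ge0 ?ltW // (CW_gt0 geom).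
by rewrite ler_pdivlMr // ler_pdivrMl // mulrC; apply: (hv_le geom).
Qed.

(** Uses [h x y <= hv x] and that [mass x] is at most [N * Cmu] times each [mu x y]. This factor is
    the one paid when the Poincaré inequality is rewritten in terms of edge differences. *)
Lemma grad_le_vertex_energy u x :
  grad u x ^+ 2 * mass x <= N%:R * Cmu * vertex_energy u x.
Proof.
have hp := hv_gt0 geom x; have mp := mass_gt0 geom x.
have K1 := NCmu_ge1 geom x.
have so := osc_sum u x; have sv := vertex_energy_sum u x.
rewrite sqr_grad mulrAC /osc /vertex_energy -!rsumZE //.
apply: ler_rsum; [exact: rsummableZ|exact: rsummableZ|].
move=> y xy; have [->|/eqP yx] := eqVneq y x.
  by rewrite /df eqxx subrr cmod0 expr0n mul0r !mulr0.
have hq := adj_h_gt0 xy yx.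
rewrite cmod_df_ne // exprMn.
have -> : N%:R * Cmu * (cmod (u y - u x) ^+ 2 * (h x y)^-1 ^+ 2 * mu x y) =
  ((h x y)^-1 ^+ 2 * (N%:R * Cmu * mu x y)) * cmod (u y - u x) ^+ 2 by ring.
rewrite ler_wpM2r ?sqr_ge0 //; apply: ler_pM; rewrite ?sqr_ge0 ?(ltW mp) //.
  rewrite lerXn2r ?nnegrE ?invr_ge0 ?(ltW hq) ?(ltW hp) //.
  by rewrite lef_pV2 ?posrE // (h_le_hv geom).
exact: (mass_le geom).
Qed.

Let edge_term_ge0 u (e : X * X) :
  adj e.1 e.2 -> 0 <= cmod (dfe u e) ^+ 2 * mue e.
Proof. by move=> /adj_mu_gt0/ltW m0; rewrite mulr_ge0 ?sqr_ge0. Qed.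

Lemma energy_vertex (A : set X) u :
  (l2s (edges_from A) mue (dfe u) <-> rsummable A (vertex_energy u)) /\
  energy A u = rsum A (vertex_energy u).
Proof.
by have := rsum_edges_from geom A (F := fun e => cmod (dfe u e) ^+ 2 * mue e) (edge_term_ge0 u).
Qed.

Lemma energy_mono (A B : set X) u : A `<=` B -> L2d u -> energy A u <= energy B u.
Proof.
move=> AB ld; apply: rsum_sub; last exact: edges_fromS.
  by move=> e [ae _]; exact: edge_term_ge0.
by apply: rsummable_sub ld => e [].
Qed.

Lemma normL2_fin f : (normL2 f < +oo)%E <-> L2u f.
Proof.
have t0 x : 0 <= cmod (f x) ^+ 2 * mass x.
  by rewrite mulr_ge0 ?sqr_ge0 // ltW // (mass_gt0 geom).
have e0 : (0 <= \esum_(x in [set: X]) (cmod (f x) ^+ 2 * mass x)%:E)%E.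
  by apply: esum_ge0 => x _; rewrite lee_fin.
rewrite -ge0_fin_numE; last exact: sqrte_ge0.
rewrite /normL2 sqrte_fin_num // ge0_fin_numE //.
split; first by apply: rsummable_nneg => x _; exact: t0.
by move=> /(esum_fin_num (fun x _ => t0 x)); rewrite ge0_fin_numE.
Qed.

Lemma normL2E f : L2u f -> normL2 f = (Num.sqrt (nsq setT (@mass R X) f))%:E.
Proof.
move=> lf; rewrite /normL2 -rsum_esum //.
by move=> x _; rewrite mulr_ge0 ?sqr_ge0 // ltW // (mass_gt0 geom).
Qed.

(** The two pointwise comparisons above make the gradient norm equivalent to the norm of the edge
    differences, the quantity that the form sees. *)
Lemma W12_l2 u : W12 u <-> L2u u /\ L2d u.
Proof.
have mp x := mass_gt0 geom x.
have gE : (fun x => cmod (grad u x)%:C%C ^+ 2 * mass x) = (fun x => grad u x ^+ 2 * mass x).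
  by apply/funext => x; rewrite cmod_real real_normK ?num_real.
have L2g : L2u (fun x => (grad u x)%:C%C) <-> L2d u.
  rewrite edges_fromT (energy_vertex setT u).1 /l2s gE; split; last first.
    move=> /(rsummableZ (N%:R * Cmu)); apply: rsummable_le => x _.
    rewrite ger0_norm ?grad_le_vertex_energy // mulr_ge0 ?sqr_ge0 //; exact/ltW.
  move=> /(rsummableZ (CW ^+ 2)); apply: rsummable_le => x _.
  by rewrite ger0_norm ?vertex_energy_le.
rewrite -normL2_fin -L2g -normL2_fin /W12 /= /normW12.
have n0 f : (0 <= normL2 f)%E by exact: sqrte_ge0.
split; last by move=> [? ?]; exact: lte_add_pinfty.
by move=> lt; split; apply: le_lt_trans lt; rewrite ?leeDl ?leeDr.
Qed.

Lemma W12_lin (a : R[i]) u v : W12 u -> W12 v -> W12 (fun x => a * u x + v x).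
Proof.
move=> /W12_l2[u1 u2] /W12_l2[v1 v2]; apply/W12_l2; split.
  by apply: (l2sD (@mass_ge0 setT)) => //; apply: (l2sZ (@mass_ge0 setT)).
have -> : dfe (fun x => a * u x + v x) = (fun e => a * dfe u e + dfe v e).
  by apply/funext => e; rewrite /dfe df_lin.
by apply: (l2sD mue_ge0T) => //; apply: (l2sZ mue_ge0T).
Qed.

Lemma rsummable_finsupp {T : choiceType} (D F : set T) (f : T -> R) : finite_set F ->
  (forall t, D t -> 0 <= f t) -> (forall t, D t -> ~ F t -> f t = 0) -> rsummable D f.
Proof.
move=> fF f0 fs.
have fDF : finite_set (D `&` F) by exact: finite_setIr.
have [] := rsum_finite (f := f) fDF; first by move=> t [/f0].
move=> /(rsummable_mkcond (@subIsetl _ D F)) + _; apply: rsummable_le => t Dt.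
case: ifPn => [_|nt]; first by rewrite ger0_norm ?f0.
rewrite fs ?normr0 // => Ft; move/negP: nt; apply.
by rewrite inE.
Qed.

(** Local finiteness: only finitely many edges meet [x]. These test functions serve to separate
    points. *)
Lemma W12_delta x : W12 (fun y => if y == x then 1 else 0 : R[i]).
Proof.
set d := fun y => _; apply/W12_l2; split.
  apply: (rsummable_finsupp (finite_set1 x)) => [y _|y _ /= /eqP/negbTE yx].
    by rewrite mulr_ge0 ?sqr_ge0 // ltW // (mass_gt0 geom).
  by rewrite /d yx cmod0 expr0n mul0r.
apply: (@rsummable_finsupp _ _ ([set x] `*` nbr x `|` nbr x `*` [set x])).
- by rewrite finite_setU; split; apply: finite_setX => //; exact: (finite_nbr geom).
- exact: edge_term_ge0.
- move=> [y z] /= yz nF; rewrite /dfe /df /=.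
  case: eqP => [_|neq]; first by rewrite cmod0 expr0n mul0r.
  have zx : z <> x by move=> zx; apply: nF; right; split => //=; rewrite /nbr /= adjC -zx.
  have yx : y <> x by move=> yx; apply: nF; left; split => //=; rewrite /nbr /= -yx.
  by rewrite /d (introF eqP zx) (introF eqP yx) subrr mul0r cmod0 expr0n mul0r.
Qed.

(** At radius [hv x / (2 * CW)], half the threshold, the ball is a singleton; doubling propagates
    finiteness to all larger radii. *)
Lemma finite_volume CD x r : doubling X CD -> rsummable (gball x r) (@mass R X).
Proof.
move=> dbl; have hp := hv_gt0 geom x; have Cp := CW_gt0 geom.
pose r0 := hv x / (2 * CW).
have r0p : 0 < r0 by rewrite divr_gt0 // mulr_gt0.
have m0 y : 0 <= mass y by apply/ltW/(mass_gt0 geom).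
have fin n : (vol x (2 ^+ n * r0) < +oo)%E.
  elim: n => [|n IH].
    rewrite expr0 mul1r /vol (gball_small geom) //.
      by rewrite /vmeasure esum_set1 ?ltry // lee_fin.
    have -> : CW * r0 = 2^-1 * hv x by rewrite /r0; field; rewrite gt_eqF.
    lra.
  rewrite exprS -mulrA; apply: le_lt_trans (dbl x _ _) _.
    by rewrite mulr_gt0 ?exprn_gt0.
  have v0 : (0 <= vol x (2 ^+ n * r0))%E by apply: esum_ge0 => y _; rewrite lee_fin.
  move: IH v0; case: (vol _ _) => //= a _ _.
  by rewrite -EFinM ltry.
have [n rn] : exists n, r <= 2 ^+ n * r0.
  exists (Num.trunc (`|r| / r0)).+1; rewrite -ler_pdivrMr //.
  have t : r / r0 <= `|r| / r0 by rewrite ler_pM2r ?invr_gt0 // ler_norm.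
  apply: le_trans t _; apply: ltW.
  apply: lt_le_trans (truncnS_gt (`|r| / r0)) _.
  rewrite -natrX ler_nat; exact/ltnW/ltn_expl.
apply: rsummable_sub (gball_sub (x := x) rn) _.
by apply: rsummable_nneg (fin n) => y _; exact: m0.
Qed.

Definition volume (B : set X) : R := rsum B (@mass R X).

Lemma volume_lower cL CD x r : doubling X CD -> lower_volume2 X cL -> 0 < r ->
  cL * r ^+ 2 <= volume (gball x r).
Proof.
move=> dbl [_ lv] r0; have := lv x r r0; rewrite /vol /vmeasure -rsum_esum ?lee_fin //.
  by move=> y _; apply/ltW/(mass_gt0 geom).
exact: finite_volume dbl.
Qed.

Lemma vmeasureE B : rsummable B (@mass R X) -> fine (vmeasure B) = volume B.
Proof.
move=> sB; rewrite /vmeasure -rsum_esum //.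
by move=> y _; apply/ltW/(mass_gt0 geom).
Qed.

(** The product of the volume of [B'] with [mean B' u - a] is the pairing of [u - a] with 1 over
    [B'], so this is Cauchy-Schwarz. It compares means over nested balls, and with [a = 0] it bounds
    a mean by the L^2 norm. *)
Lemma mean_sub_le B' B u (a : R[i]) : rsummable B (@mass R X) -> B' `<=` B ->
  0 < volume B' -> l2s B (@mass R X) u ->
  volume B' * cmod (mean B' u - a) ^+ 2 <= nsq B (@mass R X) (fun y => u y - a).
Proof.
move=> sB sub V0 lu.
have m0 A := @mass_ge0 A.
have sB' := rsummable_sub sub sB.
have lc A (k : R[i]) : rsummable A (@mass R X) -> l2s A (@mass R X) (fun=> k).
  by move=> sA; apply: rsummableZ.
have lu' : l2s B' (@mass R X) u by exact: rsummable_sub lu.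
have lua : l2s B (@mass R X) (fun y => u y - a) by apply: (l2sB (@m0 B)) => //; exact: lc.
have lua' : l2s B' (@mass R X) (fun y => u y - a) by exact: rsummable_sub lua.
have n1 : nsq B' (@mass R X) (fun=> 1) = volume B'.
  by apply: eq_rsum => y _; rewrite -[1]/(1%:C%C) cmod_real normr1 expr1n mul1r.
have E : pairing B' (@mass R X) (fun y => u y - a) (fun=> 1)
    = (volume B')%:C%C * (mean B' u - a).
  have -> : mean B' u = pairing B' (@mass R X) u (fun=> 1) / (volume B')%:C%C.
    rewrite /mean vmeasureE //; congr (_ / _); apply: eq_csum => y _.
    by rewrite rmorph1 mulr1.
  rewrite (pairingBl (@m0 B')) //; try exact: lc.
  rewrite mulrBr mulrCA divff ?mulr1; last first.
    by apply/eqP => -[] /eqP; rewrite gt_eqF.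
  congr (_ - _); have -> : (fun=> a) = (fun=> a * 1) :> (X -> R[i]).
    by apply/funext => y; rewrite mulr1.
  rewrite (pairingZl (@m0 B')); [|exact: lc|exact: lc].
  by rewrite pairing_self n1 mulrC.
have := pairing_CS (@m0 B') lua' (lc _ 1 sB').
rewrite E n1 cmodM cmod_real gtr0_norm // exprMn expr2.
rewrite [leRHS]mulrC -mulrA ler_pM2l // => H; apply: le_trans H _.
apply: rsum_sub => // y By; exact: (sqp_ge0 (@m0 B) (fun y => u y - a)).
Qed.

Lemma mean_set1 x u : mean [set x] u = u x.
Proof.
have [s1 e1] := rsum_finite (f := @mass R X) (finite_set1 x) (fun y _ => ltW (mass_gt0 geom y)).
have V0 : 0 < volume [set x] by rewrite /volume e1 fsbig_set1 (mass_gt0 geom).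
have lu : l2s [set x] (@mass R X) u.
  by have [] := rsum_finite (f := fun t => cmod (u t) ^+ 2 * mass t) (finite_set1 x)
    (fun y _ => mulr_ge0 (sqr_ge0 _) (ltW (mass_gt0 geom y))).
have := mean_sub_le (u x) s1 (@subset_refl _ _) V0 lu.
rewrite (_ : nsq _ _ _ = 0); last first.
  rewrite /nsq (@eq_rsum _ _ _ _ (fun=> 0)) ?rsum_nneg ?esum1 // => y ->.
  by rewrite subrr cmod0 expr0n mul0r.
rewrite pmulr_rle0 // real_exprn_even_le0 ?num_real //= cmod_eq0 subr_eq0.
by move/eqP.
Qed.

(** The absolute value of [CP] is taken since no sign is assumed. The summability asked by
    [poincare2] follows from [u] being square summable and the ball having finite volume. *)
Lemma poincare_energy CP CD x r u : doubling X CD -> poincare2 X CP -> 0 < r ->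
  L2u u -> L2d u ->
  nsq (gball x r) (@mass R X) (fun y => u y - mean (gball x r) u)
  <= `|CP| * (N%:R * Cmu) * r ^+ 2 * energy (gball x r) u.
Proof.
move=> dbl poin r0 lu ld; set B := gball x r.
have m0 := @mass_ge0 B.
have sB : rsummable B (@mass R X) := finite_volume x r dbl.
have luB : l2s B (@mass R X) u by exact: rsummable_sub lu.
have ldB : l2s (edges_from B) mue (dfe u).
  by apply: rsummable_sub ld => e [].
have sG : rsummable B (vertex_energy u) by apply/(energy_vertex B u).1.
have sg : rsummable B (fun y => grad u y ^+ 2 * mass y).
  apply: rsummable_le (rsummableZ (N%:R * Cmu) sG) => y By.
  by rewrite ger0_norm ?grad_le_vertex_energy // mulr_ge0 ?sqr_ge0 // m0.
have sm : summable B (fun y => (cmod (u y) * mass y)%:E).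
  apply: (rsummable_le (f := fun y => cmod (u y) * mass y) _ (rsummableD luB sB)) => y By.
  rewrite ger0_norm ?mulr_ge0 ?cmod_ge0 ?m0 //.
  rewrite -[X in _ + X]mul1r -mulrDl ler_wpM2r ?m0 //.
  by have := sqr_ge0 (cmod (u y) - 2^-1); lra.
have := poin x r r0 u sm; rewrite -/B -[(\esum_(_ in _) (grad _ _ ^+ 2 * _)%:E)%E]rsum_esum //; last first.
  by move=> y By; rewrite mulr_ge0 ?sqr_ge0 ?m0.
rewrite -EFinM => le.
have t0 y : B y -> 0 <= cmod (u y - mean B u) ^+ 2 * mass y.
  by move=> By; rewrite mulr_ge0 ?sqr_ge0 ?m0.
have lB : rsummable B (fun y => cmod (u y - mean B u) ^+ 2 * mass y).
  by apply: rsummable_nneg => //; apply: le_lt_trans le (ltry _).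
move: le; rewrite -rsum_esum // lee_fin => le.
apply: le_trans le _; rewrite (energy_vertex B u).2.
move: (r ^+ 2) (sqr_ge0 r) => r2 r20.
set S := rsum B _; set T := rsum B (vertex_energy u).
have S0 : 0 <= S by apply: rsum_ge0 => y By; rewrite mulr_ge0 ?sqr_ge0 ?m0.
have ST : S <= N%:R * Cmu * T.
  rewrite /S /T -rsumZE //; apply: ler_rsum => //; first exact: rsummableZ.
  by move=> y _; exact: grad_le_vertex_energy.
have h1 : CP * (r2 * S) <= `|CP| * (r2 * S) by rewrite ler_wpM2r ?ler_norm // mulr_ge0.
have h2 : `|CP| * (r2 * S) <= `|CP| * (r2 * (N%:R * Cmu * T)).
  by rewrite ler_wpM2l // ler_wpM2l.
by lra.
Qed.

End FunctionSpaces.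

(** * Trapezoidal cutoffs at dyadic radii *)

Section Cut.
Context {R : realType}.
Implicit Types (rho r t : R).

(** A plateau of height [rho / 2] up to [rho / 2], then slope -1 down to 0 at [rho]. For
    [rho = r / 2 ^+ j] the sloping intervals are adjacent, so that the sum of the cutoffs is again a
    single trapezoid of slope -1. *)
Definition cut rho t : R := Num.min (rho / 2) (Num.max 0 (rho - t)).

Lemma cut_ge0 rho t : 0 <= rho -> 0 <= cut rho t.
Proof. by move=> r0; rewrite /cut le_min le_max lexx divr_ge0. Qed.

Lemma cut_le rho t : cut rho t <= rho / 2.
Proof. by rewrite /cut ge_min lexx. Qed.

Lemma cut_full rho t : 0 <= rho -> t <= rho / 2 -> cut rho t = rho / 2.
Proof. by move=> r0 tr; rewrite /cut min_l // le_max; apply/orP; right; lra. Qed.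

Lemma cut_out rho t : 0 <= rho -> rho <= t -> cut rho t = 0.
Proof. by move=> r0 tr; rewrite /cut max_l ?min_r ?divr_ge0 //; lra. Qed.

Lemma cut_anti rho t t' : t <= t' -> cut rho t' <= cut rho t.
Proof.
by move=> tt; rewrite /cut; case: (lerP 0 (rho - t)); case: (lerP 0 (rho - t'));
  move=> ? ?; rewrite ?ge_min ?le_min; case: lerP => ?; case: lerP => ?; lra.
Qed.

Lemma cut_sum r t M : 0 < r ->
  \sum_(j < M) cut (r / 2 ^+ j) t
  = Num.min (r - r / 2 ^+ M) (Num.max 0 (r - t)).
Proof.
move=> r0; elim: M => [|M IH].
  by rewrite big_ord0 expr0 divr1 subrr min_l // le_max lexx.
rewrite big_ord_recr /= IH exprS invfM mulrA [r / 2]mulrC -mulrA.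
have a0 : 0 < r / 2 ^+ M by rewrite divr_gt0 // exprn_gt0.
have ar : r / 2 ^+ M <= r.
  by rewrite ler_pdivrMr ?exprn_gt0 // ler_pMr // exprn_ege1 // ler1n.
move: (r / 2 ^+ M) a0 ar => a a0 ar; rewrite /cut.
case: (lerP 0 (r - t)) => ?; case: (lerP 0 (a - t)) => ?;
  do ![case: lerP => ?]; lra.
Qed.

(** All cutoffs decrease, so the absolute differences add up without cancellation to the difference
    of the total trapezoid, which is 1-Lipschitz. This expresses that the gradients live on
    different annuli, and remains valid for an edge crossing several of them. *)
Lemma cut_diff_sum r t t' M : 0 < r ->
  \sum_(j < M) `|cut (r / 2 ^+ j) t - cut (r / 2 ^+ j) t'| <= `|t - t'|.
Proof.
move=> r0; wlog tt : t t' / t <= t'.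
  move=> H; have [tt|/ltW tt] := leP t t'; first exact: H.
  rewrite distrC; apply: le_trans (H _ _ tt).
  by apply: ler_sum => j _; rewrite distrC.
rewrite (eq_bigr (fun j : 'I_M => cut (r / 2 ^+ j) t - cut (r / 2 ^+ j) t')); last first.
  by move=> j _; rewrite ger0_norm // subr_ge0 cut_anti.
rewrite big_split /= sumrN !cut_sum // distrC ger0_norm ?subr_ge0 //.
move: (r - r / 2 ^+ M) => A.
by case: (lerP 0 (r - t)) => ?; case: (lerP 0 (r - t')) => ?;
  do ?[case: (lerP A _) => ?]; lra.
Qed.

(** Expansion of the weighted variance around [S]; the total weight only needs to be at most 1. *)
Lemma jensen_sum M (a b : 'I_M -> R) : (forall j, 0 <= b j) ->
  \sum_j b j <= 1 -> (\sum_j b j * a j) ^+ 2 <= \sum_j b j * a j ^+ 2.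
Proof.
move=> b0 b1; set S := \sum_j b j * a j.
have : 0 <= \sum_j b j * (a j - S) ^+ 2.
  by apply: sumr_ge0 => j _; rewrite mulr_ge0 ?sqr_ge0.
rewrite (eq_bigr (fun j => (b j * a j ^+ 2 - (2 * S) * (b j * a j)) + S ^+ 2 * b j)); last first.
  by move=> j _; ring.
rewrite !big_split /= sumrN -!mulr_sumr -/S.
have := ler_wpM2l (sqr_ge0 S) b1; lra.
Qed.

Lemma cmod_sum M (z : 'I_M -> R[i]) : cmod (\sum_j z j) <= \sum_j cmod (z j).
Proof.
elim/big_rec2: _ => [|j a b _ le]; first by rewrite cmod0.
by apply: le_trans (cmodD _ _) _; rewrite lerD2l.
Qed.

Lemma rsum_sum {T : choiceType} (D : set T) M (f : 'I_M -> T -> R) :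
  (forall j, rsummable D (f j)) ->
  rsummable D (fun x => \sum_j f j x) /\
  rsum D (fun x => \sum_j f j x) = \sum_j rsum D (f j).
Proof.
elim: M f => [|M IH] f sf.
  have E : (fun x => \sum_j f j x) = (fun=> 0) by apply/funext => x; rewrite big_ord0.
  rewrite E big_ord0; split; first exact: rsummable0.
  by rewrite rsum_nneg ?esum1.
have E : (fun x => \sum_j f j x) =
    (fun x => f ord0 x + \sum_(j < M) f (lift ord0 j) x).
  by apply/funext => x; rewrite big_ord_recl.
have [s e] := IH (fun j => f (lift ord0 j)) (fun j => sf _).
rewrite E; split; first exact: rsummableD.
by rewrite rsumD // e big_ord_recl.
Qed.

End Cut.

(** * Localization by cutoffs averaged over scales *)

Section Localization.
Context {R : realType} (X : wgraph R) (N : nat) (CW Cmu CD CP : R).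
Hypothesis geom : bounded_geometry X N CW Cmu.
Hypothesis dbl : doubling X CD.
Hypothesis poin : poincare2 X CP.
Implicit Types (x y z : X) (u v f g : X -> R[i]).

Variables (o : X) (r : R) (M : nat).
Hypothesis r_gt0 : 0 < r.
Hypothesis M_gt0 : (0 < M)%N.
Hypothesis hv_o : hv o <= CW * (r / 2 ^+ M).

(** The balls [B j] are enlarged by [K] so that they contain both endpoints of every edge on which
    [chi j] does not vanish identically. The hypothesis on [hv o] keeps all scales down to
    [r / 2 ^+ M] above the singleton threshold. *)
Let K := 1 + CW.
Let P := `|CP| * (N%:R * Cmu).
Let rj (j : nat) := r / 2 ^+ j.
Let B (j : nat) : set X := gball o (K * rj j).
Let chi (j : nat) x : R := cut (rj j) (dist o x) / (rj j / 2).

Let K1 : 1 <= K. Proof. by rewrite /K lerDl (ltW (CW_gt0 geom)). Qed.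
Let K0 : 0 < K. Proof. exact: lt_le_trans ltr01 K1. Qed.
Let P0 : 0 <= P.
Proof. by rewrite mulr_ge0 // (le_trans ler01) // (NCmu_ge1 geom o). Qed.
Let PK0 : 0 <= P * K ^+ 2. Proof. by apply: mulr_ge0 => //; exact: sqr_ge0. Qed.
Let rj_gt0 j : 0 < rj j. Proof. by rewrite divr_gt0 // exprn_gt0. Qed.
Let rj2_gt0 j : 0 < rj j / 2. Proof. by rewrite divr_gt0. Qed.
Let rj_le j k : (j <= k)%N -> rj k <= rj j.
Proof.
by move=> jk; rewrite ler_pM2l // lef_pV2 ?posrE ?exprn_gt0 // ler_weXn2l // ler1n.
Qed.
Let MR : 0 < M%:R :> R. Proof. by rewrite ltr0n. Qed.

(* The gradients of the M dyadic cutoffs chi_j live on different annuli, so that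
   averaging them gains a factor 1/M in [loc_err]; centering v at scale r_j lets
   the Poincare inequality compensate for |d chi_j| <= 2 / r_j. *)
Definition cutoff_avg x : R := M%:R^-1 * \sum_(j < M) chi j x.

Definition localize v x : R[i] :=
  \sum_(j < M) (M%:R^-1 * chi j x)%:C%C * (v x - mean (B j) v).

Definition loc_err v (e : X * X) : R[i] :=
  \sum_(j < M) (M%:R^-1 * (chi j e.2 - chi j e.1) / h e.1 e.2)%:C%C
    * (v e.1 - mean (B j) v).

Let chi_ge0 j x : 0 <= chi j x.
Proof. by rewrite divr_ge0 ?cut_ge0 // ltW. Qed.

Let chi_le1 j x : chi j x <= 1.
Proof. by rewrite ler_pdivrMr // mul1r cut_le. Qed.

Let chi_out j x : rj j <= dist o x -> chi j x = 0.
Proof. by move=> le; rewrite /chi cut_out ?mul0r // ltW. Qed.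

Let chi_in j x : (j < M)%N -> dist o x < rj M -> chi j x = 1.
Proof.
move=> jM xM; rewrite /chi cut_full ?divff ?gt_eqF ?(ltW (rj_gt0 _)) //.
apply: le_trans (ltW xM) _; apply: le_trans (rj_le jM) _.
by rewrite /rj exprSr invfM mulrA.
Qed.

Let hv_j j : (j <= M)%N -> hv o <= CW * rj j.
Proof.
by move=> jM; apply: le_trans hv_o _; rewrite ler_pM2l ?(CW_gt0 geom) // rj_le.
Qed.

Let sub_B j x : dist o x < rj j -> B j x.
Proof. by move=> h; apply: lt_le_trans h _; rewrite ler_peMl // ltW. Qed.

Let nbr_B j x y : (j <= M)%N -> adj x y -> dist o y < rj j -> B j x.
Proof.
move=> jM xy yj; apply: (dist_nbr geom (hv_j jM) yj).
by rewrite adjC.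
Qed.

Let chi_supp j x : (j < M)%N -> ~ B j x -> chi j x = 0.
Proof.
by move=> jM nB; apply: chi_out; rewrite leNgt; apply/negP => /sub_B.
Qed.

Let chi_nbr j x y : (j < M)%N -> adj x y -> ~ B j x -> chi j y = 0.
Proof.
move=> jM xy nB; apply: chi_out; rewrite leNgt; apply/negP => yj; apply: nB.
exact: nbr_B (ltnW jM) xy yj.
Qed.

Let B_sub j : B j `<=` B 0.
Proof. by apply: gball_sub; rewrite ler_pM2l // rj_le. Qed.

Let mueT (e : X * X) : edges e -> 0 <= mue e.
Proof. exact: mue_ge0T. Qed.

Lemma cutoff_avg_ge0 x : 0 <= cutoff_avg x.
Proof. by rewrite mulr_ge0 ?invr_ge0 ?(ltW MR) // sumr_ge0. Qed.

Lemma cutoff_avg_le1 x : cutoff_avg x <= 1.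
Proof.
rewrite ler_pdivrMl // mulr1 -[leRHS](_ : \sum_(j < M) 1 = _).
  by apply: ler_sum => j _.
by rewrite sumr_const card_ord.
Qed.

Lemma cutoff_avg_supp x y : adj x y -> ~ gball o (K * r) x -> cutoff_avg y = 0.
Proof.
move=> xy nB; rewrite /cutoff_avg big1 ?mulr0 // => j _; apply: (chi_nbr _ xy) => //.
by move=> /B_sub; rewrite /B /rj expr0 divr1.
Qed.

Lemma loc_err_supp v e : adj e.1 e.2 -> ~ gball o (K * r) e.1 -> loc_err v e = 0.
Proof.
move=> xy nB; rewrite /loc_err big1 // => j _.
have nBj : ~ B j e.1 by move=> /B_sub; rewrite /B /rj expr0 divr1.
by rewrite (chi_nbr _ xy nBj) // (chi_supp _ nBj) // subrr mulr0 mul0r mul0r.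
Qed.

(** Discrete Leibniz rule, applied at each scale after subtracting the mean. It is exact because the
    cutoff is taken at the terminal vertex and [v] at the initial one; this asymmetry is why
    [cutoff_avg_supp] speaks of a neighbor. *)
Lemma dfe_localize v e : adj e.1 e.2 ->
  dfe (localize v) e = (cutoff_avg e.2)%:C%C * dfe v e + loc_err v e.
Proof.
case: e => x y /= xy; rewrite /dfe /df /=; case: eqP => [<-|/eqP nxy].
  rewrite mulr0 add0r /loc_err big1 // => j _ /=.
  by rewrite subrr mulr0 mul0r mul0r.
have hp : h x y != 0.
  by rewrite gt_eqF // (adj_h_gt0 xy) // => e; rewrite e eqxx in nxy.
rewrite /cutoff_avg /localize /loc_err /= -sumrB mulr_suml mulr_sumr.
rewrite rmorph_sum mulr_suml -big_split /=; apply: eq_bigr => j _.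
have Q (k a b w p q m : R[i]) : (k * b * (q - m) - k * a * (p - m)) * w =
  k * b * ((q - p) * w) + k * (b - a) * w * (p - m) by ring.
move: (chi j x) (chi j y) => a b.
by rewrite !realcM realcB (realcV (h x y)) Q.
Qed.

(** Within radius [r / 2 ^+ M] all [chi j] equal 1, so that [localize v] is [v] minus an average of
    means, a constant. *)
Lemma dfe_localize_in v e : adj e.1 e.2 ->
  gball o (r / 2 ^+ M) e.1 -> gball o (r / 2 ^+ M) e.2 ->
  dfe (localize v) e = dfe v e.
Proof.
case: e => x y /= xy xM yM; rewrite /dfe /df /=; case: eqP => // _.
congr (_ / _); rewrite /localize -sumrB.
have MC : (M%:R : R[i]) != 0 by rewrite pnatr_eq0 -lt0n.
rewrite (eq_bigr (fun=> M%:R^-1 * (v y - v x))).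
  by rewrite sumr_const card_ord -[LHS]mulr_natl mulrA divff // mul1r.
move=> j _; rewrite !chi_in // mulr1 fmorphV rmorph_nat; ring.
Qed.

Let G v (j : nat) x : R :=
  if x \in B j then cmod (v x - mean (B j) v) ^+ 2 else 0.

Let G_ge0 v j x : 0 <= G v j x.
Proof. by rewrite /G; case: ifP => _ //; exact: sqr_ge0. Qed.

Lemma cmod_localize_le v x :
  cmod (localize v x) ^+ 2 <= \sum_(j < M) M%:R^-1 * G v j x.
Proof.
apply: le_trans (_ : (\sum_(j < M) M%:R^-1 * (chi j x * cmod (v x - mean (B j) v))) ^+ 2 <= _).
  rewrite lerXn2r ?nnegrE ?cmod_ge0 //.
    apply: sumr_ge0 => j _; apply: mulr_ge0; first by rewrite invr_ge0 ltW.
    by rewrite mulr_ge0 ?cmod_ge0.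
  apply: le_trans (cmod_sum _) _; apply: ler_sum => j _.
  move: (chi j x) (chi_ge0 j x) => a a0.
  have k0 : 0 <= M%:R^-1 * a by apply: mulr_ge0 => //; rewrite invr_ge0 ltW.
  by rewrite cmodM cmod_real ger0_norm // mulrA.
have := @jensen_sum R M (fun j => chi j x * cmod (v x - mean (B j) v)) (fun=> M%:R^-1).
move=> /(_ _ _)/le_trans; apply.
- by move=> j; rewrite invr_ge0 ltW.
- by rewrite sumr_const card_ord -[leLHS]mulr_natl divff // gt_eqF.
apply: ler_sum => j _; rewrite ler_wpM2l ?invr_ge0 ?(ltW MR) // /G.
case: ifPn => [_|nB]; last first.
  rewrite chi_supp ?mul0r ?expr0n // => Bx; move/negP: nB; apply; exact/mem_set.
apply: lerXn2r; rewrite ?nnegrE ?cmod_ge0 //.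
  by apply: mulr_ge0 => //; exact: cmod_ge0.
by apply: ler_piMl => //; exact: cmod_ge0.
Qed.

(** Jensen is applied with the weights [b j], the slopes of the cutoffs along the edge, whose sum is
    at most 1 by [cut_diff_sum] instead of at most M. The full square of the averaging factor [M^-1]
    therefore survives, to be set against M terms. *)
Lemma cmod_loc_err_le v e : adj e.1 e.2 ->
  cmod (loc_err v e) ^+ 2 <=
  \sum_(j < M) (M%:R^-1 ^+ 2 * (2 / rj j) ^+ 2) * G v j e.1.
Proof.
case: e => x y /= xy; have MV : 0 <= M%:R^-1 :> R by rewrite invr_ge0 ltW.
have [yx|/eqP yx] := eqVneq y x.
  rewrite /loc_err big1 ?cmod0 ?expr0n /=; last first.
    by move=> j _ /=; rewrite yx subrr mulr0 mul0r mul0r.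
  by apply: sumr_ge0 => j _; apply: mulr_ge0; [rewrite mulr_ge0 ?sqr_ge0|exact: G_ge0].
have hp := adj_h_gt0 xy yx.
pose b (j : 'I_M) := `|cut (rj j) (dist o x) - cut (rj j) (dist o y)| / h x y.
pose a (j : 'I_M) := 2 / rj j * cmod (v x - mean (B j) v).
have b0 j : 0 <= b j by rewrite divr_ge0 // ltW.
have bs : \sum_j b j <= 1.
  rewrite -mulr_suml ler_pdivrMr // mul1r; apply: le_trans (cut_diff_sum _ _ _ r_gt0) _.
  rewrite ler_norml; apply/andP; split.
    have := dist_triangle o x y; have := dist_adj xy; lra.
  have := dist_triangle o y x; rewrite adjC in xy.
  have := dist_adj xy; rewrite h_sym; lra.
have bnB (j : 'I_M) : x \notin B j -> b j = 0.
  move=> nB; have nBx : ~ B j x by move=> Bx; move/negP: nB; apply; exact/mem_set.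
  have := chi_nbr (ltn_ord j) xy nBx; have := chi_supp (ltn_ord j) nBx.
  have n0 : (rj j / 2)^-1 != 0 by rewrite invr_neq0 // gt_eqF.
  rewrite /chi /b => /eqP; rewrite mulf_eq0 (negbTE n0) orbF => /eqP ->.
  by move=> /eqP; rewrite mulf_eq0 (negbTE n0) orbF => /eqP ->; rewrite subrr normr0 mul0r.
apply: le_trans (_ : (M%:R^-1 * \sum_j b j * a j) ^+ 2 <= _).
  rewrite lerXn2r ?nnegrE ?cmod_ge0 //.
    rewrite mulr_ge0 // sumr_ge0 // => j _; rewrite mulr_ge0 // mulr_ge0 ?cmod_ge0 //.
    by rewrite divr_ge0 // ltW.
  apply: le_trans (cmod_sum _) _; rewrite mulr_sumr; apply: ler_sum => j _ /=.
  rewrite cmodM cmod_real !normrM (ger0_norm MV) normfV (gtr0_norm hp).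
  rewrite /a /b /chi -mulrBl normrM normfV (gtr0_norm (rj2_gt0 j)) distrC.
  by rewrite le_eqVlt; apply/orP; left; apply/eqP; field; rewrite !gt_eqF.
rewrite exprMn; apply: le_trans (ler_wpM2l (sqr_ge0 _) (jensen_sum _ b0 bs)) _.
rewrite mulr_sumr; apply: ler_sum => j _; rewrite -mulrA ler_wpM2l ?sqr_ge0 // /G.
case: ifPn => [_|nB]; last by rewrite bnB // mul0r mulr0.
rewrite /a exprMn; apply: ler_piMl; first by rewrite mulr_ge0 ?sqr_ge0.
apply: le_trans bs; rewrite (bigD1 j) //= lerDl sumr_ge0 //.
Qed.

Variable v : X -> R[i].
Hypothesis v_L2 : l2s setT (@mass R X) v.
Hypothesis v_energy : l2s (@edges R X) mue (dfe v).

Let E := energy (gball o (K * r)) v.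

Let energy_B j : energy (B j) v <= E.
Proof.
have BT : edges_from (gball o (K * r)) `<=` @edges R X by move=> e [].
rewrite /energy /nsq; apply: rsum_sub.
- exact: (sqp_ge0 (mue_ge0 (A := gball o (K * r)))).
- exact: rsummable_sub BT v_energy.
- by apply: edges_fromS => x /B_sub; rewrite /B /rj expr0 divr1.
Qed.

Let poin_B j : nsq (B j) (@mass R X) (fun x => v x - mean (B j) v)
  <= P * K ^+ 2 * rj j ^+ 2 * E.
Proof.
have Kr : 0 < K * rj j by rewrite mulr_gt0.
apply: le_trans (poincare_energy geom o dbl poin Kr v_L2 v_energy) _.
rewrite -/P exprMn mulrA.
by apply: ler_wpM2l (energy_B j); apply: mulr_ge0; rewrite ?sqr_ge0 // mulr_ge0 ?sqr_ge0.
Qed.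

Let sum_G (k : 'I_M -> R) :
  rsummable setT (fun x => (\sum_(j < M) k j * G v j x) * mass x) /\
  rsum setT (fun x => (\sum_(j < M) k j * G v j x) * mass x) =
  \sum_(j < M) k j * nsq (B j) (@mass R X) (fun x => v x - mean (B j) v).
Proof.
have GE j : (fun x => G v j x * mass x) = (fun x => if x \in B j then
    cmod (v x - mean (B j) v) ^+ 2 * mass x else 0).
  by apply/funext => x; rewrite /G; case: ifP => //; rewrite mul0r.
have sG j : rsummable setT (fun x => G v j x * mass x).
  rewrite GE; apply: rsummable_mkcond => //.
  have mB := @mass_ge0 R X N CW Cmu geom (B j).
  apply: (l2sB mB); first exact: rsummable_sub v_L2.
  by apply: rsummableZ; exact: (finite_volume geom o _ dbl).
have -> : (fun x => (\sum_(j < M) k j * G v j x) * mass x) =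
    (fun x => \sum_(j < M) k j * (G v j x * mass x)).
  by apply/funext => x; rewrite mulr_suml; apply: eq_bigr => j _; rewrite mulrA.
have [s ->] := rsum_sum (D := setT) (fun j : 'I_M => rsummableZ (k j) (sG j)).
split => //; apply: eq_bigr => j _; rewrite rsumZE // GE /nsq.
by congr (_ * _); rewrite -rsum_mkcond.
Qed.

Lemma localize_L2 : l2s setT (@mass R X) (localize v) /\
  nsq setT (@mass R X) (localize v) <= P * K ^+ 2 * r ^+ 2 * E.
Proof.
have [s e] := sum_G (fun=> M%:R^-1).
have m0 x := mass_gt0 geom x.
split.
  apply: rsummable_le s => x _; rewrite ger0_norm; last first.
    by apply: mulr_ge0; [exact: sqr_ge0|exact/ltW].
  by rewrite ler_pM2r // cmod_localize_le.
have le : nsq setT (@mass R X) (localize v) <=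
    rsum setT (fun x => (\sum_(j < M) M%:R^-1 * G v j x) * mass x).
  apply: ler_rsum_nneg s => x _; apply/andP; split.
    by apply: mulr_ge0; [exact: sqr_ge0|exact/ltW].
  by rewrite ler_pM2r // cmod_localize_le.
apply: le_trans le _.
have E0 : 0 <= E by apply: nsq_ge0; exact: mue_ge0.
rewrite e -mulr_sumr ler_pdivrMl //.
apply: le_trans (_ : \sum_(j < M) P * K ^+ 2 * r ^+ 2 * E <= _); last first.
  by rewrite sumr_const card_ord mulr_natl.
apply: ler_sum => j _; apply: le_trans (poin_B j) _.
rewrite ler_wpM2r // ler_wpM2l //.
rewrite lerXn2r ?nnegrE ?(ltW r_gt0) ?(ltW (rj_gt0 j)) //.
by have := rj_le (leq0n j); rewrite {2}/rj expr0 divr1.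
Qed.

(** The factor [(2 / rj j) ^+ 2] cancels the squared radius in the Poincaré inequality on [B j], so
    each of the M scales contributes a multiple of [M^-2 * E]. *)
Lemma loc_err_L2 : l2s (@edges R X) mue (loc_err v) /\
  nsq (@edges R X) mue (loc_err v) <= 4 * P * K ^+ 2 / M%:R * E.
Proof.
pose k (j : 'I_M) : R := M%:R^-1 ^+ 2 * (2 / rj j) ^+ 2.
have [s e] := sum_G k.
pose g x := \sum_(j < M) k j * G v j x.
have g0 x : 0 <= g x.
  by apply: sumr_ge0 => j _; apply: mulr_ge0; [rewrite mulr_ge0 ?sqr_ge0|exact: G_ge0].
(* The pointwise bound depends on the initial vertex only, so summing [mu] over the neighbors turns
   the edge sum into a sum against [mass]. *)
have gm x : rsum (nbr x) (fun y => g x * mu x y) = g x * mass x.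
  by have [sm ->] := mass_rsum geom x; rewrite rsumZE.
have [|[_ s2] e2] := rsum_edges_from geom setT (F := fun d => g d.1 * mue d).
  by move=> d /adj_mu_gt0/ltW m0; rewrite mulr_ge0.
have Eg : (fun x => rsum (nbr x) (fun y => g (x, y).1 * mue (x, y))) = (fun x => g x * mass x).
  by apply/funext => x; rewrite -gm.
rewrite Eg in e2 s2; rewrite -edges_fromT in e2 s2.
have {}s2 := s2 s.
have pt (d : X * X) : edges d -> 0 <= cmod (loc_err v d) ^+ 2 * mue d <= g d.1 * mue d.
  move=> ad; have m0 : 0 <= mue d := mueT ad.
  apply/andP; split; first by apply: mulr_ge0 => //; exact: sqr_ge0.
  by rewrite ler_wpM2r // cmod_loc_err_le.
split; first by apply: rsummable_le s2 => d /pt /andP[d0]; rewrite ger0_norm.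
apply: le_trans (ler_rsum_nneg pt s2) _; rewrite e2 e.
have E0 : 0 <= E by apply: nsq_ge0; exact: mue_ge0.
apply: le_trans (_ : \sum_(j < M) M%:R^-1 ^+ 2 * (4 * P * K ^+ 2 * E) <= _); last first.
  rewrite sumr_const card_ord -mulr_natl le_eqVlt; apply/orP; left; apply/eqP.
  by field; rewrite gt_eqF.
apply: ler_sum => j _; rewrite /k -[leLHS]mulrA ler_wpM2l ?sqr_ge0 //.
apply: le_trans (ler_wpM2l (sqr_ge0 _) (poin_B j)) _.
rewrite le_eqVlt; apply/orP; left; apply/eqP; field.
by rewrite gt_eqF.
Qed.

Lemma localize_energy : l2s (@edges R X) mue (dfe (localize v)) /\
  energy setT (localize v) <= (2 + 2 * (4 * P * K ^+ 2 / M%:R)) * E.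
Proof.
have [s1 e1] := loc_err_L2.
pose F (d : X * X) : R[i] := (cutoff_avg d.2)%:C%C * dfe v d.
pose F1 (d : X * X) : R[i] := if d \in edges_from (gball o (K * r)) then dfe v d else 0.
have l1 : l2s (@edges R X) mue F1.
  have := l2s_le mueT ler01 (F := F1) _ v_energy; apply => d _; rewrite /F1 mul1r; case: ifP => _;
    rewrite ?cmod0 ?cmod_ge0 //.
have FF1 d : edges d -> cmod (F d) <= 1 * cmod (F1 d).
  move=> ad; rewrite mul1r /F /F1 cmodM cmod_real ger0_norm ?cutoff_avg_ge0 //.
  case: ifPn => [_|nB]; first by rewrite ler_piMl ?cmod_ge0 ?cutoff_avg_le1.
  rewrite (cutoff_avg_supp ad) ?mul0r ?cmod0 // => Bd.
  by move/negP: nB; apply; apply/mem_set.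
have lF : l2s (@edges R X) mue F := l2s_le mueT ler01 FF1 l1.
have nF : nsq (@edges R X) mue F <= E.
  apply: le_trans (nsq_le mueT ler01 FF1 l1) _; rewrite expr1n mul1r.
  rewrite /E /energy /nsq [leRHS](@rsum_mkcond _ _ (@edges R X)); last by move=> d [].
  rewrite le_eqVlt; apply/orP; left; apply/eqP; apply: eq_rsum => d _.
  by rewrite /F1; case: ifP => // _; rewrite cmod0 expr0n mul0r.
have dE d : edges d -> dfe (localize v) d = F d + loc_err v d by exact: dfe_localize.
split.
  have := l2sD mueT lF s1; apply: (l2s_le mueT ler01) => d ad.
  by rewrite dE // mul1r.
rewrite /energy -edges_fromT /nsq (eq_rsum (g := fun d => cmod (F d + loc_err v d) ^+ 2 * mue d)).
  by have := nsqD_le mueT lF s1; rewrite /nsq in e1 nF *; lra.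
by move=> d ad; rewrite dE.
Qed.

End Localization.

(** * Caccioppoli's inequality and decay of the energy *)

Section Decay.
Context {R : realType} (X : wgraph R) (N : nat) (CW Cmu CD CP Cinf delta : R).
Hypothesis geom : bounded_geometry X N CW Cmu.
Hypothesis dbl : doubling X CD.
Hypothesis poin : poincare2 X CP.
Variable c : X -> X -> R[i].
Hypothesis ell : uniformly_elliptic Cinf delta c.
Implicit Types (x y z : X) (u v f g : X -> R[i]).

Let ce (F : X * X -> R[i]) : X * X -> R[i] := fun e => c e.1 e.2 * F e.

Let mueT (e : X * X) : edges e -> 0 <= mue e.
Proof. exact: mue_ge0T. Qed.

Let massT x : [set: X] x -> 0 <= mass x.
Proof. exact: (mass_ge0 geom). Qed.

Lemma ellipticity_constants : 0 < Cinf /\ 0 < delta.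
Proof. by case: ell. Qed.

Let ce_le F e : edges e -> cmod (ce F e) <= Cinf * cmod (F e).
Proof. by move=> ae; rewrite cmodM ler_wpM2r ?cmod_ge0 //; case: ell => _ _ + _; apply. Qed.

Let Cinf_ge0 : 0 <= Cinf. Proof. by case: ellipticity_constants => /ltW. Qed.

Lemma coeff_l2s F : l2s (@edges R X) mue F -> l2s (@edges R X) mue (ce F).
Proof. exact: (l2s_le mueT Cinf_ge0 (ce_le F)). Qed.

Lemma coeff_nsq F : l2s (@edges R X) mue F ->
  nsq (@edges R X) mue (ce F) <= Cinf ^+ 2 * nsq (@edges R X) mue F.
Proof. exact: (nsq_le mueT Cinf_ge0 (ce_le F)). Qed.

Lemma formE u v : Defs.form c u v = pairing (@edges R X) mue (ce (dfe u)) (dfe v).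
Proof. by []. Qed.

Lemma energyT u : energy setT u = nsq (@edges R X) mue (dfe u).
Proof. by rewrite /energy -edges_fromT. Qed.

(** This is the only form in which ellipticity is available: it concerns functions on the whole
    graph, and is later applied to a localized function. *)
Lemma garding u : W12 u -> delta * energy setT u <= complex.Re (Defs.form c u u).
Proof.
case: ell => _ _ _ + Wu => /(_ u Wu); rewrite energyT => le.
apply: le_trans le _; rewrite le_eqVlt; apply/orP; left; apply/eqP.
apply: eq_rsum => e _; rewrite -2!mulrA; congr (complex.Re (_ * _)).
by rewrite mulrA mulcJ realcM.
Qed.

Variables (u g : X -> R[i]).
Hypotheses (Wu : W12 u) (Lg : l2s setT (@mass R X) g).
Hypothesis eqn : forall v, W12 v -> Defs.form c u v = inner g v.

Let P := `|CP| * (N%:R * Cmu).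
Let K := 1 + CW.

(** Linear bookkeeping for [one_step], isolated so that the norms and energies enter as plain
    variables. *)
Let half_sum_le (a b k l C A D E : R) :
  a * k <= a * (C * (A * E)) -> b * l <= b * (D * E) ->
  2^-1 * (a * k) + 2^-1 * (b * l)
  <= 2^-1 * (a * (C * A) * E) + 2^-1 * (b * D * E).
Proof. lra. Qed.

Let half_sum_le' (a b k l C A D E : R) :
  b * k <= b * (C * E) -> a * l <= a * (A * (D * E)) ->
  2^-1 * (b * k) + 2^-1 * (a * l)
  <= 2^-1 * (b * C * E) + 2^-1 * (a * (A * D) * E).
Proof. lra. Qed.

Let collect_le (f x y G T1 T2 T3 T4 T5 E : R) :
  f <= G + 2^-1 * (T5 * E) -> x <= 2^-1 * (T1 * E) + 2^-1 * (T2 * E) ->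
  - y <= 2^-1 * (T3 * E) + 2^-1 * (T4 * E) ->
  f + x - y <= 2^-1 * (T1 + T2 + T3 + T4 + T5) * E + G.
Proof. lra. Qed.

(* Caccioppoli's inequality, tested with the twice localized solution w' =
   localize w, w = localize u: up to the two commutator errors [loc_err], which
   carry the factor 1/M, form u w' is the coercive quantity form w w. *)
Lemma one_step o r M (s sigma : R) : 0 < r -> (0 < M)%N ->
  hv o <= CW * (r / 2 ^+ M / K) -> 0 < s -> 0 < sigma ->
  delta * energy (gball o (r / 2 ^+ M / K)) u <=
  2^-1 * (s * (Cinf ^+ 2 * (4 * P * K ^+ 2 / M%:R))
    + s^-1 * (2 + 2 * (4 * P * K ^+ 2))
    + s^-1 * Cinf ^+ 2
    + s * (4 * P * K ^+ 2 / M%:R * (2 + 2 * (4 * P * K ^+ 2)))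
    + sigma^-1 * (P * K ^+ 2 * (2 + 2 * (4 * P * K ^+ 2))))
    * energy (gball o (K * r)) u
  + 2^-1 * (sigma * r ^+ 2 * nsq setT (@mass R X) g).
Proof.
move=> r0 M0 hvK s0 sigma0.
have CW0 := CW_gt0 geom; have K1 : 1 <= K by rewrite /K; lra.
have K0 : 0 < K by rewrite /K; lra.
have rM0 : 0 < r / 2 ^+ M by rewrite divr_gt0 ?exprn_gt0.
have hvo : hv o <= CW * (r / 2 ^+ M).
  by apply: le_trans hvK _; rewrite ler_pM2l // ler_pdivrMr // ler_pMr.
have [Lu Eu] : l2s setT (@mass R X) u /\ l2s (@edges R X) mue (dfe u).
  exact/(W12_l2 geom).
set E := energy (gball o (K * r)) u.
set A := 4 * P * K ^+ 2.
have P0 : 0 <= P by rewrite mulr_ge0 // (le_trans ler01) // (NCmu_ge1 geom o).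
have A0 : 0 <= A by apply: mulr_ge0; [rewrite mulr_ge0|exact: sqr_ge0].
have MR : 0 < M%:R :> R by rewrite ltr0n.
have AM : A / M%:R <= A by rewrite ler_pdivrMr // ler_peMr // ler1n.
have AM0 : 0 <= A / M%:R by rewrite divr_ge0 // ltW.
have E0 : 0 <= E by apply: nsq_ge0; exact: mue_ge0.
have [l1 n1] := loc_err_L2 geom dbl poin r0 M0 hvo Lu Eu.
have [lw nw] := localize_L2 geom dbl poin o r0 M0 Lu Eu.
have [ldw ndw] := localize_energy geom dbl poin r0 M0 hvo Lu Eu.
set w := localize CW o r M u in lw nw ldw ndw.
rewrite -/P -/K -/A -/E in n1 ndw nw.
have [l2 n2] := loc_err_L2 geom dbl poin r0 M0 hvo lw ldw.
have [lw' nw'] := localize_L2 geom dbl poin o r0 M0 lw ldw.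
have [ldw' _] := localize_energy geom dbl poin r0 M0 hvo lw ldw.
set w' := localize CW o r M w in lw' nw' ldw'.
rewrite -/P -/K -/A in n2 nw'.
set e1 := loc_err CW o r M u in l1 n1.
set e2 := loc_err CW o r M w in l2 n2.
have Ww : W12 w by apply/(W12_l2 geom).
have Ww' : W12 w' by apply/(W12_l2 geom).
set D := 2 + 2 * A.
have D0 : 0 <= D by rewrite /D; lra.
have nD : energy setT w <= D * E by apply: le_trans ndw _; rewrite ler_wpM2r // /D; lra.
have nB : energy (gball o (K * r)) w <= D * E.
  by apply: le_trans nD; exact: energy_mono.
have {}n2 : nsq (@edges R X) mue e2 <= A / M%:R * (D * E).
  by apply: le_trans n2 _; rewrite ler_wpM2l.
have {}nw' : nsq setT (@mass R X) w' <= P * K ^+ 2 * r ^+ 2 * (D * E).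
  apply: le_trans nw' _; rewrite ler_wpM2l //.
  by apply: mulr_ge0; [apply: mulr_ge0 => //|]; exact: sqr_ge0.
pose om : X -> R := cutoff_avg o r M.
have dw e : edges e -> dfe w e = (om e.2)%:C%C * dfe u e + e1 e.
  by exact: dfe_localize.
have dw' e : edges e -> dfe w' e = (om e.2)%:C%C * dfe w e + e2 e.
  by exact: dfe_localize.
have omle (F : X * X -> R[i]) : l2s (@edges R X) mue F ->
    l2s (@edges R X) mue (fun e => (om e.2)%:C%C * F e).
  apply: (l2s_le mueT ler01) => e _; rewrite cmodM cmod_real ger0_norm; last first.
    exact: cutoff_avg_ge0.
  by rewrite ler_wpM2r ?cmod_ge0 // cutoff_avg_le1.
(* The averaged cutoff is real, so it moves from [dw] to [du], and there [om du = dw - e1]. The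
   first localization produces [e1], the second one [e2]. *)
have id1 : Defs.form c w w = Defs.form c u w'
    + pairing (@edges R X) mue (ce e1) (dfe w)
    - pairing (@edges R X) mue (ce (dfe u)) e2.
  rewrite !formE.
  rewrite (@eq_pairing _ _ _ _ (ce (dfe u)) (ce (dfe u)) (dfe w') _ (fun _ _ => erefl) dw').
  rewrite (pairingDr mueT (omle _ ldw) l2 (coeff_l2s Eu)) addrAC addrK.
  rewrite (_ : pairing _ _ (ce (dfe u)) (fun t => (om t.2)%:C%C * dfe w t) =
    pairing (@edges R X) mue (fun e => ce (dfe w) e - ce e1 e) (dfe w)).
    by rewrite (pairingBl mueT) ?subrK //; exact: coeff_l2s.
  apply: eq_csum => e ae.
  have -> : ce (dfe w) e - ce e1 e = c e.1 e.2 * ((om e.2)%:C%C * dfe u e).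
    by rewrite /ce dw // -mulrBr addrK.
  by rewrite conjcM conjc_real /ce; ring.
(* [e2] vanishes on edges starting outside the ball, so [du] may be truncated there; Young's
   inequality then charges the local energy [E] and not that of the whole graph. *)
pose u1 (e : X * X) : R[i] := if e \in edges_from (gball o (K * r)) then dfe u e else 0.
have lu1 : l2s (@edges R X) mue u1.
  have := l2s_le mueT ler01 (F := u1) _ Eu; apply => d _; rewrite /u1 mul1r.
  by case: ifP => _; rewrite ?cmod0 ?cmod_ge0.
have nu1 : nsq (@edges R X) mue u1 = E.
  rewrite /E /energy /nsq [RHS](@rsum_mkcond _ _ (@edges R X)); last by move=> d [].
  apply: eq_rsum => d _; rewrite /u1; case: ifP => // _.
  by rewrite cmod0 expr0n mul0r.
have id2 : pairing (@edges R X) mue (ce (dfe u)) e2 = pairing (@edges R X) mue (ce u1) e2.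
  apply: eq_csum => e ae; rewrite /ce /u1; case: ifPn => // nBe.
  rewrite /e2 (loc_err_supp geom r0 hvo) //; first by rewrite conjc0 !mulr0 !mul0r.
  by move=> Be; move/negP: nBe; apply; apply/mem_set.
have b1 : complex.Re (Defs.form c u w') <=
   2^-1 * (sigma * r ^+ 2 * nsq setT (@mass R X) g)
   + 2^-1 * (sigma^-1 * (P * K ^+ 2 * D) * E).
  rewrite eqn //; apply: le_trans (ler_norm _) _; apply: le_trans (normr_Re_le _) _.
  (* The weight [sigma * r ^+ 2] compensates the [r ^+ 2] in the L^2 bound for [w']. *)
  have sr : 0 < sigma * r ^+ 2 by rewrite mulr_gt0 ?exprn_gt0.
  apply: le_trans (pairing_young massT sr Lg lw') _; rewrite lerD2l ler_pM2l //.
  rewrite invfM -[_ / _ * _]mulrA -[leRHS]mulrA ler_pM2l ?invr_gt0 //.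
  rewrite ler_pdivrMl ?exprn_gt0 //; apply: le_trans nw' _.
  by rewrite le_eqVlt; apply/orP; left; apply/eqP; ring.
have si : 0 < s^-1 by rewrite invr_gt0.
have b2 : complex.Re (pairing (@edges R X) mue (ce e1) (dfe w)) <=
   2^-1 * (s * (Cinf ^+ 2 * (A / M%:R)) * E) + 2^-1 * (s^-1 * D * E).
  apply: le_trans (ler_norm _) _; apply: le_trans (normr_Re_le _) _.
  apply: le_trans (pairing_young mueT s0 (coeff_l2s l1) ldw) _.
  have t1 := ler_wpM2l (ltW s0) (le_trans (coeff_nsq l1) (ler_wpM2l (sqr_ge0 _) n1)).
  have t2 := ler_wpM2l (ltW si) nD; rewrite energyT in t2.
  exact: half_sum_le t1 t2.
have b3 : - complex.Re (pairing (@edges R X) mue (ce u1) e2) <=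
   2^-1 * (s^-1 * Cinf ^+ 2 * E) + 2^-1 * (s * (A / M%:R * D) * E).
  rewrite -Re_oppc.
  apply: le_trans (ler_norm _) _; apply: le_trans (normr_Re_le _) _; rewrite cmodN.
  apply: le_trans (pairing_young mueT si (coeff_l2s lu1) l2) _.
  have t1 := ler_wpM2l (ltW si) (coeff_nsq lu1); rewrite nu1 in t1.
  have t2 := ler_wpM2l (ltW s0) n2.
  by rewrite invrK; exact: half_sum_le' t1 t2.
(* The extra division by [K] puts both endpoints of these edges in the core ball, where
   [dw = du]. *)
have low : energy (gball o (r / 2 ^+ M / K)) u <= energy setT w.
  have := @energy_mono R X (gball o (r / 2 ^+ M / K)) setT w (fun _ _ => I) ldw.
  apply: le_trans; rewrite /energy (@eq_nsq _ _ _ _ _ (dfe w)) //.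
  move=> e [ae xe]; symmetry; apply: dfe_localize_in => //.
    apply: lt_le_trans xe _.
    by rewrite ler_pdivrMr // ler_pMr.
  have := dist_nbr geom hvK xe ae.
  by rewrite -/K mulrC divfK // gt_eqF.
have gd := garding Ww.
have d0 : 0 < delta by case: ellipticity_constants.
apply: le_trans (ler_wpM2l (ltW d0) low) _; apply: le_trans gd _.
rewrite id1 id2 !Re_addc Re_oppc.
exact: collect_le b1 b2 b3.
Qed.

End Decay.

Lemma exp2_ge {R : realType} (x : R) : exists n : nat, x <= 2 ^+ n.
Proof.
exists (Num.trunc `|x|).+1; apply: le_trans (ler_norm x) _; apply: ltW.
apply: lt_le_trans (truncnS_gt _) _.
by rewrite -natrX ler_nat; exact/ltnW/ltn_expl.
Qed.

(* In [one_step], s and sigma are taken large to absorb the terms without a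
   factor 1/M, and then M is taken large depending on s. *)
Lemma energy_decay (R : realType) (N : nat) (CW Cmu CP Cinf delta : R) :
  0 < Cinf -> 0 < delta -> 1 <= CW -> 0 <= N%:R * Cmu ->
  exists (q : nat) (C0 : R), [/\ (0 < q)%N, 0 < C0 &
  forall (X : wgraph R) (CD : R), bounded_geometry X N CW Cmu ->
    doubling X CD -> poincare2 X CP ->
  forall (c : X -> X -> R[i]), uniformly_elliptic Cinf delta c ->
  forall (u g : X -> R[i]), W12 u -> l2s setT (@mass R X) g ->
    (forall v, W12 v -> Defs.form c u v = inner g v) ->
  forall (o : X) (rho : R), 0 < rho -> hv o <= CW * (rho / 2 ^+ q) ->
    energy (gball o (rho / 2 ^+ q)) u <=
    2^-1 * energy (gball o rho) u + C0 * rho ^+ 2 * nsq setT (@mass R X) g].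
Proof.
move=> Ci0 d0 CW1 NC0.
set P := `|CP| * (N%:R * Cmu); set K := 1 + CW.
have P0 : 0 <= P by rewrite mulr_ge0.
have K1 : 1 <= K by rewrite /K; lra.
have K0 : 0 < K by rewrite /K; lra.
set A := 4 * P * K ^+ 2; set D := 2 + 2 * A.
have A0 : 0 <= A by apply: mulr_ge0; [rewrite mulr_ge0|exact: sqr_ge0].
have D0 : 0 < D by rewrite /D; lra.
have C20 : 0 < Cinf ^+ 2 by rewrite exprn_gt0.
(* The budget is [delta] before the outer factor 1/2: this [s] makes the two terms with [s^-1] equal
   to [delta / 4] in total, [sigma] keeps its own term below [delta / 4], and M brings the two terms
   with [s] below [delta / 2]. The [+ 1] in [sigma] keeps it positive when [P = 0]. *)
pose s := 4 * (D + Cinf ^+ 2) / delta.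
have s0 : 0 < s by rewrite divr_gt0 // mulr_gt0 // addr_gt0.
pose sigma := 4 * (P * K ^+ 2 * D + 1) / delta.
have PKD : 0 <= P * K ^+ 2 * D.
  by apply: mulr_ge0; [apply: mulr_ge0 => //; exact: sqr_ge0|exact: ltW].
have sg0 : 0 < sigma by rewrite divr_gt0 // mulr_gt0 //; lra.
have [M0 HM0] := exp2_ge (2 * (s * (A * (Cinf ^+ 2 + D))) / delta).
pose M := (2 ^ M0)%N.
have Mpos : (0 < M)%N by rewrite expn_gt0.
(* The step leads from radius [K * r] to [r / 2 ^+ M / K]; the two factors [K] are absorbed into [k]
   further dyadic scales, whence [q = M + k]. *)
have [k Hk] := exp2_ge (K ^+ 2).
have MR : 0 < M%:R :> R by rewrite ltr0n.
have HM : s * (A * (Cinf ^+ 2 + D)) / M%:R <= delta / 2.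
  move: HM0; rewrite -natrX -/M; move: (s * _) => T.
  by rewrite !ler_pdivrMr // => ?; lra.
exists (M + k)%N, (sigma / (2 * delta)); split.
- by rewrite addn_gt0 Mpos.
- by rewrite divr_gt0 // mulr_gt0.
move=> X CD geom dbl poin c ell u g Wu Lg eqn o rho rho0 hvo.
pose r := rho / K.
have r0 : 0 < r by rewrite divr_gt0.
have Kr : K * r = rho by rewrite /r mulrC divfK // gt_eqF.
have p2 n : 0 < 2 ^+ n :> R by rewrite exprn_gt0.
have small : rho / 2 ^+ (M + k) <= r / 2 ^+ M / K.
  have -> : r / 2 ^+ M / K = rho * ((K ^+ 2)^-1 / 2 ^+ M).
    by rewrite /r; field; rewrite !gt_eqF.
  rewrite exprD invfM ler_pM2l // mulrC ler_pM2r ?invr_gt0 //.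
  by rewrite lef_pV2 ?posrE // exprn_gt0.
have hvK : hv o <= CW * (r / 2 ^+ M / K).
  by apply: le_trans hvo _; rewrite ler_pM2l // (lt_le_trans ltr01).
have := one_step geom dbl poin ell Wu Lg eqn r0 Mpos hvK s0 sg0.
rewrite -/P -/K -/A -/D Kr.
set E := energy (gball o rho) u; set Ei := energy (gball o (r / _ / _)) u.
set G := nsq setT _ g => step.
have E0 : 0 <= E by apply: nsq_ge0; exact: mue_ge0.
have G0 : 0 <= G by apply: nsq_ge0; exact: (mass_ge0 geom).
have mono : energy (gball o (rho / 2 ^+ (M + k))) u <= Ei.
  apply: energy_mono; first exact: gball_sub.
  by case/(W12_l2 geom): Wu.
apply: le_trans mono _.
have c1 : s^-1 * D + s^-1 * Cinf ^+ 2 = delta / 4.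
  by rewrite -mulrDr /s; field; rewrite !gt_eqF // addr_gt0.
have c2 : sigma^-1 * (P * K ^+ 2 * D) <= delta / 4.
  rewrite ler_pdivrMl // /sigma.
  have -> : 4 * (P * K ^+ 2 * D + 1) / delta * (delta / 4) = P * K ^+ 2 * D + 1.
    by field; rewrite gt_eqF.
  lra.
have c3 : s * (Cinf ^+ 2 * (A / M%:R)) + s * (A / M%:R * D) = s * (A * (Cinf ^+ 2 + D)) / M%:R.
  by field; rewrite gt_eqF.
rewrite -(ler_pM2l d0); apply: le_trans step _.
have r2 : r ^+ 2 <= rho ^+ 2.
  have rr : r <= rho by rewrite /r ler_pdivrMr // ler_pMr.
  by rewrite lerXn2r ?nnegrE ?(ltW r0) ?(ltW rho0).
have h1 : sigma * r ^+ 2 * G <= sigma * rho ^+ 2 * G.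
  by rewrite ler_wpM2r // ler_pM2l.
have -> : delta * (2^-1 * E + sigma / (2 * delta) * rho ^+ 2 * G) =
   (delta / 2) * E + 2^-1 * (sigma * rho ^+ 2 * G).
  by field; rewrite gt_eqF.
apply: lerD; last by rewrite ler_pM2l.
by rewrite ler_wpM2r //; lra.
Qed.

(** * Pointwise bounds from the decay of the energy *)

Section Morrey.
Context {R : realType} (X : wgraph R) (N : nat) (CW Cmu CD CP cL : R).
Hypothesis geom : bounded_geometry X N CW Cmu.
Hypothesis dbl : doubling X CD.
Hypothesis poin : poincare2 X CP.
Hypothesis lowv : lower_volume2 X cL.
Implicit Types (x y z o : X).

Variables (q : nat) (C0 G : R) (u : X -> R[i]).
Hypotheses (q_gt0 : (0 < q)%N) (C0_gt0 : 0 < C0) (G_ge0 : 0 <= G) (Wu : W12 u).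
Hypothesis decay : forall o rho, 0 < rho -> hv o <= CW * (rho / 2 ^+ q) ->
  energy (gball o (rho / 2 ^+ q)) u <=
  2^-1 * energy (gball o rho) u + C0 * rho ^+ 2 * G.

Let collect3 (k t a b c f1 f2 V T : R) :
  a <= 16 * k * f1 -> b <= 16 * k * f2 -> c <= 4 * k * f1 ->
  k * f1 <= k * (2 * t * T) -> k * f2 <= k * (2 * t * T) -> 0 <= t * V ->
  3 * (a + c + b) <= t * (216 * k * T + 8 * V).
Proof. lra. Qed.

Let P := `|CP| * (N%:R * Cmu).
Let Q := P * 4 ^+ q / cL.
(** The added source term makes the decay purely geometric: as [(2 ^+ q) ^+ 2 >= 4], after one step
    it is at most [C0 * rho ^+ 2 * G], which with the equal error in [decay] makes exactly half of
    [4 * C0 * rho ^+ 2 * G]. *)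
Let F o rho := energy (gball o rho) u + 4 * C0 * rho ^+ 2 * G.
Let S r := energy setT u + 4 * C0 * r ^+ 2 * G.
Let U := nsq setT (@mass R X) u.

Let Lu : l2s setT (@mass R X) u. Proof. by case/(W12_l2 geom): Wu. Qed.
Let Eu : l2s (@edges R X) mue (dfe u). Proof. by case/(W12_l2 geom): Wu. Qed.
Let cL_gt0 : 0 < cL. Proof. by case: lowv. Qed.
Let CW0 : 0 < CW. Proof. exact: CW_gt0 geom. Qed.
Let P_ge0 o : 0 <= P.
Proof. by rewrite mulr_ge0 // (le_trans ler01) // (NCmu_ge1 geom o). Qed.
Let Q_ge0 o : 0 <= Q.
Proof. by rewrite divr_ge0 ?(ltW cL_gt0) // mulr_ge0 ?exprn_ge0 // (P_ge0 o). Qed.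
Let p2 n : 0 < 2 ^+ n :> R. Proof. by rewrite exprn_gt0. Qed.
Let energy_ge0 A : 0 <= energy A u.
Proof. by apply: nsq_ge0; exact: mue_ge0. Qed.
Let tail_ge0 r : 0 <= 4 * C0 * r ^+ 2 * G.
Proof. by apply: mulr_ge0 => //; apply: mulr_ge0; [apply: mulr_ge0 => //; exact: ltW|exact: sqr_ge0]. Qed.
Let F_ge0 o rho : 0 <= F o rho. Proof. exact: addr_ge0. Qed.

Let F_le o r s : 0 <= r -> r <= s -> F o r <= F o s.
Proof.
move=> r0 rs; apply: lerD; first by apply: energy_mono => //; exact: gball_sub.
rewrite ler_wpM2r // ler_pM2l ?mulr_gt0 // lerXn2r ?nnegrE //.
exact: le_trans r0 rs.
Qed.

Let F_le_S o r : F o r <= S r.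
Proof. by rewrite lerD2r energy_mono. Qed.

Let F_step o rho : 0 < rho -> hv o <= CW * (rho / 2 ^+ q) ->
  F o (rho / 2 ^+ q) <= 2^-1 * F o rho.
Proof.
move=> r0 hr; have := decay r0 hr; rewrite /F.
have : 4 * C0 * (rho / 2 ^+ q) ^+ 2 * G <= C0 * rho ^+ 2 * G.
  rewrite ler_wpM2r // expr_div_n.
  have h : 4 <= (2 ^+ q) ^+ 2 :> R.
    have -> : 4 = 2 ^+ 2 :> R by rewrite -natrX.
    rewrite lerXn2r ?nnegrE ?(ltW (p2 q)) //.
    by rewrite -[X in X <= _]expr1 ler_eXn2l // ltr1n.
  have r2 : 0 <= C0 * rho ^+ 2 by rewrite mulr_ge0 ?sqr_ge0 // ltW.
  rewrite mulrA ler_pdivrMr ?exprn_gt0 // -mulrA.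
  by have := ler_wpM2l r2 h; lra.
by move: (4 * C0 * (rho / _) ^+ 2 * G) => a; lra.
Qed.

Let mean_close o z r s : 0 < r -> 0 < s -> gball z s `<=` gball o r ->
  cmod (mean (gball z s) u - mean (gball o r) u) ^+ 2
  <= P * r ^+ 2 / (cL * s ^+ 2) * F o r.
Proof.
move=> r0 s0 sub.
have cs : 0 < cL * s ^+ 2 by rewrite mulr_gt0 ?exprn_gt0.
have lv := volume_lower geom z dbl lowv s0.
have V0 := lt_le_trans cs lv.
have luB : l2s (gball o r) (@mass R X) u by exact: rsummable_sub Lu.
have := mean_sub_le geom (mean (gball o r) u) (finite_volume geom o r dbl) sub V0 luB.
move=> /le_trans /(_ (poincare_energy geom o dbl poin r0 Lu Eu)).
rewrite -/P => h.
have h2 := ler_wpM2r (sqr_ge0 (cmod (mean (gball z s) u - mean (gball o r) u))) lv.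
have h3 : P * r ^+ 2 * energy (gball o r) u <= P * r ^+ 2 * F o r.
  rewrite ler_wpM2l ?lerDl //.
  by apply: mulr_ge0; [exact: P_ge0 o|exact: sqr_ge0].
rewrite mulrAC ler_pdivlMr // mulrC.
exact: le_trans h2 (le_trans h h3).
Qed.

Let mean_step o rho : 0 < rho ->
  cmod (mean (gball o (rho / 2 ^+ q)) u - mean (gball o rho) u) ^+ 2 <= Q * F o rho.
Proof.
move=> r0; have s0 : 0 < rho / 2 ^+ q by rewrite divr_gt0.
apply: le_trans (@mean_close o o rho (rho / 2 ^+ q) r0 s0 _) _.
  apply: gball_sub; rewrite ler_pdivrMr // ler_peMr ?(ltW r0) //.
  by rewrite exprn_ege1 // ler1n.
rewrite le_eqVlt; apply/orP; left; apply/eqP; congr (_ * _).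
rewrite /Q (_ : 4 = 2 * 2 :> R); last by rewrite -natrM.
rewrite [in RHS]exprMn; move: (2 ^+ q) (p2 q) => a a0.
by field; rewrite !gt_eqF.
Qed.

(* The means are telescoped over the radii rho / 2^(q n), down to the scale at
   which the ball is {o}. The power r^2 gained from Poincare cancels against the
   lower volume bound, so only the decay of the energy is needed. *)
Lemma value_mean o rho : 0 < rho ->
  cmod (u o - mean (gball o rho) u) ^+ 2 <= 16 * Q * F o rho.
Proof.
have small r : 0 < r -> CW * r < hv o -> mean (gball o r) u = u o.
  by move=> r0 rh; rewrite (gball_small geom) // (mean_set1 geom).
(* The induction runs on the number of steps to the singleton scale, where the mean is [u o]
   itself. *)
have [n Hn] : exists n : nat, CW * (rho / 2 ^+ (q * n)) < hv o.
  have hp := hv_gt0 geom o.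
  have [n Hn] := exp2_ge (CW * `|rho| / hv o + 1).
  exists n; rewrite mulrA ltr_pdivrMr // [ltRHS]mulrC -ltr_pdivrMr //.
  apply: le_lt_trans (_ : CW * `|rho| / hv o < _).
    by rewrite ler_pM2r ?invr_gt0 // ler_pM2l // ler_norm.
  apply: lt_le_trans (_ : 2 ^+ n <= _); first by apply: lt_le_trans Hn; rewrite ltrDl.
  by rewrite ler_eXn2l ?ltr1n // leq_pmull.
elim: n rho Hn => [|n IH] rho Hn r0.
  rewrite small // ?subrr ?cmod0 ?expr0n /=.
    by rewrite mulr_ge0 // mulr_ge0 // (Q_ge0 o).
  by rewrite muln0 expr0 divr1 in Hn.
have Q0 := Q_ge0 o; have F0 := F_ge0 o rho.
have QF : 0 <= Q * F o rho by rewrite mulr_ge0.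
have s0 : 0 < rho / 2 ^+ q by rewrite divr_gt0.
have step := mean_step o r0.
(* If the next ball is already a singleton, [mean_step] compares with [u o] directly; otherwise the
   scale condition of [F_step] holds. *)
have [hl|hl] := lerP (hv o) (CW * (rho / 2 ^+ q)); last first.
  by move: step; rewrite (small _ s0) //; lra.
have hs := F_step r0 hl.
have {}IH : cmod (u o - mean (gball o (rho / 2 ^+ q)) u) ^+ 2
    <= 16 * Q * F o (rho / 2 ^+ q).
  apply: IH => //; rewrite -mulrA -invfM -exprD.
  by rewrite mulnS in Hn.
have IH' : cmod (u o - mean (gball o (rho / 2 ^+ q)) u) ^+ 2 <= 8 * (Q * F o rho).
  by apply: le_trans IH _; have := ler_wpM2l Q0 hs; lra.
have := cmodD (u o - mean (gball o (rho / 2 ^+ q)) u)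
  (mean (gball o (rho / 2 ^+ q)) u - mean (gball o rho) u).
rewrite addrA subrK.
move: (cmod _) (cmod _) (cmod _) (cmod_ge0 (u o - mean (gball o rho) u)) IH' step
  => a b c a0 IH' step abc.
have : c ^+ 2 <= (b + a) ^+ 2 by rewrite lerXn2r ?nnegrE // (le_trans a0).
(* The constant 16 closes the induction: halving [F] turns it into 8, and the weights 3/2 and 3 on
   the two squares give 12 + 3 = 15. *)
have := sqr_ge0 (b / 2 - a).
by rewrite -mulrA; move: (Q * F o rho) QF IH' step => V *; lra.
Qed.

(** The value is split into its deviation from the mean at scale [r] and that mean, which the L^2
    norm and the lower volume bound control. *)
Lemma sup_bound o r : 0 < r ->
  cmod (u o) ^+ 2 <= 32 * Q * S r + 2 * (U / (cL * r ^+ 2)).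
Proof.
move=> r0; have h1 := value_mean o r0.
have cs : 0 < cL * r ^+ 2 by rewrite mulr_gt0 ?exprn_gt0.
have lv := volume_lower geom o dbl lowv r0.
have V0 := lt_le_trans cs lv.
have luB : l2s (gball o r) (@mass R X) u by exact: rsummable_sub Lu.
have := mean_sub_le geom 0 (finite_volume geom o r dbl) (@subset_refl _ _) V0 luB.
rewrite subr0 => h2.
have h3 : nsq (gball o r) (@mass R X) (fun y => u y - 0) <= U.
  rewrite (@eq_nsq _ _ _ _ _ u); last by move=> t _; rewrite subr0.
  by apply: rsum_sub => // x xT; exact: (sqp_ge0 (mass_ge0 geom (A := setT)) u).
have h4 : cmod (mean (gball o r) u) ^+ 2 <= U / (cL * r ^+ 2).
  rewrite ler_pdivlMr // mulrC; apply: le_trans (le_trans h2 h3).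
  by rewrite ler_wpM2r ?sqr_ge0.
have := sqr_cmodD (u o - mean (gball o r) u) (mean (gball o r) u).
rewrite subrK => h5; have := ler_wpM2l (Q_ge0 o) (F_le_S o r); lra.
Qed.

Let dist_hv x y : y <> x -> hv x <= CW * dist x y /\ hv y <= CW * dist x y.
Proof.
move=> yx; split; apply/ler_addgt0Pr => e e0.
  have d : dist x y < dist x y + e / CW by rewrite ltrDl divr_gt0.
  by have := hv_le_dist_l geom yx d; rewrite mulrDr [CW * (_ / _)]mulrC divfK ?gt_eqF.
have d : dist x y < dist x y + e / CW by rewrite ltrDl divr_gt0.
by have := hv_le_dist_r geom yx d; rewrite mulrDr [CW * (_ / _)]mulrC divfK ?gt_eqF.
Qed.

(** With [n] the number of full steps from [r] that stay at or above [rho], all radii met satisfy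
    the scale condition because [rho] does. The factor 2 pays for the incomplete last step, and
    [2 ^- (n + 1)] is at most the power [1 / q] of [rho / r]. *)
Let F_decay o rho r : 0 < rho -> rho <= r -> hv o <= CW * rho ->
  F o rho <= 2 * (rho / r) `^ (q%:R^-1) * S r.
Proof.
move=> rho0 rr hrho; have r0 := lt_le_trans rho0 rr.
have ex : exists n, r / 2 ^+ (q * n.+1) < rho.
  have [n Hn] := exp2_ge (r / rho + 1).
  exists n; rewrite ltr_pdivrMr // mulrC -ltr_pdivrMr //.
  apply: lt_le_trans (_ : 2 ^+ n <= _); first by apply: lt_le_trans Hn; rewrite ltrDl.
  by rewrite ler_eXn2l ?ltr1n // (leq_trans (leqnSn n)) // leq_pmull.
pose n := ex_minn ex.
have [Hn Hlow] : r / 2 ^+ (q * n.+1) < rho /\ rho <= r / 2 ^+ (q * n).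
  rewrite /n; case: ex_minnP => m Hm mmin; split => //.
  case: m Hm mmin => [|m] Hm mmin; first by rewrite muln0 expr0 divr1.
  by rewrite leNgt; apply/negP => /mmin; rewrite ltnn.
have it k : (k <= n)%N -> F o (r / 2 ^+ (q * k)) <= 2^-1 ^+ k * S r.
  elim: k => [_|k IH kn]; first by rewrite muln0 !expr0 divr1 mul1r F_le_S.
  have rk0 : 0 < r / 2 ^+ (q * k) by rewrite divr_gt0.
  have E : r / 2 ^+ (q * k.+1) = r / 2 ^+ (q * k) / 2 ^+ q.
    by rewrite mulnS addnC exprD invfM mulrA.
  rewrite E; apply: le_trans (F_step rk0 _) _.
    rewrite -E; apply: le_trans hrho _; rewrite ler_pM2l //; apply: le_trans Hlow _.
    by rewrite ler_pM2l // lef_pV2 ?posrE // ler_eXn2l ?ltr1n // leq_mul2l kn orbT.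
  by rewrite exprS -mulrA ler_pM2l ?invr_gt0 // IH // ltnW.
apply: le_trans (F_le o (ltW rho0) Hlow) _; apply: le_trans (it n (leqnn n)) _.
have S0 : 0 <= S r := le_trans (F_ge0 o r) (F_le_S o r).
rewrite ler_wpM2r // -ler_pdivrMl // -exprS.
set t := (rho / r) `^ _.
have t0 : 0 <= t := powR_ge0 _ _.
have tq : t ^+ q = rho / r.
  rewrite -powR_mulrn // -powRrM mulVf ?powRr1 //.
    by rewrite divr_ge0 // ltW.
  by rewrite pnatr_eq0 -lt0n.
rewrite leNgt; apply/negP => lt.
have : t ^+ q < (2^-1 ^+ n.+1) ^+ q by rewrite ltrXn2r ?nnegrE // ?exprn_ge0 // -lt0n.
rewrite tq -exprM mulnC exprVn ltr_pdivrMr // mulrC => h.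
by have := lt_trans Hn h; rewrite ltxx.
Qed.

(** Morrey's comparison: the value at [x], the mean on the ball of radius [2 * dist x y] around [x],
    the mean on the ball of radius [dist x y] around [y] contained in it, the value at [y]. Distinct
    points are at distance at least [hv / CW] for either endpoint, so the scale condition holds
    automatically. *)
Lemma holder_bound x y r : 0 < r -> y <> x ->
  cmod (u x - u y) ^+ 2 <=
  (2 * dist x y / r) `^ (q%:R^-1) * (216 * Q * S r + 8 * (U / (cL * r ^+ 2))).
Proof.
move=> r0 yx; have [hx hy] := dist_hv yx.
have d0 : 0 < dist x y by exact: (dist_gt0 geom (nesym yx)).
set rho := 2 * dist x y; set t := _ `^ _.
have rho0 : 0 < rho by rewrite mulr_gt0.
have Q0 := Q_ge0 x.
have U0 : 0 <= U by apply: nsq_ge0; exact: (mass_ge0 geom (A := setT)).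
have S0 : 0 <= S r := le_trans (F_ge0 x r) (F_le_S x r).
have cs : 0 < cL * r ^+ 2 by rewrite mulr_gt0 ?exprn_gt0.
have UV : 0 <= U / (cL * r ^+ 2) by rewrite divr_ge0 // ltW.
have t0 : 0 <= t := powR_ge0 _ _.
have QS : 0 <= Q * S r by rewrite mulr_ge0.
(* For points farther apart than the scale [r], the power is at least 1 and the sup bound at both
   points suffices; this case dictates the coefficient 8. *)
have [big|small] := ltP r rho.
  have t1 : 1 <= t.
    have E : 1 `^ q%:R^-1 = 1 :> R by rewrite powR1.
    rewrite /t -[leLHS]E ge0_ler_powR ?nnegrE ?invr_ge0 //.
      by rewrite divr_ge0 // ltW.
    by rewrite ler_pdivlMr // mul1r ltW.
  have bx := sup_bound x r0; have by_ := sup_bound y r0.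
  have := sqr_cmodB (u x) (u y).
  have : 1 * (216 * Q * S r + 8 * (U / (cL * r ^+ 2))) <=
    t * (216 * Q * S r + 8 * (U / (cL * r ^+ 2))).
    by rewrite ler_wpM2r //; lra.
  lra.
have hx2 : hv x <= CW * rho.
  by apply: le_trans hx _; rewrite ler_pM2l // /rho; lra.
have hy2 : hv y <= CW * rho.
  by apply: le_trans hy _; rewrite ler_pM2l // /rho; lra.
have fx := F_decay rho0 small hx2; have fy := F_decay rho0 small hy2.
rewrite -/t in fx fy.
have sub : gball y (dist x y) `<=` gball x rho.
  move=> z; rewrite /gball /= => yz; apply: le_lt_trans (dist_triangle x y z) _.
  by rewrite /rho; lra.
have e1 := value_mean x rho0.
have e2 := value_mean y d0.
have e2' : F y (dist x y) <= F y rho by apply: F_le; rewrite ?ltW // /rho; lra.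
have e3 := mean_close rho0 d0 sub.
have e3' : P * rho ^+ 2 / (cL * dist x y ^+ 2) <= 4 * Q.
  have -> : P * rho ^+ 2 / (cL * dist x y ^+ 2) = 4 * (P / cL).
    by rewrite /rho; field; rewrite !gt_eqF.
  rewrite ler_pM2l // /Q ler_pM2r ?invr_gt0 // ler_peMr ?(P_ge0 x) //.
  by rewrite exprn_ege1 // ler1n.
have e3'' := le_trans e3 (ler_wpM2r (F_ge0 x rho) e3').
have e2'' := le_trans e2 (ler_wpM2l (mulr_ge0 (ler0n _ 16) Q0) e2').
have fx' := ler_wpM2l Q0 fx; have fy' := ler_wpM2l Q0 fy.
have split3 : cmod (u x - u y) ^+ 2 <=
    3 * (cmod (u x - mean (gball x rho) u) ^+ 2
       + cmod (mean (gball y (dist x y)) u - mean (gball x rho) u) ^+ 2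
       + cmod (u y - mean (gball y (dist x y)) u) ^+ 2).
  have -> : u x - u y = (u x - mean (gball x rho) u)
    - (mean (gball y (dist x y)) u - mean (gball x rho) u)
    - (u y - mean (gball y (dist x y)) u) by ring.
  set a := u x - _; set b := mean _ u - _; set c := u y - _.
  have h1 := cmodB (a - b) c; have h2 := cmodB a b.
  have a0 := cmod_ge0 a; have b0 := cmod_ge0 b; have c0 := cmod_ge0 c.
  move: (cmod_ge0 (a - b - c)) h1 h2 a0 b0 c0.
  move: (cmod (a - b - c)) (cmod (a - b)) (cmod a) (cmod b) (cmod c) => m k A B C m0 h1 h2 *.
  have : m ^+ 2 <= (A + B + C) ^+ 2 by rewrite lerXn2r ?nnegrE //; lra.
  have := sqr_ge0 (A - B); have := sqr_ge0 (B - C); have := sqr_ge0 (A - C); lra.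
apply: le_trans split3 _.
have tU : 0 <= t * (U / (cL * r ^+ 2)) by rewrite mulr_ge0.
(* The coefficient 216 is [3 * (16 + 4 + 16) * 2]: three squares, the constants of the two values
   and of the means, and the factor of [F_decay]. *)
exact: collect3 e1 e2'' e3'' fx' fy' tU.
Qed.

End Morrey.

(** * Sectors and rotations in the complex plane *)

Section Sectors.
Context {R : realType}.
Implicit Types (z w lambda : R[i]) (omega nu : R).

Lemma cmod_polar z : z <> 0 ->
  [/\ 0 <= acos (complex.Re z / cmod z) <= pi,
      complex.Re z = cmod z * cos (acos (complex.Re z / cmod z))
    & `|complex.Im z| = cmod z * sin (acos (complex.Re z / cmod z))].
Proof.
move=> z0; have m0 := cmod_gt0 z0.
set t := complex.Re z / cmod z.
have tb : -1 <= t <= 1.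
  by rewrite -ler_norml normrM normfV (gtr0_norm m0) ler_pdivrMr // mul1r normr_Re_le.
have [h1 h2] := acos_def tb; split => //.
  by rewrite h2 /t mulrC divfK // gt_eqF.
have t1 : 0 <= 1 - t ^+ 2.
  move: tb => /andP[ta tb].
  have := mulr_ge0 (_ : 0 <= 1 - t) (_ : 0 <= 1 + t); lra.
have mt : cmod z * t = complex.Re z by rewrite /t mulrC divfK // gt_eqF.
rewrite sin_acos //; apply/eqP.
rewrite -(@eqrXn2 _ 2) ?normr_ge0 ?mulr_ge0 ?sqrtr_ge0 ?(ltW m0) //; apply/eqP.
rewrite exprMn sqr_sqrtr // real_normK ?num_real // mulrBr mulr1 -exprMn mt sqr_cmod.
ring.
Qed.

Lemma cos_le_of a b : 0 <= a -> a <= b -> b <= pi -> cos b <= cos a :> R.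
Proof.
move=> a0 ab bpi; rewrite le_eqVlt in ab; case/predU1P: ab => [->//|ab].
have ia : a \in `[0, pi] by rewrite in_itv /=; apply/andP; split; lra.
have ib : b \in `[0, pi] by rewrite in_itv /=; apply/andP; split; lra.
by rewrite ltW // ltr_cos.
Qed.

Lemma normr_carg z : z <> 0 -> `|carg z| = acos (complex.Re z / cmod z).
Proof.
move=> z0; have [/andP[a0 _] _ _] := cmod_polar z0.
by rewrite /carg; case: ifP => _; rewrite ?normrN ger0_norm.
Qed.

(** Restating the sector as an inequality between real part and modulus makes it stable under
    limits, as [numerical_range] requires. *)
Lemma closed_sector_Re omega z : 0 < omega < pi / 2 -> closed_sector omega z ->
  cos omega * cmod z <= complex.Re z.
Proof.
move=> /andP[w0 wpi] [->|]; first by rewrite cmod0 mulr0.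
have [->|/eqP z0] := eqVneq z 0; first by rewrite cmod0 mulr0.
have [/andP[a0 _] e _] := cmod_polar z0.
rewrite normr_carg // => le; rewrite [leRHS]e mulrC ler_wpM2l ?cmod_ge0 //.
by apply: cos_le_of => //; have := pi_gt0 R; lra.
Qed.

(* The direction bisecting the union of the two sectors makes an angle at most
   [(nu + omega) / 2 < pi / 2] with every element of either. *)
Lemma sector_rotation omega nu lambda :
  0 < omega < pi / 2 -> pi / 2 < nu < pi - omega -> lambda <> 0 ->
  open_sector nu lambda ->
  exists a : R[i], [/\ cmod a = 1,
    cos ((nu + omega) / 2) * cmod lambda <= complex.Re (a * lambda)
    & forall z, cos omega * cmod z <= complex.Re z ->
        cos ((nu + omega) / 2) * cmod z <= complex.Re (a * z)].
Proof.
move=> /andP[w0 wpi] /andP[npi nw] l0 [//|].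
have pi0 := pi_gt0 R.
have [/andP[a0 api] eR eI] := cmod_polar l0; rewrite normr_carg //.
move: (acos _) a0 api eR eI => a a0 api eR eI anu.
(* The rotation is by [- th] if [lambda] has nonnegative imaginary part and by [th] otherwise. The
   small sector is sent to angles at most [omega + th], and [lambda] to an angle at most [nu - th];
   both numbers equal [(nu + omega) / 2]. *)
pose th := (nu - omega) / 2.
have th0 : 0 <= th by rewrite /th; lra.
have ct0 : 0 <= cos th by apply: cos_ge0_pihalf; rewrite /th; lra.
have st0 : 0 <= sin th by apply: sin_ge0_pi; rewrite /th; lra.
have sw0 : 0 <= sin omega by apply: sin_ge0_pi; lra.
have cw0 : 0 <= cos omega by apply: cos_ge0_pihalf; lra.
have sq : cos th ^+ 2 + sin th ^+ 2 = 1 by rewrite cos2Dsin2.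
have cl : cos ((nu + omega) / 2) <= cos (a - th).
  have [ta|ta] := lerP th a.
    by apply: cos_le_of; rewrite /th in ta *; lra.
  by rewrite -[leRHS]cosN opprB; apply: cos_le_of; rewrite /th in ta *; lra.
have Imz z : cos omega * cmod z <= complex.Re z ->
    `|complex.Im z| <= sin omega * cmod z.
  move=> h; rewrite -(ler_pXn2r (n := 2)) ?nnegrE ?mulr_ge0 ?cmod_ge0 //.
  rewrite real_normK ?num_real // exprMn.
  have := sqr_cmod z; have := cos2Dsin2 omega.
  have : (cos omega * cmod z) ^+ 2 <= complex.Re z ^+ 2.
    rewrite lerXn2r ?nnegrE ?mulr_ge0 ?cmod_ge0 //.
    by apply: le_trans h; rewrite mulr_ge0 ?cmod_ge0.
  rewrite exprMn => h1 h2 h3.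
  have -> : sin omega ^+ 2 = 1 - cos omega ^+ 2 by lra.
  by rewrite mulrBl mul1r; lra.
have cz z : cos omega * cmod z <= complex.Re z ->
    cos ((nu + omega) / 2) * cmod z
    <= cos th * complex.Re z - sin th * `|complex.Im z|.
  move=> h; have h1 := ler_wpM2l ct0 h; have h2 := ler_wpM2l st0 (Imz z h).
  have -> : (nu + omega) / 2 = th + omega by rewrite /th; lra.
  by rewrite cosD; lra.
have cll : cos ((nu + omega) / 2) * cmod lambda
    <= cos th * complex.Re lambda + sin th * `|complex.Im lambda|.
  rewrite eR eI; have := ler_wpM2r (cmod_ge0 lambda) cl.
  by rewrite cosB; lra.
have cm (s : R) : s ^+ 2 = sin th ^+ 2 -> cmod (Complex (cos th) s) = 1.
  by move=> s2; rewrite /= s2 sq sqrtr1.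
have [I0|I0] := lerP 0 (complex.Im lambda).
  exists (Complex (cos th) (- sin th)); split; first by rewrite cm // sqrrN.
    by rewrite Re_mulc /=; move: cll; rewrite ger0_norm //; lra.
  move=> z /cz; rewrite Re_mulc /=.
  have := ler_wpM2l st0 (ler_norm (- complex.Im z)); rewrite normrN; lra.
exists (Complex (cos th) (sin th)); split; first by rewrite cm.
  by rewrite Re_mulc /=; move: cll; rewrite ltr0_norm //; lra.
move=> z /cz; rewrite Re_mulc /=.
have := ler_wpM2l st0 (ler_norm (complex.Im z)); lra.
Qed.

End Sectors.

(** * Limits of complex sequences through real and imaginary parts *)

Section PointwiseLimits.
Context {R : realType}.

Definition ccvg (z_ : nat -> R[i]) (z : R[i]) : Prop :=
  ((fun n => complex.Re (z_ n)) @ \oo --> complex.Re z) /\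
  ((fun n => complex.Im (z_ n)) @ \oo --> complex.Im z).

Lemma ccvgB z_ w_ z w : ccvg z_ z -> ccvg w_ w -> ccvg (fun n => z_ n - w_ n) (z - w).
Proof.
move=> [z1 z2] [w1 w2]; split.
  rewrite Re_addc Re_oppc (_ : (fun _ => _) =
    (fun n => complex.Re (z_ n) - complex.Re (w_ n))); first exact: cvgB.
  by apply/funext => n; rewrite Re_addc Re_oppc.
have ImN (x : R[i]) : complex.Im (- x) = - complex.Im x by case: x.
rewrite Im_addc ImN (_ : (fun _ => _) =
    (fun n => complex.Im (z_ n) - complex.Im (w_ n))); first exact: cvgB.
by apply/funext => n; rewrite Im_addc ImN.
Qed.

Lemma ccvg_cst z : ccvg (fun=> z) z.
Proof. by split; exact: cvg_cst. Qed.

Lemma ccvgMr z_ z w : ccvg z_ z -> ccvg (fun n => z_ n * w) (z * w).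
Proof.
move=> [z1 z2]; split.
  rewrite Re_mulc (_ : (fun _ => _) = (fun n => complex.Re (z_ n) * complex.Re w
    - complex.Im (z_ n) * complex.Im w)); last first.
    by apply/funext => n; rewrite Re_mulc.
  by apply: cvgB; apply: cvgMl.
rewrite Im_mulc (_ : (fun _ => _) = (fun n => complex.Re (z_ n) * complex.Im w
    + complex.Im (z_ n) * complex.Re w)); last first.
  by apply/funext => n; rewrite Im_mulc.
by apply: cvgD; apply: cvgMl.
Qed.

Lemma ccvg_sqr_cmod z_ z (p : R) : ccvg z_ z ->
  (fun n => cmod (z_ n) ^+ 2 * p) @ \oo --> cmod z ^+ 2 * p.
Proof.
move=> [z1 z2]; apply: cvgMl; rewrite sqr_cmod.
rewrite (_ : (fun _ => _) = (fun n => complex.Re (z_ n) * complex.Re (z_ n)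
  + complex.Im (z_ n) * complex.Im (z_ n))); last by apply/funext => n; rewrite sqr_cmod !expr2.
by rewrite !expr2; apply: cvgD; apply: cvgM.
Qed.

Lemma ccvg_cauchy (z_ : nat -> R[i]) :
  (forall e, 0 < e -> exists N, forall n m, (N <= n)%N -> (N <= m)%N ->
     cmod (z_ n - z_ m) <= e) -> exists z, ccvg z_ z.
Proof.
move=> C.
have lim (f : R[i] -> R) : (forall z w, `|f z - f w| <= cmod (z - w)) ->
    exists l : R, (fun n => f (z_ n)) @ \oo --> l.
  move=> fl; have : cvg ((fun n => f (z_ n)) @ \oo).
    apply/cauchy_cvgP/cauchy_ballP => e e0.
    have e2 : 0 < e / 2 by rewrite divr_gt0.
    have [N HN] := C _ e2.
    exists ([set z | exists2 n, (N <= n)%N & f (z_ n) = z],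
            [set z | exists2 n, (N <= n)%N & f (z_ n) = z]).
      by split => /=; exists N => // n /= Nn; exists n.
    move=> [x y] /= [[n Nn <-] [m Nm <-]]; rewrite /ball /=.
    apply: le_lt_trans (fl _ _) _; apply: le_lt_trans (HN _ _ Nn Nm) _.
    by rewrite ltr_pdivrMr // ltr_pMr // ltr1n.
  by move=> /cvg_ex[l hl]; exists l.
have [a ha] : exists l : R, (fun n => complex.Re (z_ n)) @ \oo --> l.
  apply: lim => z w; apply: le_trans (normr_Re_le _).
  by rewrite Re_addc Re_oppc.
have [b hb] : exists l : R, (fun n => complex.Im (z_ n)) @ \oo --> l.
  apply: lim => z w; apply: le_trans (normr_Im_le _).
  by case: z w => ? ? [].
by exists (Complex a b).
Qed.

End PointwiseLimits.

(** * [W12] as a Hilbert space and solvability of coercive equations *)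

Section Solvability.
Context {R : realType} (X : wgraph R) (N : nat) (CW Cmu Cinf delta : R).
Hypothesis geom : bounded_geometry X N CW Cmu.
Variable c : X -> X -> R[i].
Hypothesis ell : uniformly_elliptic Cinf delta c.
Implicit Types (x y z : X) (u v f g : X -> R[i]).

Local Notation L2u u := (l2s setT (@mass R X) u).
Local Notation L2d u := (l2s (@edges R X) mue (dfe u)).
Let ce (F : X * X -> R[i]) : X * X -> R[i] := fun e => c e.1 e.2 * F e.
Let mueT (e : X * X) : edges e -> 0 <= mue e.
Proof. exact: mue_ge0T. Qed.
Let massT x : [set: X] x -> 0 <= mass x.
Proof. exact: (mass_ge0 geom). Qed.

Definition w12_inner u v : R :=
  complex.Re (inner u v) + complex.Re (pairing (@edges R X) mue (dfe u) (dfe v)).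

Lemma w12_inner_self u : w12_inner u u = nsq setT (@mass R X) u + energy setT u.
Proof.
rewrite /w12_inner energyT; congr (_ + _); last by rewrite pairing_self.
by rewrite -[inner u u]/(pairing setT (@mass R X) u u) pairing_self.
Qed.

Lemma dfe_lin (a : R[i]) u v :
  dfe (fun x => a * u x + v x) = (fun e => a * dfe u e + dfe v e).
Proof. by apply/funext => e; rewrite /dfe df_lin. Qed.

Lemma dfeB u v : dfe (fun x => u x - v x) = (fun e => dfe u e - dfe v e).
Proof.
have -> : (fun x => u x - v x) = (fun x => -1 * v x + u x).
  by apply/funext => x; ring.
by rewrite dfe_lin; apply/funext => e; ring.
Qed.

Lemma W12_subspace : is_subspace (fun u : X -> R[i] => W12 u).
Proof.
split; last by move=> a u v Wu Wv; exact: (W12_lin geom).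
apply/(W12_l2 geom); split; first exact: (l2s0 setT).
apply: (@eq_l2s _ _ _ _ (fun=> 0)); last exact: l2s0.
by move=> e _; rewrite /dfe /df subrr mul0r; case: ifP.
Qed.

Lemma W12B u v : W12 u -> W12 v -> W12 (fun x => u x - v x).
Proof. exact: (subspaceB W12_subspace). Qed.

Lemma W12Z (a : R[i]) u : W12 u -> W12 (fun x => a * u x).
Proof. exact: (subspaceZ W12_subspace a). Qed.

Lemma w12_semi_inner : semi_inner (fun u : X -> R[i] => W12 u) w12_inner.
Proof.
have RZ (a : R) (z : R[i]) : complex.Re (a%:C%C * z) = a * complex.Re z.
  by rewrite Re_mulc /= mul0r subr0.
split.
- move=> u v _ _; rewrite /w12_inner; congr (_ + _); last exact: Re_pairingC.
  exact: (Re_pairingC setT (@mass R X)).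
- move=> a u v w /(W12_l2 geom)[u1 u2] /(W12_l2 geom)[v1 v2] /(W12_l2 geom)[w1 w2].
  rewrite /w12_inner.
  have -> : inner (a%:C%C *: u + v) w = a%:C%C * inner u w + inner v w.
    rewrite -[LHS]/(pairing setT (@mass R X) (fun x => a%:C%C * u x + v x) w).
    rewrite (pairingDl massT) // ?(pairingZl massT) //.
    exact: (l2sZ massT).
  rewrite -[dfe (_ + _)]/(dfe (fun x => a%:C%C * u x + v x)) dfe_lin.
  rewrite (pairingDl mueT) // ?(pairingZl mueT) //; last exact: (l2sZ mueT).
  by rewrite !Re_addc !RZ; ring.
- move=> u _; rewrite w12_inner_self addr_ge0 //; first exact: (nsq_ge0 massT).
  by rewrite energyT; exact: (nsq_ge0 mueT).
Qed.

(** Point evaluation is continuous because every vertex has positive mass; Cauchy sequences thus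
    converge pointwise. *)
Lemma sqr_cmod_le_nsq u x : L2u u ->
  cmod (u x) ^+ 2 <= (mass x)^-1 * nsq setT (@mass R X) u.
Proof.
move=> lu; rewrite ler_pdivlMl ?(mass_gt0 geom) // mulrC.
apply: (term_le_rsum (f := fun x => cmod (u x) ^+ 2 * mass x)) => // y _.
exact: (sqp_ge0 massT u).
Qed.

(** The candidate limit is the pointwise one, and edge differences converge pointwise with it. *)
Lemma w12_complete : form_complete (fun u : X -> R[i] => W12 u) w12_inner.
Proof.
move=> u_ Wu Cu.
have Lu n : L2u (u_ n) by case/(W12_l2 geom): (Wu n).
have Du n : L2d (u_ n) by case/(W12_l2 geom): (Wu n).
have qE n m : w12_inner (u_ n - u_ m) (u_ n - u_ m) =
    nsq setT (@mass R X) (fun x => u_ n x - u_ m x)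
    + nsq (@edges R X) mue (fun e => dfe (u_ n) e - dfe (u_ m) e).
  by rewrite w12_inner_self energyT -[dfe (_ - _)]/(dfe (fun x => u_ n x - u_ m x)) dfeB.
have LB n m : L2u (fun x => u_ n x - u_ m x) by exact: (l2sB massT).
have DB n m : l2s (@edges R X) mue (fun e => dfe (u_ n) e - dfe (u_ m) e).
  exact: (l2sB mueT).
have n1 n m := nsq_ge0 massT (fun x => u_ n x - u_ m x).
have n2 n m := nsq_ge0 mueT (fun e => dfe (u_ n) e - dfe (u_ m) e).
have /choice[l Hl] : forall x, exists z : R[i], ccvg (fun n => u_ n x) z.
  move=> x; apply: ccvg_cauchy => e e0.
  have m0 := mass_gt0 geom x.
  have em : 0 < e ^+ 2 * mass x by rewrite mulr_gt0 ?exprn_gt0.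
  have [M HM] := Cu _ em; exists M => n m Mn Mm.
  rewrite -(ler_pXn2r (n := 2)) ?nnegrE ?cmod_ge0 ?(ltW e0) //.
  apply: le_trans (sqr_cmod_le_nsq x (LB n m)) _.
  rewrite ler_pdivrMl // mulrC; apply: le_trans (HM _ _ Mn Mm).
  by rewrite qE lerDl.
have Hd e : ccvg (fun n => dfe (u_ n) e) (dfe l e).
  rewrite /dfe /df; case: ifP => _; first exact: ccvg_cst.
  by apply: ccvgMr; exact: ccvgB.
(* Fatou's lemma in [m] with [n] fixed, once on vertices and once on edges. *)
have key n e : 0 < e -> (forall m, (n <= m)%N -> w12_inner (u_ n - u_ m) (u_ n - u_ m) <= e) ->
    [/\ L2u (fun x => u_ n x - l x), nsq setT (@mass R X) (fun x => u_ n x - l x) <= e,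
     l2s (@edges R X) mue (fun d => dfe (u_ n) d - dfe l d)
     & nsq (@edges R X) mue (fun d => dfe (u_ n) d - dfe l d) <= e].
  move=> e0 H.
  have [] := @Fatou_rsum R X setT (fun m x => cmod (u_ n x - u_ m x) ^+ 2 * mass x)
    (fun x => cmod (u_ n x - l x) ^+ 2 * mass x) e.
  - by move=> m x _; exact: (sqp_ge0 massT (fun x => u_ n x - u_ m x)).
  - by move=> x _; apply: ccvg_sqr_cmod; apply: ccvgB => //; exact: ccvg_cst.
  - by move=> m; exact: LB.
  - exists n => // m /= nm; apply: le_trans (H m nm); by rewrite qE lerDl.
  move=> a1 a2.
  have [] := @Fatou_rsum R _ (@edges R X)
    (fun m d => cmod (dfe (u_ n) d - dfe (u_ m) d) ^+ 2 * mue d)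
    (fun d => cmod (dfe (u_ n) d - dfe l d) ^+ 2 * mue d) e.
  - by move=> m d ad; exact: (sqp_ge0 mueT (fun d => dfe (u_ n) d - dfe (u_ m) d)).
  - by move=> d _; apply: ccvg_sqr_cmod; apply: ccvgB => //; exact: ccvg_cst.
  - by move=> m; exact: DB.
  - exists n => // m /= nm; apply: le_trans (H m nm); by rewrite qE lerDr.
  by move=> b1 b2; split.
exists l; split.
  have [M HM] := Cu 1 ltr01.
  have [a1 _ b1 _] := key M 1 ltr01 (fun m Mm => HM M m (leqnn M) Mm).
  apply/(W12_l2 geom); split.
    have := l2sB massT (Lu M) a1; apply: eq_l2s => x _; ring.
  have := l2sB mueT (Du M) b1; apply: eq_l2s => d _; ring.
move=> e e0; have e2 : 0 < e / 2 by rewrite divr_gt0.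
have [M HM] := Cu _ e2; exists M => n Mn.
have [_ a2 _ b2] := key n _ e2 (fun m nm => HM n m Mn (leq_trans Mn nm)).
rewrite w12_inner_self energyT -[dfe (_ - _)]/(dfe (fun x => u_ n x - l x)) dfeB.
rewrite -[nsq _ _ (u_ n - l)]/(nsq setT (@mass R X) (fun x => u_ n x - l x)).
by lra.
Qed.

Lemma form_lin_l (a : R[i]) u v w : W12 u -> W12 v -> W12 w ->
  Defs.form c (fun x => a * u x + v x) w = a * Defs.form c u w + Defs.form c v w.
Proof.
move=> /(W12_l2 geom)[_ u2] /(W12_l2 geom)[_ v2] /(W12_l2 geom)[_ w2].
have u2' := coeff_l2s ell u2; have v2' := coeff_l2s ell v2.
rewrite !formE -(pairingZl mueT) // -(pairingDl mueT) //; last exact: (l2sZ mueT).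
by apply: eq_pairing => // e _; rewrite dfe_lin; ring.
Qed.

Lemma form_lin_r (a : R[i]) u v w : W12 u -> W12 v -> W12 w ->
  Defs.form c w (fun x => a * u x + v x)
  = conjc a * Defs.form c w u + Defs.form c w v.
Proof.
move=> /(W12_l2 geom)[_ u2] /(W12_l2 geom)[_ v2] /(W12_l2 geom)[_ w2].
have w2' := coeff_l2s ell w2.
rewrite !formE dfe_lin (pairingDr mueT) //; last exact: (l2sZ mueT).
by rewrite (pairingZr mueT).
Qed.

Lemma inner_lin_l (a : R[i]) u v w : L2u u -> L2u v -> L2u w ->
  inner (fun x => a * u x + v x) w = a * inner u w + inner v w.
Proof.
move=> u1 v1 w1.
rewrite -[LHS]/(pairing setT (@mass R X) (fun x => a * u x + v x) w).
by rewrite (pairingDl massT) // ?(pairingZl massT) //; exact: (l2sZ massT).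
Qed.

Lemma inner_lin_r (a : R[i]) u v w : L2u u -> L2u v -> L2u w ->
  inner w (fun x => a * u x + v x) = conjc a * inner w u + inner w v.
Proof.
move=> u1 v1 w1.
rewrite -[LHS]/(pairing setT (@mass R X) w (fun x => a * u x + v x)).
by rewrite (pairingDr massT) // ?(pairingZr massT) //; exact: (l2sZ massT).
Qed.

Lemma form_CS u v : W12 u -> W12 v ->
  cmod (Defs.form c u v) ^+ 2 <= Cinf ^+ 2 * energy setT u * energy setT v.
Proof.
move=> /(W12_l2 geom)[_ u2] /(W12_l2 geom)[_ v2].
rewrite formE !energyT; apply: le_trans (pairing_CS mueT (coeff_l2s ell u2) v2) _.
by rewrite ler_wpM2r ?(nsq_ge0 mueT) // (coeff_nsq ell).
Qed.

Lemma form_young s u v : 0 < s -> W12 u -> W12 v ->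
  cmod (Defs.form c u v) <=
  2^-1 * (s * (Cinf ^+ 2 * energy setT u)) + 2^-1 * (s^-1 * energy setT v).
Proof.
move=> s0 /(W12_l2 geom)[_ u2] /(W12_l2 geom)[_ v2].
rewrite formE !energyT; apply: le_trans (pairing_young mueT s0 (coeff_l2s ell u2) v2) _.
by rewrite lerD2r !ler_pM2l ?invr_gt0 // (coeff_nsq ell).
Qed.

(** Two complex coefficients are allowed because it is used twice: with [tau] and 1 to approximate
    by elements of the domain, and with [a] and [a * lambda] for the rotated resolvent equation. *)
Lemma solve (alpha beta : R[i]) (kappa : R) f : 0 < kappa ->
  (forall u, W12 u -> kappa * (nsq setT (@mass R X) u + energy setT u) <=
     complex.Re (alpha * Defs.form c u u + beta * inner u u)) ->
  L2u f ->
  exists u, W12 u /\ forall v, W12 v ->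
    alpha * Defs.form c u v + beta * inner u v = inner f v.
Proof.
move=> k0 coer lf.
have q0 u : 0 <= nsq setT (@mass R X) u by exact: (nsq_ge0 massT).
have e0 u : 0 <= energy setT u by rewrite energyT; exact: (nsq_ge0 mueT).
apply: (Lax_Milgram W12_subspace w12_semi_inner w12_complete
  (B := fun u v => alpha * Defs.form c u v + beta * inner u v)
  (F := fun v => inner f v)
  (K := 2 * cmod alpha ^+ 2 * Cinf ^+ 2 + 2 * cmod beta ^+ 2)
  (K' := nsq setT (@mass R X) f) (kappa := kappa)) => //.
- apply: addr_ge0; apply: mulr_ge0; rewrite ?sqr_ge0 //.
  by apply: mulr_ge0; rewrite ?sqr_ge0.
- move=> a u v w Wu Wv Ww.
  have [[u1 _] [v1 _] [w1 _]] := And3 (proj1 (W12_l2 geom u) Wu) (proj1 (W12_l2 geom v) Wv) (proj1 (W12_l2 geom w) Ww).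
  rewrite -[a *: u + v]/(fun x => a * u x + v x) form_lin_l // inner_lin_l //; ring.
- move=> a u v w Wu Wv Ww.
  have [[u1 _] [v1 _] [w1 _]] := And3 (proj1 (W12_l2 geom u) Wu) (proj1 (W12_l2 geom v) Wv) (proj1 (W12_l2 geom w) Ww).
  rewrite -[a *: u + v]/(fun x => a * u x + v x) form_lin_r // inner_lin_r //; ring.
- move=> u v Wu Wv.
  have [[u1 _] [v1 _]] := conj (proj1 (W12_l2 geom u) Wu) (proj1 (W12_l2 geom v) Wv).
  apply: le_trans (sqr_cmodD _ _) _; rewrite !cmodM !exprMn !w12_inner_self.
  have h1 := form_CS Wu Wv.
  have h2 : cmod (inner u v) ^+ 2 <= nsq setT (@mass R X) u * nsq setT (@mass R X) v.
    exact: (pairing_CS massT u1 v1).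
  have := ler_wpM2l (sqr_ge0 (cmod alpha)) h1.
  have := ler_wpM2l (sqr_ge0 (cmod beta)) h2.
  move: (q0 u) (q0 v) (e0 u) (e0 v) (sqr_ge0 (cmod alpha)) (sqr_ge0 (cmod beta)) (sqr_ge0 Cinf).
  move: (nsq _ _ u) (nsq _ _ v) (energy _ u) (energy _ v) (cmod alpha ^+ 2)
    (cmod beta ^+ 2) (Cinf ^+ 2) => a b A B x y k a0 b0 A0 B0 x0 y0 k0' h3 h4.
  have s1 : 0 <= a * b by rewrite mulr_ge0.
  have s2 : 0 <= a * B by rewrite mulr_ge0.
  have s3 : 0 <= A * b by rewrite mulr_ge0.
  have s4 : 0 <= A * B by rewrite mulr_ge0.
  have xk : 0 <= x * k by rewrite mulr_ge0.
  have t1 := mulr_ge0 xk s1; have t2 := mulr_ge0 xk s2; have t3 := mulr_ge0 xk s3.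
  have t4 := mulr_ge0 y0 s2; have t5 := mulr_ge0 y0 s3; have t6 := mulr_ge0 y0 s4.
  by lra.
- by move=> u Wu; rewrite w12_inner_self; exact: coer.
- move=> a u v Wu Wv.
  have [[u1 _] [v1 _]] := conj (proj1 (W12_l2 geom u) Wu) (proj1 (W12_l2 geom v) Wv).
  by rewrite -[a *: u + v]/(fun x => a * u x + v x) inner_lin_r.
- move=> u Wu; have [u1 _] := proj1 (W12_l2 geom u) Wu.
  apply: le_trans (pairing_CS massT lf u1) _.
  by rewrite ler_wpM2l // w12_inner_self lerDl.
Qed.

End Solvability.

(** * Transfer of the sector condition from [L] to the form *)

Section NumericalRange.
Context {R : realType} (X : wgraph R) (N : nat) (CW Cmu Cinf delta : R).
Hypothesis geom : bounded_geometry X N CW Cmu.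
Variable c : X -> X -> R[i].
Hypothesis ell : uniformly_elliptic Cinf delta c.
Implicit Types (x y : X) (u v w f g : X -> R[i]).

Local Notation L2u u := (l2s setT (@mass R X) u).
Local Notation L2d u := (l2s (@edges R X) mue (dfe u)).
Local Notation form := (Defs.form c).
Let ce (F : X * X -> R[i]) : X * X -> R[i] := fun e => c e.1 e.2 * F e.
Let mueT (e : X * X) : edges e -> 0 <= mue e.
Proof. exact: mue_ge0T. Qed.
Let massT x : [set: X] x -> 0 <= mass x.
Proof. exact: (mass_ge0 geom). Qed.
Let Wl u : W12 u -> L2u u. Proof. by case/(W12_l2 geom). Qed.
Let Wd u : W12 u -> L2d u. Proof. by case/(W12_l2 geom). Qed.
Let d0 : 0 < delta. Proof. by case: (ellipticity_constants ell). Qed.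
Let energy0 u : 0 <= energy setT u.
Proof. by rewrite energyT; exact: (nsq_ge0 mueT). Qed.

(** The test function is the difference [w - w'] restricted to a single vertex. *)
Lemma inner_separates w w' : L2u w -> L2u w' ->
  (forall v, W12 v -> inner w v = inner w' v) -> w = w'.
Proof.
move=> lw lw' H; apply/funext => x; apply/eqP; rewrite -subr_eq0.
pose d y := w y - w' y; pose v y : R[i] := if y == x then d x else 0.
have Wv : W12 v.
  have := W12Z geom (d x) (W12_delta geom x).
  rewrite (_ : (fun y => _) = v) //; apply/funext => y; rewrite /v.
  by case: ifP; rewrite ?mulr1 ?mulr0.
have ld : L2u d by exact: (l2sB massT).
have E : pairing setT (@mass R X) v v = 0.
  have : pairing setT (@mass R X) d v = 0.
    have := H v Wv; rewrite -[inner w v]/(pairing setT (@mass R X) w v).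
    rewrite -[inner w' v]/(pairing setT (@mass R X) w' v) => e.
    by rewrite (pairingBl massT lw lw' (Wl Wv)) e subrr.
  move=> <-; apply: eq_csum => y _; rewrite /v; case: eqP => [->//|_].
  by rewrite conjc0 !mulr0.
have := sqr_cmod_le_nsq geom x (Wl Wv).
have -> : nsq setT (@mass R X) v = 0 by move: E; rewrite pairing_self => -[].
rewrite mulr0 real_exprn_even_le0 ?num_real //= cmod_eq0 /v eqxx.
by [].
Qed.

(** The largest domain on which the form is represented by an L^2 function. It contains the domain
    of any [L] associated with the form; the reverse inclusion is the use made of maximality. *)
Definition form_domain u : Prop :=
  W12 u /\ exists w, L2u w /\ forall v, W12 v -> form u v = inner w v.

Lemma form_operator : exists M : operator X,
  (forall u, Defs.dom M u <-> form_domain u) /\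
  (forall u v, form_domain u -> W12 v -> form u v = inner (op M u) v).
Proof.
pose A u : X -> R[i] :=
  if pselect (form_domain u) is left H then projT1 (cid (proj2 H)) else fun=> 0.
have HA u : form_domain u -> L2u (A u) /\ forall v, W12 v -> form u v = inner (A u) v.
  by move=> Du; rewrite /A; case: pselect => // H; case: (cid _).
(* The representing function is picked by choice; its uniqueness is what makes the operator
   linear. *)
have AE u w : form_domain u -> L2u w -> (forall v, W12 v -> form u v = inner w v) ->
    A u = w.
  move=> /HA[l1 h1] lw h2; apply: inner_separates => // v Wv.
  by rewrite -h1 // h2.
have lin (a : R[i]) u v : form_domain u -> form_domain v ->
    form_domain (fun x => a * u x + v x) /\
    A (fun x => a * u x + v x) = (fun x => a * A u x + A v x).
  move=> Du Dv; have [lu hu] := HA u Du; have [lv hv] := HA v Dv.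
  have lw : L2u (fun x => a * A u x + A v x) by apply: (l2sD massT) => //; exact: (l2sZ massT).
  have hw t : W12 t -> form (fun x => a * u x + v x) t = inner (fun x => a * A u x + A v x) t.
    have Wu : W12 u by case: Du.
    have Wv : W12 v by case: Dv.
    move=> Wt; rewrite (form_lin_l geom ell a Wu Wv Wt).
    by rewrite (inner_lin_l geom a lu lv (Wl Wt)) hu // hv.
  have D : form_domain (fun x => a * u x + v x).
    split; first by apply: (W12_lin geom); [case: Du|case: Dv].
    by exists (fun x => a * A u x + A v x).
  by split => //; exact: AE.
have D0 : form_domain (fun=> 0).
  have W0 : W12 (fun=> 0 : R[i]) := proj1 (W12_subspace geom).
  split => //; exists (fun=> 0); split; first exact: (l2s0 setT).
  move=> v Wv.
  have E : (fun=> 0 : R[i]) = (fun x : X => 0 * (fun=> 0) x + (fun=> 0) x) :> (X -> R[i]).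
    by apply/funext => x; rewrite mul0r add0r.
  have := form_lin_l geom ell 0 W0 W0 Wv; rewrite -E mul0r add0r => _.
  have z1 : form (fun=> 0) v = 0.
    have := form_lin_l geom ell (-1) W0 W0 Wv.
    rewrite (_ : (fun x => _) = (fun=> 0)); last by apply/funext => x; rewrite mulr0 add0r.
    by rewrite mulN1r addNr.
  have z2 : inner (fun=> 0) v = 0.
    have := inner_lin_l geom (-1) (l2s0 setT (@mass R X)) (l2s0 setT (@mass R X)) (Wl Wv).
    rewrite (_ : (fun x => _) = (fun=> 0)); last by apply/funext => x; rewrite mulr0 add0r.
    by rewrite mulN1r addNr.
  by rewrite z1 z2.
have DL2 : [set u | form_domain u] `<=` @L2 R X.
  by move=> u [Wu _]; apply/(normL2_fin geom); exact: Wl.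
have AL2 u : [set u | form_domain u] u -> L2 (A u).
  by move=> /HA[lw _]; apply/(normL2_fin geom).
exists (@Operator R X [set u | form_domain u] A DL2 AL2 D0
  (fun a u v Du Dv => proj1 (lin a u v Du Dv))
  (fun a u v Du Dv => proj2 (lin a u v Du Dv))).
by split => // u v Du Wv; case: (HA u Du) => _; apply.
Qed.

(* The realization of the form on its maximal domain is an accretive extension
   of L, hence equal to L by maximality. *)
Lemma form_domain_sub (L : operator X) u : associated_operator c L ->
  form_domain u -> Defs.dom L u.
Proof.
move=> [[accL maxL] domW assoc] Du.
have [M [domM opM]] := form_operator.
apply: (maxL M); last exact/domM.
  move=> v /domM Dv; rewrite -opM //; last by case: Dv.
  have Wv : W12 v by case: Dv.
  apply: le_trans (garding ell Wv); apply: mulr_ge0; rewrite ?(ltW d0) //.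
have sub v : Defs.dom L v -> form_domain v.
  move=> Lv; split; first exact: domW.
  exists (op L v); split; last by move=> t Wt; rewrite assoc.
  by apply/(normL2_fin geom); exact: (op_L2 Lv).
split; first by move=> v /sub Dv; exact/domM.
move=> v Lv; have Dv := sub v Lv; apply: inner_separates.
- by apply/(normL2_fin geom); apply: op_L2; exact/domM.
- by apply/(normL2_fin geom); apply: op_L2.
- by move=> t Wt; rewrite -opM // assoc.
Qed.

(** On finitely many edges differences are bounded by values at the endpoints. The constant depends
    on [F], as nothing bounds the weights [h] from below uniformly. *)
Lemma finite_energy_le (F : set (X * X)) : finite_set F -> F `<=` @edges R X ->
  exists k : R, 0 <= k /\ forall z, L2u z ->
    rsum F (fun e => cmod (dfe z e) ^+ 2 * mue e) <= k * nsq setT (@mass R X) z.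
Proof.
move=> fF FE.
pose k (e : X * X) : R :=
  2 * ((mass e.2)^-1 + (mass e.1)^-1) * (h e.1 e.2)^-1 ^+ 2 * mue e.
have mp x := mass_gt0 geom x.
have k0 e : F e -> 0 <= k e.
  move=> /FE/mueT m0; rewrite /k mulr_ge0 // mulr_ge0 ?sqr_ge0 //.
  by rewrite mulr_ge0 // addr_ge0 // invr_ge0 ltW.
have [sk _] := rsum_finite fF k0.
exists (rsum F k); split; first exact: rsum_ge0.
move=> z lz; have n0 := nsq_ge0 massT z.
have sF : rsummable F (fun e => cmod (dfe z e) ^+ 2 * mue e).
  have [|] := rsum_finite (f := fun e => cmod (dfe z e) ^+ 2 * mue e) fF => //.
  by move=> e /FE/mueT m0; rewrite mulr_ge0 ?sqr_ge0.
rewrite mulrC -rsumZE //; apply: ler_rsum => //; first exact: rsummableZ.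
move=> [x y] Fe; have ae := FE _ Fe; have m0 := mueT ae.
have [yx|/eqP yx] := eqVneq y x.
  rewrite /dfe /df /= yx eqxx cmod0 expr0n mul0r mulr_ge0 //.
  by have := k0 _ Fe; rewrite yx.
set n := nsq _ _ _ in n0 *.
have -> : n * k (x, y) =
    (2 * ((mass y)^-1 * n + (mass x)^-1 * n)) * (h x y)^-1 ^+ 2 * mue (x, y).
  by rewrite /k /=; move: (mue _) ((h x y)^-1) => a b; ring.
rewrite /dfe /= cmod_df_ne // exprMn; apply: ler_wpM2r => //.
apply: ler_wpM2r; first exact: sqr_ge0.
apply: le_trans (sqr_cmodB _ _) _.
by have := sqr_cmod_le_nsq geom x lz; have := sqr_cmod_le_nsq geom y lz; rewrite -/n; lra.
Qed.

(* The approximation v solves tau * form v + v = u. To bound z = v - u, du is cut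
   into a tail of small norm and a part supported on a finite set of edges,
   where dz is controlled by the L^2 norm of z, which tends to 0 with tau. *)
Lemma W12_form_domain_close u eta : W12 u -> 0 < eta ->
  exists v, [/\ form_domain v, cmod (form u (fun x => v x - u x)) <= eta
    & energy setT (fun x => v x - u x) <= eta].
Proof.
move=> Wu; wlog : eta / eta <= 1.
  move=> H eta0; have [|e1] := lerP eta 1; first by move=> ?; exact: H.
  have [v [h1 h2 h3]] := H 1 (lexx 1) ltr01.
  by exists v; split => //; [apply: le_trans h2 _|apply: le_trans h3 _]; exact: ltW.
move=> _ eta0.
have dd : 0 < Num.min eta (delta * eta) by rewrite lt_min eta0 mulr_gt0.
(* One bound on [form u z] serves both conclusions, since [delta] times the energy of [z = v - u] is
   at most its modulus. *)
set e0 := Num.min eta (delta * eta) in dd *.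
(* [B1] and [B0] will bound the modulus of [form u z] and the energy of [z] uniformly in [tau]. *)
set E := energy setT u; have E0 : 0 <= E := energy0 u.
pose B0 := Cinf ^+ 2 * E / delta ^+ 2; pose B1 := Cinf ^+ 2 * E / delta.
have CE0 : 0 <= Cinf ^+ 2 * E by rewrite mulr_ge0 ?sqr_ge0.
have B00 : 0 <= B0 by rewrite divr_ge0 ?sqr_ge0.
have B10 : 0 <= B1 by rewrite divr_ge0 // ltW.
have Ci : 0 < Cinf by case: (ellipticity_constants ell).
(* The parameters are chosen in the order [s1], [eps], the finite set [F] and its constant [k],
   [s2], and [tau] last, so that each of the four Young terms below is at most [e0 / 2] before its
   factor 1/2. *)
pose s1 := 2 * (B0 + 1) / e0.
have s10 : 0 < s1 by rewrite divr_gt0 // mulr_gt0 //; lra.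
pose eps := e0 / (2 * (s1 * Cinf ^+ 2)).
have eps0 : 0 < eps by rewrite divr_gt0 // mulr_gt0 // mulr_gt0 // exprn_gt0.
have [F [fF FE tail]] := rsum_tail (sqp_ge0 mueT (dfe u)) (Wd Wu) eps0.
have [k [k0 kF]] := finite_energy_le fF FE.
pose s2 := e0 / (2 * (Cinf ^+ 2 * E + 1)).
have s20 : 0 < s2 by rewrite divr_gt0 // mulr_gt0 //; lra.
pose tau := e0 * s2 / (2 * (k * B1 + 1)).
have kB : 0 <= k * B1 by rewrite mulr_ge0.
have kB1 : 0 < k * B1 + 1 by rewrite ltr_pwDr.
have tau0 : 0 < tau.
  by apply: divr_gt0; [exact: mulr_gt0|apply: mulr_gt0].
have ReZ (a : R) (z : R[i]) : complex.Re (a%:C%C * z) = a * complex.Re z.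
  by rewrite Re_mulc /= mul0r subr0.
have inn w : complex.Re (inner w w) = nsq setT (@mass R X) w.
  by rewrite -[inner w w]/(pairing setT (@mass R X) w w) pairing_self.
have [||v [Wv Hv]] := solve geom ell (alpha := tau%:C%C) (beta := 1)
    (kappa := Num.min 1 (tau * delta)) (f := u) _ _ (Wl Wu).
- by rewrite lt_min ltr01 mulr_gt0.
- move=> w Ww; rewrite Re_addc ReZ mul1r inn mulrDr addrC; apply: lerD.
    apply: le_trans (_ : tau * delta * energy setT w <= _).
      by rewrite ler_wpM2r // ge_min lexx orbT.
    by rewrite -mulrA ler_pM2l // (garding ell).
  by rewrite ler_piMl ?(nsq_ge0 massT) // ge_min lexx.
pose z x := v x - u x.
have Wz : W12 z by exact: (W12B geom).
have tC : tau%:C%C != 0 by apply/eqP => -[] /eqP; rewrite gt_eqF.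
have Dv : form_domain v.
  split => //; exists (fun x => - (tau%:C%C^-1) * z x); split.
    by apply: (l2sZ massT); exact: Wl.
  move=> t Wt; have := Hv t Wt; rewrite mul1r.
  have -> : inner (fun x => - (tau%:C%C^-1) * z x) t = - (tau%:C%C^-1) * inner z t.
    by apply: (pairingZl massT); exact: Wl.
  have -> : inner z t = inner v t - inner u t by apply: (pairingBl massT); exact: Wl.
  move=> <-; rewrite opprD addrCA subrr addr0 mulrN mulNr opprK mulrA mulVf //.
  by rewrite mul1r.
have vE : v = (fun x => 1 * z x + u x).
  by apply/funext => x; rewrite /z mul1r subrK.
(* The equation for [v], tested with [z] after subtracting [u]. *)
have key : tau * complex.Re (form z z) + nsq setT (@mass R X) z
    = - (tau * complex.Re (form u z)).
  have := Hv z Wz; rewrite {1}vE (form_lin_l geom ell) // !mul1r mulrDr.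
  have -> : inner v z = inner z z + inner u z.
    by have := inner_lin_l geom 1 (Wl Wz) (Wl Wu) (Wl Wz); rewrite -vE mul1r.
  rewrite addrA => /(congr1 (fun a => complex.Re (a - inner u z))).
  rewrite addrK subrr !Re_addc !ReZ inn /= => h; lra.
have fuz : - complex.Re (form u z) <= cmod (form u z).
  by rewrite -Re_oppc; apply: le_trans (ler_norm _) _;
    apply: le_trans (normr_Re_le _) _; rewrite cmodN.
set fz := cmod (form u z) in fuz *.
have gz := garding ell Wz.
have nz0 := nsq_ge0 massT z; have ez0 := energy0 z.
have nz : nsq setT (@mass R X) z <= tau * fz.
  have h1 := ler_wpM2l (ltW tau0) fuz.
  have h2 := ler_wpM2l (ltW tau0) gz.
  have h3 : 0 <= tau * (delta * energy setT z).
    by apply: mulr_ge0; [exact: ltW|apply: mulr_ge0; [exact: ltW|]].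
  lra.
have ez : delta * energy setT z <= fz.
  rewrite -(ler_pM2l tau0).
  have h1 := ler_wpM2l (ltW tau0) fuz.
  have h2 := ler_wpM2l (ltW tau0) gz.
  lra.
have di0 : 0 < delta^-1 by rewrite invr_gt0.
(* With weight [delta^-1], Young's inequality returns half of [delta * energy setT z], hence at most
   half of [fz], which is absorbed. *)
have fz1 : fz <= B1 /\ energy setT z <= B0.
  have := form_young geom ell di0 Wu Wz; rewrite -/fz -/E invrK => h.
  have B1E : delta^-1 * (Cinf ^+ 2 * E) = B1 by rewrite mulrC.
  have B0E : B0 = B1 / delta by rewrite /B0 /B1; field; rewrite gt_eqF.
  by rewrite B1E in h; split; [|rewrite B0E ler_pdivlMr //]; lra.
pose u1 (e : X * X) : R[i] := if e \in F then 0 else dfe u e.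
pose u2 (e : X * X) : R[i] := if e \in F then dfe u e else 0.
pose z2 (e : X * X) : R[i] := if e \in F then dfe z e else 0.
have cut0 (G : X * X -> R[i]) (b : bool) e : cmod (if b then G e else 0) <= 1 * cmod (G e).
  by rewrite mul1r; case: b; rewrite ?cmod0 ?cmod_ge0.
have lu1 : l2s (@edges R X) mue u1.
  apply: (l2s_le mueT ler01 _ (Wd Wu)) => e _; rewrite /u1 mul1r.
  by case: ifP => _; rewrite ?cmod0 ?cmod_ge0.
have lu2 : l2s (@edges R X) mue u2.
  by apply: (l2s_le mueT ler01 _ (Wd Wu)) => e _; exact: cut0.
have lz2 : l2s (@edges R X) mue z2.
  by apply: (l2s_le mueT ler01 _ (Wd Wz)) => e _; exact: cut0.
have nu1 : nsq (@edges R X) mue u1 <= eps.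
  apply: le_trans tail; rewrite (@rsum_mkcond _ _ (@edges R X)) //.
  rewrite le_eqVlt; apply/orP; left; apply/eqP; apply: eq_rsum => e ae.
  rewrite /u1; have [eF|eF] := boolP (e \in F).
    rewrite cmod0 expr0n mul0r ifF //; apply/negbTE/negP => /set_mem[_]; apply.
    exact: set_mem.
  by rewrite ifT //; apply/mem_set; split => // Fe; move/negP: eF; apply; apply/mem_set.
have nu2 : nsq (@edges R X) mue u2 <= E.
  have := nsq_le mueT ler01 (F := u2) (fun e _ => cut0 (dfe u) (e \in F) e) (Wd Wu).
  by rewrite expr1n mul1r -energyT.
have nz2 : nsq (@edges R X) mue z2 <= k * (tau * B1).
  apply: le_trans (_ : k * nsq setT (@mass R X) z <= _); last first.
    rewrite ler_wpM2l //; apply: le_trans nz _; rewrite ler_pM2l //; by case: fz1.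
  apply: le_trans (kF z (Wl Wz)); rewrite [leRHS](@rsum_mkcond _ _ (@edges R X)) //.
  rewrite le_eqVlt; apply/orP; left; apply/eqP; apply: eq_rsum => e ae.
  by rewrite /z2; case: ifP => // _; rewrite cmod0 expr0n mul0r.
have fzsplit : form u z = pairing (@edges R X) mue (ce u1) (dfe z)
    + pairing (@edges R X) mue (ce u2) z2.
  have -> : pairing (@edges R X) mue (ce u2) z2 = pairing (@edges R X) mue (ce u2) (dfe z).
    apply: eq_csum => e _; rewrite /ce /u2 /z2; case: ifP => // _.
    by rewrite !mulr0 !mul0r.
  have -> := esym (pairingDl mueT (coeff_l2s ell lu1) (coeff_l2s ell lu2) (Wd Wz)).
  rewrite formE; apply: eq_pairing => // e _; rewrite /ce /u1 /u2; case: ifP => _;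
    by rewrite ?mulr0 ?add0r ?addr0.
have p1 := pairing_young mueT s10 (coeff_l2s ell lu1) (Wd Wz).
have p2 := pairing_young mueT s20 (coeff_l2s ell lu2) lz2.
have q1 := le_trans (coeff_nsq ell lu1) (ler_wpM2l (sqr_ge0 Cinf) nu1).
have q2 := le_trans (coeff_nsq ell lu2) (ler_wpM2l (sqr_ge0 Cinf) nu2).
have r1 : s1 * nsq (@edges R X) mue (ce u1) <= 2^-1 * e0.
  apply: le_trans (ler_wpM2l (ltW s10) q1) _; rewrite /eps le_eqVlt.
  by apply/orP; left; apply/eqP; field; rewrite !gt_eqF.
have r2 : s1^-1 * nsq (@edges R X) mue (dfe z) <= 2^-1 * e0.
  rewrite ler_pdivrMl //; apply: le_trans (_ : B0 <= _); first by rewrite -energyT; case: fz1.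
  have -> : s1 * (2^-1 * e0) = B0 + 1 by rewrite /s1; field; rewrite gt_eqF.
  lra.
have r3 : s2 * nsq (@edges R X) mue (ce u2) <= 2^-1 * e0.
  apply: le_trans (ler_wpM2l (ltW s20) q2) _.
  have CE1 : 0 < Cinf ^+ 2 * E + 1 by lra.
  rewrite /s2 mulrAC ler_pdivrMr ?mulr_gt0 //.
  have := ler_wpM2l (ltW dd) (_ : Cinf ^+ 2 * E <= Cinf ^+ 2 * E + 1); lra.
have r4 : s2^-1 * nsq (@edges R X) mue z2 <= 2^-1 * e0.
  rewrite ler_pdivrMl //; apply: le_trans nz2 _.
  have -> : k * (tau * B1) = (k * B1) * (e0 * s2) / (2 * (k * B1 + 1)).
    by rewrite /tau; ring.
  rewrite ler_pdivrMr ?mulr_gt0 //.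
  have es : 0 <= e0 * s2 by rewrite mulr_ge0 // ltW.
  have := ler_wpM2l es (_ : k * B1 <= k * B1 + 1); lra.
have fze : fz <= e0.
  rewrite /fz fzsplit; apply: le_trans (cmodD _ _) _.
  apply: le_trans (lerD p1 p2) _.
  by move: r1 r2 r3 r4; rewrite /ce; lra.
exists v; split => //.
  by apply: le_trans fze _; rewrite ge_min lexx.
rewrite -(ler_pM2l d0); apply: le_trans ez _; apply: le_trans fze _.
by rewrite ge_min lexx orbT.
Qed.

(** The inequality is known at [v] in the domain of [L], where [form v v] is [inner (op L v) v], and
    passes to [u] by approximation in the energy. *)
Lemma numerical_range (L : operator X) omega u : associated_operator c L ->
  omega_accretive omega L -> 0 < omega < pi / 2 -> W12 u ->
  cos omega * cmod (form u u) <= complex.Re (form u u).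
Proof.
move=> assocL omL om Wu; apply/ler_addgt0Pr => e e0.
set E := energy setT u; have E0 : 0 <= E := energy0 u.
have C20 := sqr_ge0 Cinf.
(* [k] collects the coefficients of [eta] in the bounds for [form z z], [form u z] and [form z u].
   Their sum is then at most [3 * e / 8]; it enters the conclusion twice, once with the factor
   [cos omega <= 1]. *)
pose s := 4 * (E + 1) / e.
have s0 : 0 < s by rewrite divr_gt0 // mulr_gt0 //; lra.
pose k := 1 + 2^-1 * (s * Cinf ^+ 2) + 2^-1 * (Cinf ^+ 2 + 1).
have sC : 0 <= s * Cinf ^+ 2 by rewrite mulr_ge0 // ltW.
have k0 : 0 < k by rewrite /k; lra.
pose eta := e / (4 * k).
have eta0 : 0 < eta by rewrite divr_gt0 // mulr_gt0.
have [v [Dv fuz ez]] := W12_form_domain_close Wu eta0.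
have Wv : W12 v by case: Dv.
have Lv := form_domain_sub assocL Dv.
have := closed_sector_Re om (omL v Lv).
have -> : inner (op L v) v = form v v by case: assocL => _ _ ->.
move=> hv; move: fuz ez; set z := fun x => v x - u x => fuz ez.
have Wz : W12 z by exact: (W12B geom).
have vE : v = (fun x => 1 * z x + u x).
  by apply/funext => x; rewrite /z mul1r subrK.
have fv : form v v = form u u + (form z z + form u z + form z u).
  rewrite {1}vE (form_lin_l geom ell) // {1 2}vE !(form_lin_r geom ell) //.
  by rewrite conjc1 !mul1r; ring.
have h1 := form_young geom ell s0 Wz Wu; have h2 := form_young geom ell ltr01 Wz Wz.
rewrite invr1 !mul1r in h2; rewrite -/E in h1.
have ez0 := energy0 z.
have g1 : s * (Cinf ^+ 2 * energy setT z) <= s * (Cinf ^+ 2 * eta).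
  by rewrite ler_pM2l // ler_wpM2l.
have g2 : s^-1 * E <= e / 4.
  rewrite ler_pdivrMl // /s; have -> : 4 * (E + 1) / e * (e / 4) = E + 1.
    by field; rewrite gt_eqF.
  lra.
have g3 : Cinf ^+ 2 * energy setT z <= Cinf ^+ 2 * eta by rewrite ler_wpM2l.
have keta : eta * k = e / 4 by rewrite /eta; field; rewrite gt_eqF.
rewrite /k in keta.
set d := form z z + form u z + form z u in fv.
have dle : cmod d <= e * (3 / 8).
  apply: le_trans (cmodD _ _) _; apply: le_trans (lerD (cmodD _ _) (lexx _)) _.
  by lra.
have c1 : cos omega <= 1 by exact: cos_le1.
have c0 : 0 <= cos omega by apply: cos_ge0_pihalf; lra.
have t1 : cmod (form u u) <= cmod (form v v) + cmod d.
  have -> : form u u = form v v - d by rewrite fv addrK.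
  exact: cmodB.
have t2 : complex.Re (form v v) <= complex.Re (form u u) + cmod d.
  rewrite fv Re_addc lerD2l; apply: le_trans (ler_norm _) (normr_Re_le _).
have t3 := ler_wpM2l c0 t1.
have t4 : cos omega * cmod d <= 1 * cmod d by rewrite ler_wpM2r ?cmod_ge0.
by lra.
Qed.

End NumericalRange.

(** * Scaling arithmetic in [lambda] *)

Section PowerArithmetic.
Context {R : realType}.
Implicit Types (a b C r n M d e S V G E U Nf : R).

Lemma le_of_sqr_le a C r n : 0 <= a -> 0 <= C -> 0 <= r -> 0 <= n ->
  a ^+ 2 <= C * (r ^+ 2 * n) -> a <= Num.sqrt C * r * Num.sqrt n.
Proof.
move=> a0 C0 r0 n0 h; rewrite -(ler_pXn2r (ltn0Sn 1)) ?nnegrE ?mulr_ge0 ?sqrtr_ge0 //.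
by rewrite !exprMn !sqr_sqrtr // -mulrA.
Qed.

(** Homogeneity: for [r ^+ 2] equal to the inverse modulus of [lambda], energy, source and squared
    norm of [u] scale like [r ^+ 2], 1 and [r ^+ 4], so every term of the local estimates scales
    like [r ^+ 2]. *)
Lemma local_bound_le (A B Q kE kG kU C0 cL r Nf E G U : R) :
  0 <= A -> 0 <= B -> 0 <= Q -> 0 < C0 -> 0 < cL -> 0 < r ->
  E <= kE * (r ^+ 2 * Nf) -> G <= kG * Nf -> U <= kU * ((r ^+ 2) ^+ 2 * Nf) ->
  A * Q * (E + 4 * C0 * r ^+ 2 * G) + B * (U / (cL * r ^+ 2)) <=
  (A * Q * (kE + 4 * C0 * kG) + B * (kU / cL)) * (r ^+ 2 * Nf).
Proof.
move=> A0 B0 Q0 C00 cL0 r0 hE hG hU.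
have r20 : 0 < r ^+ 2 by rewrite exprn_gt0.
move: (r ^+ 2) r20 hE hU => t t0 hE hU.
rewrite [leRHS]mulrDl; apply: lerD.
  rewrite -[leRHS]mulrA; apply: ler_wpM2l; first exact: mulr_ge0.
  rewrite [leRHS]mulrDl; apply: lerD => //.
  rewrite (_ : 4 * C0 * kG * (t * Nf) = 4 * C0 * t * (kG * Nf)); last by ring.
  by apply: ler_wpM2l => //; rewrite !mulr_ge0 // ltW.
rewrite -[leRHS]mulrA; apply: ler_wpM2l => //.
rewrite ler_pdivrMr ?mulr_gt0 //.
rewrite (_ : _ * (cL * t) = kU * (t ^+ 2 * Nf)) //.
by field; rewrite gt_eqF.
Qed.

Lemma holder_scale_le M d e C n : 0 < M -> 0 < d -> 0 < e -> e <= 1 -> 0 <= C -> 0 <= n ->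
  Num.sqrt ((2 * d / M `^ (- 2^-1)) `^ (2 * e) * C) * M `^ (- 2^-1) * Num.sqrt n <=
  2 * Num.sqrt C * M `^ (e / 2) * M `^ (- 2^-1) * Num.sqrt n * d `^ e.
Proof.
move=> M0 d0 e0 e1 C0 n0.
have r0 : 0 < M `^ (- 2^-1) by exact: powR_gt0.
rewrite sqrtrM ?powR_ge0 // -powR12_sqrt ?powR_ge0 // -powRrM.
rewrite (_ : 2 * e / 2 = e); last by field.
have d2 : 0 <= 2 * d by rewrite mulr_ge0 // ltW.
have ri : 0 <= (M `^ (- 2^-1))^-1 by rewrite invr_ge0 ltW.
rewrite (powRM _ d2 ri) (powRM _ _ (ltW d0)) // -powRN -powRrM opprK (mulrC 2^-1).
have two : 2 `^ e <= 2 :> R.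
  by rewrite -[leRHS]powRr1 //; apply: ler_powR => //; rewrite ler1n.
set p := M `^ (e / 2); set D := d `^ e; set s := Num.sqrt C.
set m := M `^ (- 2^-1) in r0 *; set t := Num.sqrt n.
rewrite (_ : 2 `^ e * D * p * s * m * t = 2 `^ e * (D * p * s * m * t)); last by ring.
rewrite (_ : 2 * s * p * m * t * D = 2 * (D * p * s * m * t)); last by ring.
by apply: ler_wpM2r => //; rewrite !mulr_ge0 ?powR_ge0 ?sqrtr_ge0.
Qed.

End PowerArithmetic.

(** * The resolvent equation: existence, uniqueness and estimates *)

Section Resolvent.
Context {R : realType} (X : wgraph R) (N : nat) (CW Cmu Cinf delta kappa : R).
Hypothesis geom : bounded_geometry X N CW Cmu.
Variables (c : X -> X -> R[i]) (lambda a : R[i]).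
Hypothesis ell : uniformly_elliptic Cinf delta c.
Hypotheses (kappa_gt0 : 0 < kappa) (lambda_neq0 : lambda <> 0) (cmod_a : cmod a = 1).

Local Notation L2u u := (l2s setT (@mass R X) u).
Local Notation nrm u := (nsq setT (@mass R X) u).
Local Notation form := (Defs.form c).
Local Notation M := (cmod lambda).

Hypothesis sector_coercive : forall u : X -> R[i], W12 u ->
  kappa * (cmod (form u u) + M * nrm u) <=
  complex.Re (a * (form u u + lambda * inner u u)).

Implicit Types u v f : X -> R[i].

Let massT x : [set: X] x -> 0 <= mass x.
Proof. exact: (mass_ge0 geom). Qed.
Let Wl u : W12 u -> L2u u. Proof. by case/(W12_l2 geom). Qed.
Let d0 : 0 < delta. Proof. by case: (ellipticity_constants ell). Qed.
Let n0 u : 0 <= nrm u. Proof. exact: (nsq_ge0 massT). Qed.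
Let e0 u : 0 <= energy setT u.
Proof. by rewrite energyT; apply: nsq_ge0; exact: mue_ge0T. Qed.
Let M0 : 0 < M. Proof. exact: cmod_gt0. Qed.
Let a0 : a != 0.
Proof. by apply/eqP => az; move: cmod_a; rewrite az cmod0 => /eqP; rewrite eq_sym oner_eq0. Qed.

(** The modulus of [form u u] dominates its real part, so ellipticity turns the sector bound into
    coercivity. *)
Lemma resolvent_coercive u : W12 u ->
  kappa * (delta * energy setT u + M * nrm u) <=
  complex.Re (a * (form u u + lambda * inner u u)).
Proof.
move=> Wu; apply: le_trans (sector_coercive Wu); rewrite ler_pM2l // lerD2r.
apply: le_trans (garding ell Wu) _.
by apply: le_trans (ler_norm _) (normr_Re_le _).
Qed.

Lemma weak_solution_exists f : L2u f -> exists u, weak_solution c lambda f u.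
Proof.
move=> lf; pose k := kappa * Num.min delta M.
have k0 : 0 < k by rewrite mulr_gt0 // lt_min d0.
have [|u [Wu Hu]] := solve geom ell (alpha := a) (beta := a * lambda)
    (f := fun x => a * f x) k0 _ (l2sZ massT a lf).
  move=> u Wu; rewrite -mulrA -mulrDr; apply: le_trans (resolvent_coercive Wu).
  rewrite /k -mulrA ler_pM2l // mulrDr addrC.
  by apply: lerD; apply: ler_wpM2r; rewrite // ge_min lexx ?orbT.
exists u; split => // v Wv; apply: (mulfI a0).
have aE : inner (fun x => a * f x) v = a * inner f v.
  by apply: (pairingZl massT) => //; exact: Wl.
by rewrite -aE -Hu // mulrDr mulrA.
Qed.

Lemma weak_solution_unique f u v :
  weak_solution c lambda f u -> weak_solution c lambda f v -> u = v.
Proof.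
move=> [Wu Hu] [Wv Hv].
pose w x := -1 * v x + u x.
have Ww : W12 w by exact: (W12_lin geom).
have := resolvent_coercive Ww.
have -> : form w w + lambda * inner w w = 0.
  rewrite {1}/w (form_lin_l geom ell (-1) Wv Wu Ww).
  rewrite {1}/w (inner_lin_l geom (-1) (Wl Wv) (Wl Wu) (Wl Ww)).
  have := Hu w Ww; have := Hv w Ww; move: (inner f w) (form u w) (form v w) => fw fu fv.
  move: (inner u w) (inner v w) => iu iv <- h.
  have -> : -1 * fv + fu + lambda * (-1 * iv + iu) =
      (fu + lambda * iu) - (fv + lambda * iv) by ring.
  by rewrite h subrr.
rewrite mulr0 /= => h.
have nw : nrm w <= 0.
  move: h; rewrite pmulr_rle0 // => h.
  have p := mulr_ge0 (ltW d0) (e0 w); rewrite -(pmulr_rle0 _ M0).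
  by apply: le_trans h; rewrite lerDr.
apply/funext => x; apply/eqP; rewrite -subr_eq0 -cmod_eq0 -sqrf_eq0 eq_le sqr_ge0 andbT.
have := sqr_cmod_le_nsq geom x (Wl Ww).
rewrite {1}/w mulN1r addrC => le; apply: le_trans le _.
by rewrite mulr_ge0_le0 // invr_ge0 ltW // (mass_gt0 geom).
Qed.

Section APriori.
Variables f u : X -> R[i].
Hypotheses (lf : L2u f) (wu : weak_solution c lambda f u).

Let Wu : W12 u. Proof. by case: wu. Qed.

Let young_absorb (k m d e n p q : R) : k * (d + m) <= q ->
  q <= 2^-1 * p + 2^-1 * (k * m) -> 2 * (k * d) + k * m <= p.
Proof. lra. Qed.

Lemma weak_solution_energy_le :
  2 * (kappa * (delta * energy setT u)) + kappa * (M * nrm u) <= (kappa * M)^-1 * nrm f.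
Proof.
(* With this weight Young's inequality returns half of [kappa * (M * nrm u)], which is absorbed on
   the left. *)
have kM : 0 < (kappa * M)^-1 by rewrite invr_gt0 mulr_gt0.
apply: young_absorb (resolvent_coercive Wu) _ => //.
case: wu => _ -> //.
apply: le_trans (ler_norm _) _; apply: le_trans (normr_Re_le _) _.
rewrite cmodM cmod_a mul1r.
have := pairing_young massT kM lf (Wl Wu); rewrite invrK.
by rewrite -[pairing _ _ f u]/(inner f u) -[kappa * M * _]mulrA.
Qed.

Lemma weak_solution_nsq_le : nrm u <= (kappa ^+ 2)^-1 * (M^-1 ^+ 2 * nrm f).
Proof.
have := weak_solution_energy_le.
have : 0 <= 2 * (kappa * (delta * energy setT u)).
  by apply: mulr_ge0 => //; apply: mulr_ge0; [exact: ltW|apply: mulr_ge0 => //; exact: ltW].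
move: (2 * _) => p p0 h.
have {p p0}h : kappa * (M * nrm u) <= (kappa * M)^-1 * nrm f by lra.
rewrite -(ler_pM2l kappa_gt0) -(ler_pM2l M0) mulrCA; apply: le_trans h _.
by rewrite le_eqVlt; apply/orP; left; apply/eqP; field; rewrite !gt_eqF.
Qed.

Lemma weak_solution_dirichlet_le :
  energy setT u <= (2 * kappa ^+ 2 * delta)^-1 * (M^-1 * nrm f).
Proof.
have := weak_solution_energy_le.
have : 0 <= kappa * (M * nrm u).
  by apply: mulr_ge0; [exact: ltW|apply: mulr_ge0 => //; exact: ltW].
move: (kappa * (M * _)) => p p0 h.
have {p p0}h : 2 * (kappa * (delta * energy setT u)) <= (kappa * M)^-1 * nrm f by lra.
have k2 : 0 < 2 * kappa * delta by rewrite !mulr_gt0.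
rewrite -(ler_pM2l k2) -!mulrA; apply: le_trans h _.
by rewrite le_eqVlt; apply/orP; left; apply/eqP; field; rewrite !gt_eqF.
Qed.

(** The source is [f - lambda * u]. Since [M ^+ 2 * nrm u] is bounded by a multiple of [nrm f],
    moving [lambda * u] to the right costs a factor independent of [lambda]. *)
Lemma weak_solution_source : exists g : X -> R[i],
  [/\ L2u g, nrm g <= (2 + 2 * (kappa ^+ 2)^-1) * nrm f
    & forall v, W12 v -> form u v = inner g v].
Proof.
pose g x := - lambda * u x + f x.
have lu : L2u (fun x => - lambda * u x) by apply: (l2sZ massT); exact: Wl.
exists g; split; first exact: (l2sD massT).
  apply: le_trans (nsqD_le massT lu lf) _; rewrite (nsqZ _ (Wl Wu)) cmodN.
  have := ler_wpM2l (sqr_ge0 M) weak_solution_nsq_le.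
  have -> : M ^+ 2 * ((kappa ^+ 2)^-1 * (M^-1 ^+ 2 * nrm f)) = (kappa ^+ 2)^-1 * nrm f.
    by field; rewrite !gt_eqF.
  by lra.
move=> v Wv.
have -> : inner g v = - lambda * inner u v + inner f v.
  exact: (inner_lin_l geom (- lambda) (Wl Wu) lf (Wl Wv)).
case: wu => _ /(_ v Wv) <-.
by move: (form u v) (inner u v) => F I; ring.
Qed.

End APriori.

Section PointwiseBounds.
Variables (CD CP cL C0 : R) (q : nat).
Hypotheses (dbl : doubling X CD) (poin : poincare2 X CP) (lowv : lower_volume2 X cL).
Hypotheses (q_gt0 : (0 < q)%N) (C0_gt0 : 0 < C0).
Hypothesis decay : forall u g, W12 u -> L2u g ->
  (forall v, W12 v -> form u v = inner g v) ->
  forall o rho, 0 < rho -> hv o <= CW * (rho / 2 ^+ q) ->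
  energy (gball o (rho / 2 ^+ q)) u <=
  2^-1 * energy (gball o rho) u + C0 * rho ^+ 2 * nrm g.
Variables f u : X -> R[i].
Hypotheses (lf : L2u f) (wu : weak_solution c lambda f u).

Let Q := `|CP| * (N%:R * Cmu) * 4 ^+ q / cL.
(** [A] and [B] are the numerical coefficients of the local estimates: (32, 2) for [sup_bound] and
    (216, 8) for [holder_bound]. *)
Let K A B := A * Q * ((2 * kappa ^+ 2 * delta)^-1 +
  4 * C0 * (2 + 2 * (kappa ^+ 2)^-1)) + B * ((kappa ^+ 2)^-1 / cL).
Let r := M `^ (- 2^-1).
Let r0 : 0 < r. Proof. exact: powR_gt0. Qed.
Let rM : r ^+ 2 = M^-1.
Proof.
rewrite -powR_mulrn ?powR_ge0 // -powRrM -[RHS]powR_inv1 ?cmod_ge0 //.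
by congr (_ `^ _); field.
Qed.
Let cL0 : 0 < cL. Proof. by case: lowv. Qed.
Let Q0 (x : X) : 0 <= Q.
Proof.
apply: divr_ge0; last exact: ltW.
apply: mulr_ge0; last exact: exprn_ge0.
by apply: mulr_ge0 => //; apply: le_trans ler01 (NCmu_ge1 geom x).
Qed.
Let K0 (x : X) A B : 0 <= A -> 0 <= B -> 0 <= K A B.
Proof.
move=> A0 B0; have k2 : 0 <= (kappa ^+ 2)^-1 by rewrite invr_ge0 sqr_ge0.
apply: addr_ge0; last by apply: mulr_ge0 => //; apply: divr_ge0 => //; exact: ltW.
apply: mulr_ge0; first exact: mulr_ge0 (Q0 x).
apply: addr_ge0.
  rewrite invr_ge0; apply: mulr_ge0; last exact: ltW.
  by apply: mulr_ge0 => //; exact: sqr_ge0.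
apply: mulr_ge0; first by apply: mulr_ge0 => //; exact: ltW.
by apply: addr_ge0 => //; apply: mulr_ge0.
Qed.

Let scaled A B G : X -> 0 <= A -> 0 <= B ->
  G <= (2 + 2 * (kappa ^+ 2)^-1) * nrm f ->
  A * Q * (energy setT u + 4 * C0 * r ^+ 2 * G) + B * (nrm u / (cL * r ^+ 2)) <=
  K A B * (r ^+ 2 * nrm f).
Proof.
move=> x A0 B0 hG; apply: local_bound_le => //; first exact: Q0 x.
  by rewrite rM; exact: weak_solution_dirichlet_le.
by rewrite rM; exact: weak_solution_nsq_le.
Qed.

Lemma weak_solution_sup_le o :
  cmod (u o) <= Num.sqrt (K 32 2) * r * Num.sqrt (nrm f).
Proof.
have [g [lg ng Hg]] := weak_solution_source lf wu.
have Wu : W12 u by case: wu.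
apply: le_of_sqr_le; rewrite ?cmod_ge0 ?(ltW r0) ?(K0 o) //.
apply: le_trans (sup_bound geom dbl poin lowv q_gt0 C0_gt0 (n0 g) Wu (decay Wu lg Hg) o r0) _.
exact: (scaled o).
Qed.

Lemma weak_solution_holder_le x y : x <> y ->
  cmod (u x - u y) <= 2 * Num.sqrt (K 216 8) * M `^ ((2 * q%:R)^-1 / 2) * r
    * Num.sqrt (nrm f) * dist x y `^ ((2 * q%:R)^-1).
Proof.
move=> xy; have [g [lg ng Hg]] := weak_solution_source lf wu.
have Wu : W12 u by case: wu.
have q0 : 0 < q%:R :> R by rewrite ltr0n.
have e1 : (2 * q%:R)^-1 <= 1 :> R.
  by rewrite invf_le1 ?mulr_gt0 // -natrM ler1n muln_gt0.
have q20 : 0 < (2 * q%:R)^-1 :> R by rewrite invr_gt0 mulr_gt0.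
have Kx : 0 <= K 216 8 by exact: (K0 x).
apply: le_trans (holder_scale_le M0 (dist_gt0 geom xy) q20 e1 Kx (n0 f)).
have qE : 2 * (2 * q%:R)^-1 = q%:R^-1 :> R by field; rewrite gt_eqF.
rewrite qE; apply: le_of_sqr_le; rewrite ?cmod_ge0 ?(ltW r0) ?mulr_ge0 ?powR_ge0 //.
have yx : y <> x by exact: nesym.
apply: le_trans (holder_bound geom dbl poin lowv q_gt0 C0_gt0 (n0 g) Wu (decay Wu lg Hg) r0 yx) _.
rewrite -[leRHS]mulrA; apply: ler_wpM2l; first exact: powR_ge0.
exact: (scaled x).
Qed.

End PointwiseBounds.

End Resolvent.

(** * Uniform choice of the constants and conclusion *)

Theorem theorem5p3 (R : realType)
    (N : nat) (CW Cmu CD cL CP Cinf delta omega nu : R)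
    (homega : 0 < omega < pi / 2) (hnu : pi / 2 < nu < pi - omega) :
  exists C eta : R, 0 < C /\ 0 < eta /\
  forall X : wgraph R,
    bounded_geometry X N CW Cmu ->
    doubling X CD -> lower_volume2 X cL -> poincare2 X CP ->
  forall (c : X -> X -> R[i]) (L : operator X),
    uniformly_elliptic Cinf delta c -> associated_operator c L ->
    omega_accretive omega L ->
  forall (f : X -> R[i]) (lambda : R[i]),
    L2 f -> open_sector nu lambda -> lambda <> 0 ->
    (exists! u : X -> R[i], weak_solution c lambda f u) /\
    (forall u : X -> R[i], weak_solution c lambda f u ->
       (normLinf u <= (C * cmod lambda `^ (- 2^-1))%:E * normL2 f)%E /\
       (holder_seminorm eta u <=
          (C * cmod lambda `^ (eta / 2) * cmod lambda `^ (- 2^-1))%:E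
          * normL2 f)%E).
Proof.
(* The constants are given before any graph and without sign conditions. If one of these
   inequalities fails, no graph and coefficients can satisfy the hypotheses, since an infinite graph
   has a vertex, and 1 serves for both constants. *)
have [[d0 [Ci0 [CW1 NC0]]]|bad] :=
  pselect (0 < delta /\ 0 < Cinf /\ 1 <= CW /\ 0 <= N%:R * Cmu); last first.
  exists 1, 1; split => //; split => // X geom dbl lowv poin c L ell.
  have [x _] := infinite_setN0 (@wgraph_infinite R X).
  case: bad; have [Ci0 d0] := ellipticity_constants ell.
  split => //; split => //; split; first by case: geom.
  exact: le_trans ler01 (NCmu_ge1 geom x).
(* [q] and [C0] are obtained before the graph is introduced, which makes [C] and [eta] uniform over
   all graphs with the given constants. *)
have [q [C0 [q0 C00 decay]]] := energy_decay (N := N) CP Ci0 d0 CW1 NC0.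
pose kappa := cos ((nu + omega) / 2).
have k0 : 0 < kappa.
  by apply: cos_gt0_pihalf; move: homega hnu => /andP[? ?] /andP[? ?]; apply/andP; split; lra.
pose Q := `|CP| * (N%:R * Cmu) * 4 ^+ q / cL.
pose K A B := A * Q * ((2 * kappa ^+ 2 * delta)^-1 +
  4 * C0 * (2 + 2 * (kappa ^+ 2)^-1)) + B * ((kappa ^+ 2)^-1 / cL).
(* The [+ 1] makes [C] positive whatever the square roots are; the sign of [cL] is not yet known
   here. *)
pose C := Num.sqrt (K 32 2) + 2 * Num.sqrt (K 216 8) + 1.
have s1 := sqrtr_ge0 (K 32 2); have s2 := sqrtr_ge0 (K 216 8).
have C10 : 0 < C by rewrite /C; lra.
have C1 : Num.sqrt (K 32 2) <= C by rewrite /C; lra.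
have C2 : 2 * Num.sqrt (K 216 8) <= C by rewrite /C; lra.
exists C, (2 * q%:R)^-1; split => //; split; first by rewrite invr_gt0 mulr_gt0 // ltr0n.
move=> X geom dbl lowv poin c L ell assoc acc f lambda L2f sl l0.
have lf : l2s setT (@mass R X) f by apply/(normL2_fin geom).
have [a [a1 al aS]] := sector_rotation homega hnu l0 sl.
have coer (u : X -> R[i]) : W12 u ->
    kappa * (cmod (Defs.form c u u) + cmod lambda * nsq setT (@mass R X) u) <=
    complex.Re (a * (Defs.form c u u + lambda * inner u u)).
  move=> Wu; rewrite mulrDr (mulrDr a) Re_addc; apply: lerD.
    by apply: aS; exact: (numerical_range geom ell assoc acc).
  have -> : inner u u = (nsq setT (@mass R X) u)%:C%C by exact: pairing_self.
  rewrite (mulrA a) Re_mulc /= mulr0 subr0 mulrA; apply: ler_wpM2r => //.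
  by apply: nsq_ge0; exact: (mass_ge0 geom).
have dec := decay X CD geom dbl poin c ell.
split.
  have [u wu] := weak_solution_exists geom ell k0 l0 a1 coer lf.
  by exists u; split => // v wv; exact: (weak_solution_unique geom ell k0 l0 coer wu wv).
move=> u wu; rewrite (normL2E geom lf) -!EFinM; split.
  apply: ge_ereal_sup => e; case=> o _ <-; rewrite lee_fin.
  apply: le_trans (weak_solution_sup_le geom ell k0 l0 a1 coer dbl poin lowv q0 C00 dec lf wu o) _.
  apply: ler_wpM2r; first exact: sqrtr_ge0.
  by apply: ler_wpM2r; [exact: powR_ge0|exact: C1].
apply: ge_ereal_sup => e; case=> -[x y] /= xy <-; rewrite lee_fin.
rewrite ler_pdivrMr; last by apply: powR_gt0; exact: (dist_gt0 geom xy).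
apply: le_trans (weak_solution_holder_le geom ell k0 l0 a1 coer dbl poin lowv q0 C00 dec lf wu xy) _.
apply: ler_wpM2r; first exact: powR_ge0.
apply: ler_wpM2r; first exact: sqrtr_ge0.
do 2![apply: ler_wpM2r; first exact: powR_ge0].
exact: C2.
Qed.
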